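(* Let $M$ be a real hypersurface in $\mathbb{C}P^m$, $m\geq 3$. Then $A_F$ is $\eta$-pure with respect to $\phi$, that is, $A_F(\phi X,Y)=A_F(X,\phi Y)$ for any $X,Y\in\mathbb{D}$, if and only if $M$ is locally congruent to a ruled real hypersurface.
   Context: $\mathbb{C}P^m$ is complex projective space with its Kaehlerian structure $(J,g)$, where $g$ is the Fubini-Study metric of constant holomorphic sectional curvature $4$. All manifolds, vector fields, etc. are of class $C^\infty$. A real hypersurface $M$ is connected and without boundary; $g$ also denotes the induced metric on $M$ and $\nabla$ the Levi-Civita connection of $M$. $N$ is a locally defined unit normal vector field on $M$, $A$ is the shape operator of $M$ associated to $N$ (so $AX=-\overline{\nabla}_XN$, with $\overline{\nabla}$ the Levi-Civita connection of $\mathbb{C}P^m$), and $\xi=-JN$ is the structure (Reeb) vector field. For $X$ tangent to $M$ write $JX=\phi X+\eta(X)N$, where $\phi X$ is the tangential component of $JX$ and $\eta(X)=g(X,\xi)$; $\phi$ is called the structure tensor. $\mathbb{D}$ is the maximal holomorphic distribution on $M$, consisting at each point of the tangent vectors orthogonal to $\xi$. For a nonzero real number $k$ and $X,Y$ tangent to $M$, set $F^{(k)}_XY=g(\phi AX,Y)\xi-\eta(Y)\phi AX-k\eta(X)\phi Y$ (the $k$-th Cho operator). If $X\in\mathbb{D}$ this does not depend on $k$ and is written $F_XY=g(\phi AX,Y)\xi-\eta(Y)\phi AX$. For $X\in\mathbb{D}$ and $Y$ tangent to $M$, $A_F(X,Y)=[F_X,A]Y=F_XAY-AF_XY$. A real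 hypersurface of $\mathbb{C}P^m$ is ruled if $\mathbb{D}$ is integrable and its integral manifolds are totally geodesic $\mathbb{C}P^{m-1}$'s (open parts thereof); equivalently, $g(AX,Y)=0$ for all $X,Y\in\mathbb{D}$. *)

(* Defs.v *)
From HB Require Import structures.
From mathcomp Require Import all_boot all_order all_algebra.
From mathcomp Require Import all_classical all_reals all_analysis.
From mathcomp Require Import complex.

Set Implicit Arguments.
Unset Strict Implicit.
Unset Printing Implicit Defensive.

Import Order.TTheory GRing.Theory Num.Theory.
Import numFieldNormedType.Exports.

Local Open Scope classical_set_scope.
Local Open Scope ring_scope.
Local Open Scope complex_scope.
Local Open Scope sesquilinear_scope.

Section Smoothness.
Variable R : realType.

Fixpoint iter_derive (V W : normedModType R) (vs : seq V) (f : V -> W)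
    : V -> W :=
  if vs is v :: vs' then iter_derive vs' (fun x => 'D_v f x) else f.

(* C^oo on an open set [U]. *)
Definition smooth_on (V W : normedModType R) (U : set V) (f : V -> W) : Prop :=
  forall (vs : seq V) (x : V), U x -> differentiable (iter_derive vs f) x.

(* Complex matrices are seen as a real vector space: maps into them are
   differentiated through the real and imaginary parts of the entries. *)
Definition msmooth_on (V : normedModType R) (p : nat) (U : set V)
    (F : V -> 'M[R[i]]_p) : Prop :=
  forall i j, smooth_on U (fun x => complex.Re (F x i j) : R)
           /\ smooth_on U (fun x => complex.Im (F x i j) : R).

Definition mderive (V : normedModType R) (p : nat) (F : V -> 'M[R[i]]_p)
    (x v : V) : 'M[R[i]]_p :=
  \matrix_(i, j) ('D_v (fun y => complex.Re (F y i j) : R) x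
                  +i* 'D_v (fun y => complex.Im (F y i j) : R) x).

End Smoothness.

Section Manifolds.
Variable R : realType.

(* A chart is given by its inverse, a parametrization of an open subset of [T]
   by an open subset [dom] of R^n; values outside [dom] are irrelevant. *)
Record chart (n : nat) (T : Type) := Chart {
  dom : set 'rV[R]_n;
  param :> 'rV[R]_n -> T }.

Definition is_chart (n : nat) (T : topologicalType) (c : chart n T) : Prop :=
  [/\ open (dom c),
      {within dom c, continuous c},
      set_inj (dom c) c &
      forall W, open W -> W `<=` dom c -> open (c @` W)].

(* [h] is smooth on [W] when read in the chart [c]. *)
Definition smooth_in_chart (k n : nat) (T : Type) (W : set 'rV[R]_k)
    (h : 'rV[R]_k -> T) (c : chart n T) : Prop :=
  exists e : 'rV[R]_k -> 'rV[R]_n,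
    smooth_on W e /\ forall u, W u -> dom c (e u) /\ c (e u) = h u.

Record smooth_manifold (n : nat) := SmoothManifold {
  points :> topologicalType;
  atlas : set (chart n points);
  _ : hausdorff_space points;
  _ : @second_countable points;
  _ : forall c, atlas c -> is_chart c;
  _ : forall q : points, exists c, atlas c /\ (c @` dom c) q;
  _ : forall c c', atlas c -> atlas c' ->
      forall W, open W -> W `<=` dom c `&` c @^-1` (c' @` dom c') ->
      smooth_in_chart W c c' }.

Definition smooth_map_on (n n' : nat) (M : smooth_manifold n)
    (M' : smooth_manifold n') (U : set M) (h : M -> M') : Prop :=
  {within U, continuous h} /\
  forall c c', atlas c -> atlas c' ->
    forall W, open W ->
      W `<=` dom c `&` c @^-1` (U `&` h @^-1` (c' @` dom c')) ->
      smooth_in_chart W (h \o c) c'.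

(* Smooth maps from an open subset [W0] of R^k to a manifold. *)
Definition smooth_patch (k n : nat) (M : smooth_manifold n)
    (W0 : set 'rV[R]_k) (y : 'rV[R]_k -> M) : Prop :=
  {within W0, continuous y} /\
  forall c, atlas c ->
    forall W, open W -> W `<=` W0 `&` y @^-1` (c @` dom c) ->
      smooth_in_chart W y c.

Definition diffeo_on (n : nat) (M M' : smooth_manifold n) (U : set M)
    (U' : set M') (h : M -> M') : Prop :=
  exists h' : M' -> M,
    [/\ smooth_map_on U h, smooth_map_on U' h',
        forall q, U q -> U' (h q) /\ h' (h q) = q &
        forall q, U' q -> U (h' q) /\ h (h' q) = q].

End Manifolds.

(* CP^m is modelled as the set of orthogonal projections of C^(m+1) onto complex
   lines (a line is identified with the projection P onto it), a submanifold of
   the real vector space of Hermitian matrices.  Writing v^H for the conjugate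
   transpose: if z is a unit vector of the line, then P = z z^H and the tangent
   vectors at P are the v z^H + z v^H, for v in C^(m+1) orthogonal to z. *)
Section ProjectiveSpace.
Variables (R : realType) (m : nat).
Local Notation mat := 'M[R[i]]_m.+1.

Definition CP : set mat :=
  [set P | [/\ P^t* = P, P *m P = P & \tr P = 1]].

Definition CP_tangent (P : mat) : set mat :=
  [set X | X^t* = X /\ X *m P + P *m X = X].

(* v z^H + z v^H |-> (i v) z^H + z (i v)^H *)
Definition CP_J (P X : mat) : mat := (0 +i* 1) *: (X *m P - P *m X).

(* g(v z^H + z v^H, w z^H + z w^H) = Re <v, w>: the metric making the Hopf map
   z |-> z z^H from the unit sphere S^(2m+1) onto CP^m a Riemannian submersion, whose holomorphic sectional
   curvature is 4. *)
Definition CP_metric (X Y : mat) : R := complex.Re (\tr (X *m Y)) / 2.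

(* Orthogonal projection of Hermitian matrices onto the tangent space at P. *)
Definition CP_proj (P X : mat) : mat :=
  P *m X *m (1%:M - P) + (1%:M - P) *m X *m P.

(* The isometries of CP^m are those induced by the unitary and the antiunitary
   transformations of C^(m+1). *)
Definition CP_isometry (Psi : mat -> mat) : Prop :=
  exists U : mat, U \is unitarymx /\
    ((forall P, Psi P = U *m P *m U^t*) \/
     (forall P, Psi P = U *m map_mx Num.conj P *m U^t*)).

(* The totally geodesic CP^(m-1)'s are the projective hyperplanes, that is,
   the sets of lines orthogonal to a given nonzero vector. *)
Definition CP_hyperplane (w : 'cV[R[i]]_m.+1) : set mat :=
  [set P | CP P /\ P *m w = 0].

End ProjectiveSpace.

Section Hypersurfaces.
Variables (R : realType) (m : nat).
Local Notation mat := 'M[R[i]]_m.+1.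
Local Notation hmanifold := (smooth_manifold R m.*2.-1).

(* Real hypersurfaces are immersed: [f] need not be injective. *)
Definition real_hypersurface (M : hmanifold) (f : M -> mat) : Prop :=
  [/\ connected [set: M],
      forall q, CP (f q),
      forall c, atlas c -> msmooth_on (dom c) (f \o c) &
      forall c, atlas c -> forall u, dom c u ->
        forall v, mderive (f \o c) u v = 0 -> v = 0].

Section Geometry.
Variables (M : hmanifold) (f : M -> mat).

(* Tangent vectors of M are identified with their images under df. *)
Definition tangent (q : M) : set mat :=
  [set X | exists c u v, [/\ atlas c, dom c u, c u = q &
                             X = mderive (f \o c) u v]].

(* Derivative at [q] of a map [h] in the direction of a tangent vector [X];
   it does not depend on the chart. *)
Definition deriv_along (h : M -> mat) (q : M) (X : mat) : mat :=
  xget 0 [set Z | exists c u v, [/\ atlas c, dom c u, c u = q,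
    mderive (f \o c) u v = X & mderive (h \o c) u v = Z]].

(* Levi-Civita connection of CP^m, on vector fields along f: as for any
   submanifold of a Euclidean space, the tangential part of the derivative. *)
Definition CP_nabla (q : M) (X : mat) (Z : M -> mat) : mat :=
  CP_proj (f q) (deriv_along Z q X).

Definition unit_normal_at (q : M) (n : mat) : Prop :=
  [/\ CP_tangent (f q) n, CP_metric n n = 1 &
      forall X, tangent q X -> CP_metric X n = 0].

Definition unit_normal_field (U : set M) (N : M -> mat) : Prop :=
  (forall c, atlas c -> msmooth_on (dom c `&` c @^-1` U) (N \o c)) /\
  forall q, U q -> unit_normal_at q (N q).

(* The maximal holomorphic distribution: the tangent vectors orthogonal to
   xi = - J n, for n a unit normal vector (defined up to sign). *)
Definition holo_dist (q : M) : set mat :=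
  [set X | tangent q X /\
     forall n, unit_normal_at q n -> CP_metric X (- CP_J (f q) n) = 0].

Section ShapeOperator.
Variables (N : M -> mat) (q : M).

Definition xi : mat := - CP_J (f q) (N q).

Definition eta (X : mat) : R := CP_metric X xi.

Definition phi (X : mat) : mat := CP_J (f q) X - (eta X)%:C *: N q.

Definition shape (X : mat) : mat := - CP_nabla q X N.

(* The k-th Cho operator for X in the holomorphic distribution, where the term
   - k eta(X) phi Y vanishes. *)
Definition cho (X Y : mat) : mat :=
  (CP_metric (phi (shape X)) Y)%:C *: xi - (eta Y)%:C *: phi (shape X).

Definition cho_shape (X Y : mat) : mat := cho X (shape Y) - shape (cho X Y).

End ShapeOperator.

(* Expressed with all the local unit normal fields, on open sets. *)
Definition eta_pure : Prop :=
  forall (U : set M) (N : M -> mat), open U -> unit_normal_field U N ->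
  forall q, U q -> forall X Y, holo_dist q X -> holo_dist q Y ->
    cho_shape N q (phi N q X) Y = cho_shape N q X (phi N q Y).

(* A connected parametrized integral manifold of the holomorphic distribution. *)
Definition integral_patch (W : set 'rV[R]_(m.*2 - 2))
    (y : 'rV[R]_(m.*2 - 2) -> M) : Prop :=
  [/\ open W, connected W, smooth_patch W y &
      forall u, W u ->
        (forall v, mderive (f \o y) u v = 0 -> v = 0) /\
        range (mderive (f \o y) u) = holo_dist (y u)].

(* An integral manifold, being of dimension 2m - 2, is an open part of a totally
   geodesic CP^(m-1) as soon as it is contained in it. *)
Definition ruled : Prop :=
  (forall q : M, exists W y, integral_patch W y /\ (y @` W) q) /\
  (forall W y, integral_patch W y ->
     exists w, w != 0 /\ (f \o y) @` W `<=` CP_hyperplane w).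

End Geometry.

Definition locally_congruent_to_ruled (M : hmanifold) (f : M -> mat) : Prop :=
  forall q : M, exists (M' : hmanifold) (f' : M' -> mat),
    [/\ real_hypersurface f', ruled f' &
        exists (Psi : mat -> mat) (U : set M) (U' : set M') (h : M -> M'),
          [/\ CP_isometry Psi, open U /\ U q, open U',
              diffeo_on U U' h &
              forall p, U p -> f' (h p) = Psi (f p)]].

End Hypersurfaces.

(* Main.v *)
(* Put P = z z^H, and let the unit normal at P be N = w z^H + z w^H with w a unit vector
   orthogonal to z.  The projection G = N P N onto the line of w does not depend on the
   sign of N, and dN(X) = - AX + (N X + X N)(1 - 2 P) for X in D.  Hence g(AX, Y) = 0 for
   all X, Y in D if and only if dG vanishes on D.  In that case w is constant up to phase
   along the integral manifolds of D, which therefore lie in the hyperplane orthogonal to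
   w.  They exist without Frobenius' theorem: since <dG(xi), xi> = -1, they are the level
   sets of the scalar function <G, xi_0>, xi_0 being the value of xi at a fixed point, and
   the scalar implicit function theorem parametrizes them.
   eta-purity is an algebraic condition on A at each point, which gives the result unless
   A xi = alpha xi.  In that case the Codazzi equation, read as the exterior derivative of
   the form g(dN, xi) = - alpha eta, contradicts eta-purity unless g(AX, Y) = 0 on D. *)

From HB Require Import structures.
From mathcomp Require Import all_boot all_order all_algebra.
From mathcomp Require Import all_classical all_reals all_analysis.
From mathcomp Require Import complex ring lra.
Require Import Defs.

Set Implicit Arguments.
Unset Strict Implicit.
Unset Printing Implicit Defensive.

Import Order.TTheory GRing.Theory Num.Theory.
Import numFieldNormedType.Exports.

Local Open Scope classical_set_scope.
Local Open Scope ring_scope.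
Local Open Scope complex_scope.
Local Open Scope sesquilinear_scope.

(** * Calculus *)

(** Write a(X) = g(AX, xi) and b(X, Y) = g(AX, Y). Purity is used by components. The D-component of
    A_F involves only a and b, and forces b = 0 on D as soon as a is nonzero on D. The xi-component
    is used when a = 0 on D, together with the Codazzi equation, which requires a = 0 on a whole
    neighbourhood. Hence the contrapositive form: if b is nonzero at a point, it is nonzero nearby,
    so a = 0 nearby, and Codazzi at the point leaves |X| = 0. Vectors keep constant coordinates in a
    chart and CP^m sits in the space of matrices, so that forms become scalar functions of the
    point. A field in D extending x is eta(e) x - eta(x) e, where e gives xi at the point
    considered. For the way back, a patch in the hyperplane of w satisfies F w = 0. Differentiating,
    X w = 0 for X in D, whence G w = w: the rank one projection G is constant along the patch. Both
    sides of the equivalence are thus compared with the pointwise condition b = 0 on D. It gives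
    purity because AX is then a multiple of xi and phi xi = 0, so that F_X = 0. *)

Section Calculus.
Variable R : realType.
Implicit Types V W X : normedModType R.

Lemma differentiable_eps V W (f : V -> W) x : differentiable f x ->
  forall e, 0 < e -> \forall h \near 0, `|f (h + x) - f x - 'd f x h| <= e * `|h|.
Proof.
move=> /diff_locally /eqaddoP df e e0.
by have := df e e0; apply: filterS => h /=; rewrite !fctE opprD addrA.
Qed.

Lemma eps_differentiable V W (f : V -> W) (L : {linear V -> W}) x :
  continuous L ->
  (forall e, 0 < e -> \forall h \near 0, `|f (h + x) - f x - L h| <= e * `|h|) ->
  differentiable f x /\ 'd f x = L :> (V -> W).
Proof.
move=> cL H.
have E : f \o shift x = cst (f x) + L +o_ 0 id.
  apply/eqaddoP => e e0; have := H e e0; apply: filterS => h /=.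
  by rewrite !fctE opprD addrA.
have dL := diff_unique cL E.
by split=> //; apply/diff_locallyP; rewrite dL.
Qed.

Lemma near_shift0 V (P : set V) (t : V) :
  (\forall x \near t, P x) -> \forall h \near (0 : V), P (h + t).
Proof. by rewrite (near_shift 0) /=; apply: filterS => h /=; rewrite subr0. Qed.

Lemma near_eq_differentiable V W (f g : V -> W) x :
  (\near x, f x = g x) -> differentiable f x -> differentiable g x.
Proof.
move=> fg df.
suff H : forall e, 0 < e ->
    \forall h \near 0, `|g (h + x) - g x - 'd f x h| <= e * `|h|.
  by have [] := eps_differentiable (diff_continuous df) H.
move=> e e0; have := differentiable_eps df e0.
have fg0 : \forall h \near 0, f (h + x) = g (h + x).
  exact: (near_shift0 fg).
have fgx : f x = g x by apply: (nbhs_singleton fg).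
by move=> H; apply: filterS2 H fg0 => h + E; rewrite -fgx -E.
Qed.

(** [smooth_on] treats all lists of directions at once and offers no induction. Bounding the order
    does: the derivative of a product, an inverse or a composite involves the functions themselves,
    smooth to the lower order by [ksmoothW]. *)
Definition ksmooth k V W (U : set V) (f : V -> W) : Prop :=
  forall vs x, (size vs <= k)%N -> U x -> differentiable (iter_derive vs f) x.

Lemma smooth_onP V W (U : set V) (f : V -> W) :
  smooth_on U f <-> forall k, ksmooth k U f.
Proof.
split=> [H k vs x _|H vs x]; first exact: H.
exact: (H (size vs)).
Qed.

Lemma ksmooth0 V W (U : set V) (f : V -> W) :
  ksmooth 0 U f <-> forall x, U x -> differentiable f x.
Proof.
split=> [H x Ux|H [|//] x _]; first exact: (H [::]).
exact: H.
Qed.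

Lemma ksmoothS k V W (U : set V) (f : V -> W) :
  ksmooth k.+1 U f <-> (forall x, U x -> differentiable f x) /\
                       forall v, ksmooth k U ('D_v f).
Proof.
split=> [H|[H0 H] [|v vs] x /= s Ux].
- split=> [x Ux|v vs x s Ux]; first exact: (H [::]).
  exact: (H (v :: vs)).
- exact: H0.
- exact: (H v).
Qed.

Lemma ksmooth_diff k V W (U : set V) (f : V -> W) :
  ksmooth k U f -> forall x, U x -> differentiable f x.
Proof. by move=> H x Ux; exact: (H [::]). Qed.

Lemma ksmoothW k V W (U : set V) (f : V -> W) :
  ksmooth k.+1 U f -> ksmooth k U f.
Proof. by move=> H vs x /leqW; exact: H. Qed.

Lemma open_near V (U : set V) (P : V -> Prop) x : open U -> U x ->
  (forall y, U y -> P y) -> \forall y \near x, P y.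
Proof. by move=> oU Ux H; apply: (filterS H); exact: open_nbhs_nbhs. Qed.

Lemma ksmooth_eq k V W (U : set V) (f g : V -> W) : open U ->
  (forall x, U x -> f x = g x) -> ksmooth k U f -> ksmooth k U g.
Proof.
move=> oU; elim: k f g => [|k IH] f g fg.
  move=> /ksmooth0 H; apply/ksmooth0 => x Ux.
  by apply: near_eq_differentiable (H x Ux); exact: open_near fg.
move=> /ksmoothS[H0 H]; apply/ksmoothS; split=> [x Ux|v].
  by apply: near_eq_differentiable (H0 x Ux); exact: open_near fg.
apply: IH (H v) => x Ux; apply: near_eq_derive; exact: open_near fg.
Qed.

Lemma ksmooth_cst k V W (U : set V) (w : W) : ksmooth k U (cst w).
Proof.
elim: k w => [|k IH] w; first by apply/ksmooth0 => x _; exact: differentiable_cst.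
apply/ksmoothS; split=> [x _|v]; first exact: differentiable_cst.
rewrite (_ : 'D_v (cst w) = cst 0); first exact: IH.
by apply/funext => x; rewrite derive_cst.
Qed.

Lemma ksmoothD k V W (U : set V) (f g : V -> W) : open U ->
  ksmooth k U f -> ksmooth k U g -> ksmooth k U (fun x => f x + g x).
Proof.
move=> oU; elim: k f g => [|k IH] f g.
  move=> /ksmooth0 df /ksmooth0 dg; apply/ksmooth0 => x Ux.
  by apply: differentiableD; [exact: df|exact: dg].
move=> /ksmoothS[df Df] /ksmoothS[dg Dg]; apply/ksmoothS; split=> [x Ux|v].
  by apply: differentiableD; [exact: df|exact: dg].
apply: ksmooth_eq (IH _ _ (Df v) (Dg v)) => // x Ux.
by rewrite [RHS]deriveD//; apply: diff_derivable; [exact: df|exact: dg].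
Qed.

Lemma ksmoothM k V (U : set V) (f g : V -> R) : open U ->
  ksmooth k U f -> ksmooth k U g -> ksmooth k U (fun x => f x * g x).
Proof.
move=> oU; elim: k f g => [|k IH] f g.
  move=> /ksmooth0 df /ksmooth0 dg; apply/ksmooth0 => x Ux.
  by apply: differentiableM; [exact: df|exact: dg].
move=> Hf Hg; move: (Hf) (Hg).
move=> /ksmoothS[df Df] /ksmoothS[dg Dg]; apply/ksmoothS; split=> [x Ux|v].
  by apply: differentiableM; [exact: df|exact: dg].
apply: (@ksmooth_eq _ _ _ _ (fun x => f x * 'D_v g x + g x * 'D_v f x)) => //.
  move=> x Ux; rewrite [RHS]deriveM//; apply: diff_derivable; [exact: df|exact: dg].
by apply: ksmoothD => //; apply: IH => //; exact: ksmoothW.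
Qed.

Lemma ksmoothN k V (U : set V) (f : V -> R) : open U ->
  ksmooth k U f -> ksmooth k U (fun x => - f x).
Proof.
move=> oU H; apply: (@ksmooth_eq _ _ _ _ (fun x => (-1) * f x)) => //.
  by move=> x _; rewrite mulN1r.
by apply: ksmoothM => //; exact: (ksmooth_cst (-1 : R)).
Qed.

Lemma ksmooth_sum k V (I : Type) (r : seq I) (P : pred I) (U : set V)
    (f : I -> V -> R) : open U ->
  (forall i, ksmooth k U (f i)) -> ksmooth k U (fun x => \sum_(i <- r | P i) f i x).
Proof.
move=> oU H; elim: r => [|i r IH].
  apply: ksmooth_eq (ksmooth_cst (0 : R)) => // x _.
  by rewrite big_nil.
apply: (@ksmooth_eq _ _ _ _ (fun x => (P i)%:R * f i x + \sum_(i <- r | P i) f i x)) => //.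
  by move=> x _; rewrite big_cons; case: (P i); rewrite ?mul1r ?mul0r ?add0r.
apply: ksmoothD => //; apply: ksmoothM => //.
exact: (ksmooth_cst ((P i)%:R : R)).
Qed.

Lemma ksmooth_prod k V (I : Type) (r : seq I) (P : pred I) (U : set V)
    (f : I -> V -> R) : open U ->
  (forall i, ksmooth k U (f i)) -> ksmooth k U (fun x => \prod_(i <- r | P i) f i x).
Proof.
move=> oU H; elim: r => [|i r IH].
  apply: ksmooth_eq (ksmooth_cst (1 : R)) => // x _.
  by rewrite big_nil.
case Pi : (P i).
  apply: (@ksmooth_eq _ _ _ _ (fun x => f i x * \prod_(i <- r | P i) f i x)) => //.
    by move=> x _; rewrite big_cons Pi.
  exact: ksmoothM.
by apply: ksmooth_eq IH => // x _; rewrite big_cons Pi.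
Qed.

Lemma ksmoothV k V (U : set V) (f : V -> R) : open U ->
  (forall x, U x -> f x != 0) -> ksmooth k U f -> ksmooth k U (fun x => (f x)^-1).
Proof.
move=> oU f0; elim: k => [|k IH] Hf.
  by apply/ksmooth0 => x Ux; apply: differentiableV (f0 _ Ux); exact: ksmooth_diff Hf x Ux.
have /ksmoothS[df Df] := Hf; apply/ksmoothS; split=> [x Ux|v].
  by apply: differentiableV (f0 _ Ux); exact: df.
apply: (@ksmooth_eq _ _ _ _ (fun x => - (((f x)^-1 * (f x)^-1) * 'D_v f x))) => //.
  move=> x Ux; rewrite [RHS]deriveV ?f0//; last exact/diff_derivable/df.
  by rewrite scaleNr expr2 invfM.
have Hi := IH (ksmoothW Hf).
by apply: ksmoothN => //; apply: ksmoothM => //; exact: ksmoothM.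
Qed.

Lemma derivative_comp V W X (f : V -> W) (g : W -> X) x v :
  differentiable f x -> differentiable g (f x) ->
  'D_v (g \o f) x = 'D_('D_v f x) g (f x).
Proof.
move=> df dg; rewrite (deriveE _ (differentiable_comp df dg)) (diff_comp df dg).
by rewrite /= (deriveE _ df) (deriveE _ dg).
Qed.

Lemma differentiable_sqrt (r : R) : 0 < r -> differentiable (Num.sqrt : R -> R) r.
Proof. by move=> r0; apply/derivable1_diffP; case: (is_derive1_sqrt r0). Qed.

Lemma derivative_sqrt (r v : R) : 0 < r ->
  'D_v (Num.sqrt : R -> R) r = v * (2 * Num.sqrt r)^-1.
Proof.
move=> r0; rewrite deriveE; last exact: differentiable_sqrt.
rewrite -(derive_sqrt r0) deriveE; last exact: differentiable_sqrt.
by rewrite -[in LHS](mulr1 v) -[v * 1]/(v *: 1) linearZ.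
Qed.

Lemma ksmooth_sqrt k V (U : set V) (f : V -> R) : open U ->
  (forall x, U x -> 0 < f x) -> ksmooth k U f -> ksmooth k U (fun x => Num.sqrt (f x)).
Proof.
move=> oU f0; elim: k => [|k IH] Hf; have df := ksmooth_diff Hf.
  apply/ksmooth0 => x Ux; apply: (@differentiable_comp _ _ _ _ f Num.sqrt) (df _ Ux) _.
  exact/differentiable_sqrt/f0.
have /ksmoothS[_ Df] := Hf; apply/ksmoothS; split=> [x Ux|v].
  apply: (@differentiable_comp _ _ _ _ f Num.sqrt) (df _ Ux) _.
  exact/differentiable_sqrt/f0.
apply: (@ksmooth_eq _ _ _ _ (fun x => 'D_v f x * (2 * Num.sqrt (f x))^-1)) => //.
  move=> x Ux; rewrite [RHS](@derivative_comp _ _ _ f Num.sqrt)//; last 2 first.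
  - exact: df.
  - exact/differentiable_sqrt/f0.
  by rewrite derivative_sqrt//; exact: f0.
apply: ksmoothM => //; apply: ksmoothV => //.
  by move=> x Ux; rewrite mulf_neq0// gt_eqF// sqrtr_gt0 f0.
apply: ksmoothM => //; first exact: (ksmooth_cst (2 : R)).
exact/IH/ksmoothW.
Qed.

Lemma differentiable_rVP V n (f : V -> 'rV[R]_n) x :
  differentiable f x <-> forall i, differentiable (fun y => f y 0 i) x.
Proof.
split=> [df i|H].
  by apply: (@differentiable_comp _ _ _ _ f (fun e : 'rV[R]_n => e 0 i)) df _;
     exact: differentiable_coord.
have -> : f = \sum_(i < n) (fun y => f y 0 i *: delta_mx 0 i).
  by apply/funext => y; rewrite fct_sumE [LHS]row_sum_delta.
by apply: differentiable_sum => i; apply: differentiableZl; exact: H.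
Qed.

Lemma derivative_coord V n (f : V -> 'rV[R]_n) x v i : differentiable f x ->
  ('D_v f x) 0 i = 'D_v (fun y => f y 0 i) x.
Proof. by move=> df; rewrite derive_mx ?mxE//; exact: diff_derivable. Qed.

Lemma ksmooth_rVP k V n (U : set V) (f : V -> 'rV[R]_n) : open U ->
  ksmooth k U f <-> forall i, ksmooth k U (fun y => f y 0 i).
Proof.
move=> oU; elim: k f => [|k IH] f.
  split=> [/ksmooth0 H i|H]; apply/ksmooth0 => x Ux.
    by have /differentiable_rVP := H _ Ux; exact.
  by apply/differentiable_rVP => i; have /ksmooth0 := H i; exact.
split=> [/ksmoothS[df Df] i|H].
  apply/ksmoothS; split=> [x Ux|v].
    by have /differentiable_rVP := df _ Ux; exact.
  have /IH/(_ i) := Df v; apply: ksmooth_eq => // x Ux.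
  by rewrite derivative_coord//; exact: df.
have df x : U x -> differentiable f x.
  by move=> Ux; apply/differentiable_rVP => i; have /ksmoothS[+ _] := H i; exact.
apply/ksmoothS; split=> // v; apply/IH => i.
have /ksmoothS[_ /(_ v)] := H i; apply: ksmooth_eq => // x Ux.
by rewrite derivative_coord//; exact: df.
Qed.

Lemma ksmooth_id k V (U : set V) : ksmooth k U (id : V -> V).
Proof.
case: k => [|k]; first by apply/ksmooth0.
apply/ksmoothS; split=> // v.
rewrite (_ : 'D_v id = cst v); first exact: ksmooth_cst.
by apply/funext => x; rewrite derive_id.
Qed.

Lemma ksmooth_coord k n (U : set 'rV[R]_n) i : open U ->
  ksmooth k U (fun t : 'rV[R]_n => t 0 i).
Proof.
by move=> oU; apply: ((ksmooth_rVP k id oU).1 _ i); exact: ksmooth_id.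
Qed.

Lemma derivative_rV_sum n W (g : 'rV[R]_n -> W) y (w : 'rV[R]_n) : differentiable g y ->
  'D_w g y = \sum_(i < n) w 0 i *: 'D_(delta_mx 0 i) g y.
Proof.
move=> dg; rewrite deriveE// [in LHS](row_sum_delta w) linear_sum.
by apply: eq_bigr => i _; rewrite linearZ deriveE.
Qed.

(** In the chain rule the direction in which [g] is differentiated moves with the point. Expanding
    it on the basis [delta_mx 0 i] leaves derivatives of [g] in fixed directions, to which the
    induction hypothesis applies. *)
Lemma ksmooth_comp k V n (U : set V) (U' : set 'rV[R]_n) (f : V -> 'rV[R]_n)
    (g : 'rV[R]_n -> R) : open U -> open U' -> (forall x, U x -> U' (f x)) ->
  ksmooth k U f -> ksmooth k U' g -> ksmooth k U (g \o f).
Proof.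
move=> oU oU' fU; elim: k g => [|k IH] g Hf Hg.
  apply/ksmooth0 => x Ux; apply: differentiable_comp.
    exact: (ksmooth_diff Hf).
  by apply: (ksmooth_diff Hg); exact: fU.
have df := ksmooth_diff Hf; have dg := ksmooth_diff Hg.
have /ksmoothS[_ Df] := Hf; have /ksmoothS[_ Dg] := Hg.
apply/ksmoothS; split=> [x Ux|v].
  by apply: differentiable_comp; [exact: df|exact/dg/fU].
apply: (@ksmooth_eq _ _ _ _
  (fun x => \sum_(i < n) 'D_v f x 0 i * 'D_(delta_mx 0 i) g (f x))) => //.
  move=> x Ux; rewrite [RHS]derivative_comp; [|exact: df|exact/dg/fU].
  by rewrite [RHS]derivative_rV_sum//; exact/dg/fU.
apply: ksmooth_sum => // i; apply: ksmoothM => //.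
  by have /(ksmooth_rVP _ _ oU) := Df v; exact.
exact: (IH _ (ksmoothW Hf) (Dg _)).
Qed.

Lemma ksmooth_comp_rV k V n p (U : set V) (U' : set 'rV[R]_n) (f : V -> 'rV[R]_n)
    (g : 'rV[R]_n -> 'rV[R]_p) : open U -> open U' -> (forall x, U x -> U' (f x)) ->
  ksmooth k U f -> ksmooth k U' g -> ksmooth k U (g \o f).
Proof.
move=> oU oU' fU Hf /(ksmooth_rVP _ _ oU') Hg; apply/ksmooth_rVP => // i.
exact: ksmooth_comp (Hg i).
Qed.

End Calculus.

Section Calculus2.
Variable R : realType.
Implicit Types V W X : normedModType R.

Lemma line_is_derive V (f : V -> R) (y u : V) (s : R) :
  differentiable f (y + s *: u) ->
  is_derive s 1 (fun s => f (y + s *: u)) ('D_u f (y + s *: u)).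
Proof.
move=> df; pose l (s : R) := y + s *: u.
have dl : is_diff s l (fun r => r *: u).
  have dcst : is_diff s (cst y : R -> V) 0 by exact: is_diff_cst.
  have dsc : is_diff s (fun r : R => r *: u) (fun r => r *: u).
    exact: is_diff_scalel.
  have := is_diffD dcst dsc; rewrite add0r; exact.
have dls : differentiable l s by exact: ex_diff.
apply: DeriveDef.
  by apply/derivable1_diffP; exact: (@differentiable_comp _ _ _ _ l f).
rewrite (@derivative_comp _ _ _ _ l f)//; congr ('D_ _ f _).
by rewrite deriveE// diff_val scale1r.
Qed.

Lemma line_MVT V (f : V -> R) (y u : V) (a b : R) : a < b ->
  (forall s, a <= s <= b -> differentiable f (y + s *: u)) ->
  exists2 c, a < c < b & f (y + b *: u) - f (y + a *: u) = 'D_u f (y + c *: u) * (b - a).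
Proof.
move=> ab df.
have [||c + ->] := @MVT _ (fun s => f (y + s *: u)) (fun s => 'D_u f (y + s *: u)) _ _ ab.
- by move=> x /andP[ax xb]; apply/line_is_derive/df; rewrite !bnd_simp in ax xb; lra.
- apply: derivable_within_continuous => x; rewrite in_itv/= => xab.
  by have [] := line_is_derive (df x xab).
by rewrite in_itv/= => cab; exists c.
Qed.

(** The mean value theorem along [u], for [F y = f (y + h v) - f y], turns the second difference
    into [h] times an increment of ['D_u f], which is estimated by the differentiability of ['D_u f]
    at the single point [x]. *)
Lemma second_difference V (f : V -> R) (x u v : V) (e : R) : 0 < e ->
  (\forall y \near x, differentiable f y) -> differentiable ('D_u f) x ->
  \forall h \near 0^'+, `|(f (x + h *: u + h *: v) - f (x + h *: u) - f (x + h *: v) + f x)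
     - h ^+ 2 * 'D_v ('D_u f) x| <= e * h ^+ 2.
Proof.
move=> e0 df dg; set g := 'D_u f.
(* For [s] and [t] between 0 and [h] the norm of [s u + t v] is at most [h c]. The error [e1] is
   spent on two such vectors, hence the factor 2. *)
pose c := `|u| + `|v| + 1.
have c0 : 0 < c by rewrite ltr_wpDl// addr_ge0.
pose e1 := e / (2 * c).
have e10 : 0 < e1 by rewrite divr_gt0// mulr_gt0.
have := differentiable_eps dg e10.
move=> /nbhs_ballP[d1 /= d10 H1].
move: df => /nbhs_ballP[d2 /= d20 H2].
near=> h.
have h0 : 0 < h by near: h; exact: nbhs_right_gt.
have hd1 : h < d1 / c by near: h; apply: nbhs_right_lt; rewrite divr_gt0.
have hd2 : h < d2 / c by near: h; apply: nbhs_right_lt; rewrite divr_gt0.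
rewrite ltr_pdivlMr// in hd1; rewrite ltr_pdivlMr// in hd2.
have small (s t : R) : 0 <= s <= h -> 0 <= t <= h -> `|s *: u + t *: v| <= h * c.
  move=> /andP[s0 sh] /andP[t0 th]; apply: le_trans (ler_normD _ _) _.
  rewrite !normrZ (ger0_norm s0) (ger0_norm t0).
  rewrite /c !mulrDr mulr1 -[leLHS]addr0; apply: lerD; last exact: ltW.
  by apply: lerD; exact: ler_wpM2r.
have dff s t : 0 <= s <= h -> 0 <= t <= h -> differentiable f (x + s *: u + t *: v).
  move=> sh th; apply: H2; rewrite -ball_normE/=.
  by rewrite -addrA opprD addNKr normrN; apply: le_lt_trans hd2; exact: small.
have h00 : (0 : R) <= 0 <= h by apply/andP; split; [|exact: ltW].
have hhh : 0 <= h <= h by apply/andP; split; [exact: ltW|].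
pose F y := f (y + h *: v) - f y.
have dF s : 0 <= s <= h -> differentiable F (x + s *: u) /\
    'D_u F (x + s *: u) = g (x + s *: u + h *: v) - g (x + s *: u).
  move=> sh.
  have d1f := dff _ _ sh hhh; have := dff _ _ sh h00; rewrite scale0r addr0 => d2f.
  have dsh : is_diff (x + s *: u) (fun y => y + h *: v) id.
    have dh1 : is_diff (x + s *: u) (cst (h *: v) : V -> V) 0 by exact: is_diff_cst.
    have := is_diffD (is_diff_id (x + s *: u)) dh1; rewrite addr0; exact.
  have d3 : differentiable (f \o (fun y => y + h *: v)) (x + s *: u).
    by apply: differentiable_comp.
  split; first by apply: differentiableB.
  rewrite deriveB; [|exact: diff_derivable|exact: diff_derivable].
  rewrite (@derivative_comp _ _ _ _ (fun y => y + h *: v) f)//.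
  by congr ('D_ _ f _ - _); rewrite deriveE// diff_val.
have [s /andP[s0 sh]] := @line_MVT _ F x u 0 h h0 (fun s sh => (dF s sh).1).
have sh' : 0 <= s <= h by rewrite !ltW.
rewrite (dF s sh').2 subr0 scale0r addr0 /F => E.
have -> : f (x + h *: u + h *: v) - f (x + h *: u) - f (x + h *: v) + f x =
   (g (x + s *: u + h *: v) - g (x + s *: u)) * h by rewrite -E; ring.
have A1 := H1 (s *: u + h *: v); have A2 := H1 (s *: u).
have n1 : `|s *: u + h *: v| <= h * c by exact: small.
have n2 : `|s *: u| <= h * c by have := small s 0 sh' h00; rewrite scale0r addr0.
have {}A1 : `|g (s *: u + h *: v + x) - g x - 'd g x (s *: u + h *: v)| <= e1 * (h * c).
  apply: le_trans (A1 _) _; last by rewrite ler_wpM2l// ltW.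
  by rewrite -ball_normE/= sub0r normrN; exact: le_lt_trans hd1.
have {}A2 : `|g (s *: u + x) - g x - 'd g x (s *: u)| <= e1 * (h * c).
  apply: le_trans (A2 _) _; last by rewrite ler_wpM2l// ltW.
  by rewrite -ball_normE/= sub0r normrN; exact: le_lt_trans hd1.
rewrite deriveE//.
have Ed : 'd g x (s *: u + h *: v) = 'd g x (s *: u) + h * 'd g x v.
  by rewrite linearD [X in _ + X = _]linearZ.
rewrite Ed in A1.
have -> : x + s *: u + h *: v = s *: u + h *: v + x by rewrite -addrA addrC.
rewrite [x + s *: u]addrC.
set a := g _ in A1 *; set b := g _ in A2 *; set p := g x in A1 A2.
set q := 'd g x (s *: u) in A1 A2; set r := 'd g x v in A1 *.
have -> : (a - b) * h - h ^+ 2 * r =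
  h * ((a - p - (q + h * r)) - (b - p - q)) by ring.
rewrite normrM (gtr0_norm h0).
have -> : e * h ^+ 2 = h * (e1 * (h * c) + e1 * (h * c)).
  by rewrite /e1; field; rewrite gt_eqF.
apply: ler_wpM2l; first exact: ltW.
by apply: le_trans (ler_normB _ _) _; exact: lerD.
Unshelve. all: by end_near. Qed.

(** The second difference is symmetric in [u] and [v], so divided by [h ^+ 2] it tends to both mixed
    derivatives. *)
Lemma derivative_swap V (f : V -> R) (x u v : V) :
  (\forall y \near x, differentiable f y) ->
  differentiable ('D_u f) x -> differentiable ('D_v f) x ->
  'D_v ('D_u f) x = 'D_u ('D_v f) x.
Proof.
move=> df du dv; apply/eqP; rewrite -subr_eq0 -normr_le0; apply/ler_addgt0Pr => e e0; rewrite add0r.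
have e20 : 0 < e / 2 by rewrite divr_gt0.
have A := second_difference v e20 df du.
have B := second_difference u e20 df dv.
have : \forall h \near (0:R)^'+, `|'D_v ('D_u f) x - 'D_u ('D_v f) x| <= e.
  near=> h.
  have h0 : 0 < h by near: h; exact: nbhs_right_gt.
  have := near A h; have := near B h.
  rewrite [x + h *: v + h *: u]addrAC => /(_ _)/wrap[//|H2] /(_ _)/wrap[//|H1].
  move: H1 H2; set p := 'D_v _ x; set q := 'D_u _ x.
  set a := f _; set b := f _; set c := f _; set d := f x => H1 H2.
  have h20 : 0 < h ^+ 2 by rewrite exprn_gt0.
  rewrite -(ler_pM2r h20) -[X in _ * X <= _](ger0_norm (ltW h20)) -normrM.
  have -> : (p - q) * h ^+ 2 = (a - c - b + d - h ^+ 2 * q) - (a - b - c + d - h ^+ 2 * p).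
    by ring.
  apply: le_trans (ler_normB _ _) _.
  have -> : e * h ^+ 2 = e / 2 * h ^+ 2 + e / 2 * h ^+ 2 by field.
  by apply: (lerD H2 H1).
by move=> /(@filter_ex _ _ (at_right_proper_filter 0))[].
Unshelve. all: by end_near. Qed.

End Calculus2.

Section Calculus3.
Variable R : realType.
Implicit Types V W X : normedModType R.

Lemma ball_segment V (x y : V) (r s : R) : ball x r y -> 0 <= s <= 1 ->
  ball x r (x + s *: (y - x)).
Proof.
rewrite -ball_normE/= => xy /andP[s0 s1].
rewrite opprD addNKr normrN normrZ (ger0_norm s0) distrC.
by apply: le_lt_trans xy; rewrite ler_piMl.
Qed.

Lemma connected_ball V (x : V) (r : R) : 0 < r -> connected (ball x r).
Proof.
move=> r0.
have -> : ball x r = \bigcup_(y in ball x r) ((fun s : R => x + s *: (y - x)) @` `[0, 1]).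
  apply/seteqP; split=> [y xy|y [z xz [s + <-]]].
    exists y => //; exists 1; first by rewrite /= in_itv/= ler01 lexx.
    by rewrite scale1r addrC subrK.
  by rewrite /= in_itv/=; exact: ball_segment.
apply: bigcup_connected.
  exists x => y _; exists 0; first by rewrite /= in_itv/= ler01 lexx.
  by rewrite scale0r addr0.
move=> y _; apply: connected_continuous_connected; first exact: segment_connected.
apply: continuous_subspaceT => s.
by apply: cvgD; [exact: cvg_cst|apply: cvgZr_tmp; exact: cvg_id].
Qed.

Lemma derivative0_connected V (W : set V) (f : V -> R) : open W -> connected W ->
  (forall x, W x -> differentiable f x) -> (forall x, W x -> forall v, 'D_v f x = 0) ->
  forall x y, W x -> W y -> f x = f y.
Proof.
move=> oW cW df Df x0 y0 Wx0 Wy0.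
have locc x : W x -> exists2 r, 0 < r & ball x r `<=` W /\
    forall y, ball x r y -> f y = f x.
  move=> Wx; have /nbhs_ballP[r /= r0 rW] : nbhs x W by exact: open_nbhs_nbhs.
  exists r => //; split=> // y xy.
  have [|c /andP[c0 c1]] := @line_MVT _ _ f x (y - x) 0 1 ltr01.
    by move=> s s01; apply/df/rW/ball_segment.
  rewrite scale1r scale0r addr0 [x + _]addrC subrK Df ?mul0r.
    by move=> /eqP; rewrite subr_eq0 => /eqP.
  by apply/rW/ball_segment => //; rewrite !ltW.
pose B := [set x | W x /\ f x = f x0].
have oB : open B.
  rewrite openE => x [Wx fx]; have [r r0 [rW rf]] := locc x Wx.
  by apply/nbhs_ballP; exists r => // y xy; split; [exact: rW|rewrite rf].
have oB' : open [set x | W x /\ f x <> f x0].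
  rewrite openE => x [Wx fx]; have [r r0 [rW rf]] := locc x Wx.
  by apply/nbhs_ballP; exists r => // y xy; split; [exact: rW|rewrite rf].
have BW : B = W.
  apply: cW; first by exists x0.
    by exists B => //; apply/seteqP; split=> [x []|x []//].
  exists (~` [set x | W x /\ f x <> f x0]); first exact: open_closedC.
  apply/seteqP; split=> [x [Wx fx]|x [Wx nfx]]; split=> //; first by case.
  by apply: contrapT => fx; apply: nfx.
by have [_ ->] : B y0 by rewrite BW.
Qed.

(** * Implicit function theorem for one scalar equation *)

Section Implicit.
Variables (k n : nat) (U : set 'rV[R]_n) (s : 'rV[R]_n -> R) (u0 v0 : 'rV[R]_n)
  (L : 'M[R]_(k, n)).
Hypotheses (oU : open U) (sU : smooth_on U s) (Uu0 : U u0).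

Let pt (t : 'rV[R]_k) (r : R) := u0 + t *m L + r *: v0.

Let ds x : U x -> differentiable s x.
Proof. by move=> Ux; exact: (sU [::] Ux). Qed.

Let dgs x v : U x -> differentiable ('D_v s) x.
Proof. by move=> Ux; exact: (sU [:: v] Ux). Qed.

Lemma mulmxr_cont : continuous (mulmxr L : 'rV[R]_k -> 'rV[R]_n).
Proof.
move=> x; apply: differentiable_continuous; apply/differentiable_rVP => i.
rewrite (_ : (fun _ => _) = \sum_(j < k) (fun y : 'rV[R]_k => L j i *: y 0 j)).
  by apply: differentiable_sum => j; apply: differentiableZ; exact: differentiable_coord.
by apply/funext => y; rewrite fct_sumE /= mxE; apply: eq_bigr => j _; exact: mulrC.
Qed.

(** Near [u0] the function [s] increases strictly along [v0]. It is below [s u0] at height [- ep]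
    and above it at height [ep], first for [t = 0], then for small [t]. The intermediate value
    theorem gives the root [sg t], and monotonicity its uniqueness and continuity. *)
Lemma implicit_pos : 0 < 'D_v0 s u0 -> exists2 r : R, 0 < r &
  exists sg : 'rV[R]_k -> R, [/\ sg 0 = 0 &
    forall t, ball 0 r t -> [/\ U (u0 + t *m L + sg t *: v0),
      s (u0 + t *m L + sg t *: v0) = s u0,
      'D_v0 s (u0 + t *m L + sg t *: v0) != 0 & {for t, continuous sg}]].
Proof.
move=> s0.
have [rho rho0 Hrho] : exists2 rho, 0 < rho & forall x, ball u0 rho x -> U x /\ 0 < 'D_v0 s x.
  have c0 : {for u0, continuous ('D_v0 s)} by apply: differentiable_continuous; exact: dgs.
  have N1 : \forall x \near u0, U x by exact: open_nbhs_nbhs.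
  have N2 : \forall x \near u0, 0 < 'D_v0 s x by apply: (cvgr_gt _ c0).
  have /nbhs_ballP[r r0 H] : \forall x \near u0, U x /\ 0 < 'D_v0 s x by near do split.
  by exists r.
have [K K0 HK] := linear_lipschitz mulmxr_cont.
(* The radius [rho] is shared: one half for [t *m L], through [d1], the other for [r *: v0], through
   [ep]. *)
pose ep := rho / (2 * (`|v0| + 1)).
have v1 : 0 < `|v0| + 1 by rewrite ltr_wpDl.
have ep0 : 0 < ep by rewrite divr_gt0// mulr_gt0.
pose d1 := rho / (2 * K).
have d10 : 0 < d1 by rewrite divr_gt0// mulr_gt0.
have inb t r : `|t| < d1 -> `|r| <= ep -> ball u0 rho (pt t r).
  move=> td rep; rewrite -ball_normE/= /pt opprD opprD addrA addrA subrr sub0r -opprD normrN.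
  apply: le_lt_trans (ler_normD _ _) _; rewrite normrZ.
  have A : `|t *m L| < rho / 2.
    apply: le_lt_trans (HK t) _; rewrite (_ : rho / 2 = K * d1); last first.
      by rewrite /d1; field; rewrite gt_eqF.
    by rewrite ltr_pM2l.
  have B : `|r| * `|v0| <= rho / 2.
    rewrite (_ : rho / 2 = ep * (`|v0| + 1)); last by rewrite /ep; field; rewrite gt_eqF.
    by apply: ler_pM => //; rewrite lerDl.
  by rewrite [ltRHS]splitr; exact: ltr_leD.
have Upt t r : `|t| < d1 -> `|r| <= ep -> U (pt t r).
  by move=> td rep; have [] := Hrho _ (inb _ _ td rep).
have mono t r1 r2 : `|t| < d1 -> `|r1| <= ep -> `|r2| <= ep -> r1 < r2 ->
    s (pt t r1) < s (pt t r2).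
  move=> td r1e r2e r12.
  have inr r : r1 <= r <= r2 -> `|r| <= ep.
    by move: r1e r2e; rewrite !ler_norml; lra.
  have [x xr|c /andP[c1 c2] E] := @line_MVT _ _ s (u0 + t *m L) v0 _ _ r12.
    by apply/ds/Upt => //; exact: inr.
  rewrite -subr_gt0 E mulr_gt0 ?subr_gt0//.
  by apply: (Hrho _ (inb t c _ _)).2 => //; apply: inr; rewrite !ltW.
have ptc r t : {for t, continuous (pt ^~ r)}.
  apply: differentiable_continuous.
  have dL : differentiable (mulmxr L : 'rV[R]_k -> 'rV[R]_n) t.
    exact: linear_differentiable mulmxr_cont.
  have dc1 : differentiable (cst u0 : 'rV[R]_k -> 'rV[R]_n) t by exact: differentiable_cst.
  have dc2 : differentiable (cst (r *: v0) : 'rV[R]_k -> 'rV[R]_n) t by exact: differentiable_cst.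
  exact: differentiableD (differentiableD dc1 dL) dc2.
have sptc r t : `|t| < d1 -> `|r| <= ep -> {for t, continuous (fun t => s (pt t r))}.
  move=> td rep; apply: continuous_comp; first exact: ptc.
  by apply: differentiable_continuous; apply: ds; exact: Upt.
have nd0 : `|0 : 'rV[R]_k| < d1 by rewrite normr0.
have epe : `|ep| <= ep by rewrite ger0_norm// ltW.
have epN : `|- ep| <= ep by rewrite normrN.
have ep00 : `|0 : R| <= ep by rewrite normr0 ltW.
have pt00 : pt 0 0 = u0 by rewrite /pt mul0mx scale0r !addr0.
have [d d0 Hd] : exists2 d, 0 < d & forall t, ball 0 d t ->
    [/\ `|t| < d1, s (pt t (- ep)) < s u0 & s u0 < s (pt t ep)].
  have N1 : \forall t \near (0 : 'rV[R]_k), `|t| < d1.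
    by apply/nbhs_ballP; exists d1 => // t; rewrite -ball_normE/= sub0r normrN.
  have N2 : \forall t \near (0 : 'rV[R]_k), s (pt t (- ep)) < s u0.
    apply: (cvgr_lt _ (sptc _ _ nd0 epN)).
    by rewrite -pt00; apply: mono => //; rewrite oppr_lt0.
  have N3 : \forall t \near (0 : 'rV[R]_k), s u0 < s (pt t ep).
    by apply: (cvgr_gt _ (sptc _ _ nd0 epe)); rewrite -pt00; exact: mono.
  have /nbhs_ballP[r r0 H] : \forall t \near (0 : 'rV[R]_k),
    [/\ `|t| < d1, s (pt t (- ep)) < s u0 & s u0 < s (pt t ep)] by near do split.
  by exists r.
have exr t : ball 0 d t -> exists r, `|r| < ep /\ s (pt t r) = s u0.
  move=> /Hd[td lo hi].
  have eNe : - ep <= ep by rewrite ltW// gtrN.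
  have [||c] := @IVT _ (fun r => s (pt t r)) (- ep) ep (s u0) eNe.
  - apply: derivable_within_continuous => x; rewrite in_itv/= => xab.
    have [] := @line_is_derive _ _ s (u0 + t *m L) v0 x _ => //.
    by apply/ds/Upt => //; rewrite ler_norml.
  - by rewrite (le_trans _ (ltW lo)) ?ge_min ?lexx//= (le_trans (ltW hi))// le_max lexx orbT.
  rewrite in_itv/= => /andP[c1 c2] E; exists c; split=> //.
  rewrite ltr_norml !lt_neqAle c1 c2 !andbT; apply/andP; split; apply/eqP => ce.
    by move: lo; rewrite ce E ltxx.
  by move: hi; rewrite -ce E ltxx.
pose sg t := xget 0 [set r | `|r| < ep /\ s (pt t r) = s u0].
have sgP t : ball 0 d t -> `|sg t| < ep /\ s (pt t (sg t)) = s u0.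
  by move=> /exr[r Hr]; rewrite /sg; case: xgetP => [_ _ //|/(_ r)]; case.
exists d => //; exists sg; split.
  have [s1 s2] := sgP 0 (ballxx _ d0).
  have [H|H|//] := ltgtP (sg 0) 0.
    by have := mono _ _ _ nd0 (ltW s1) ep00 H; rewrite s2 pt00 ltxx.
  by have := mono _ _ _ nd0 ep00 (ltW s1) H; rewrite s2 pt00 ltxx.
move=> t bt; have [sg1 sg2] := sgP t bt; have [td _ _] := Hd _ bt.
have [g1 g2] := Hrho _ (inb _ _ td (ltW sg1)).
split=> //; first by rewrite gt_eqF.
suff H : forall e, 0 < e -> \forall t' \near t, `|sg t - sg t'| <= e.
  exact: (cvgrPdist_le (F:=nbhs t) _ _).2.
move=> e e0.
(* The heights [sg t - e1] and [sg t + e1] must stay in the range [[- ep, ep]] where [s] is known to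
   be monotone. *)
pose e1 := Num.min e (ep - `|sg t|).
have e10 : 0 < e1 by rewrite lt_min e0 subr_gt0.
have e1e : e1 <= e by rewrite ge_min lexx.
have e1p : `|sg t| + e1 <= ep by rewrite -lerBrDl ge_min lexx orbT.
have A1 : `|sg t - e1| <= ep.
  by apply: le_trans (ler_normB _ _) _; rewrite (gtr0_norm e10).
have A2 : `|sg t + e1| <= ep.
  by apply: le_trans (ler_normD _ _) _; rewrite (gtr0_norm e10).
have N1 : \forall t' \near t, s (pt t' (sg t - e1)) < s u0.
  apply: (cvgr_lt _ (sptc _ _ td A1)).
  by rewrite -sg2; apply: mono => //; [exact: ltW|rewrite gtrDl oppr_lt0].
have N2 : \forall t' \near t, s u0 < s (pt t' (sg t + e1)).
  apply: (cvgr_gt _ (sptc _ _ td A2)).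
  by rewrite -[ltLHS]sg2; apply: mono => //; [exact: ltW|rewrite ltrDl].
have N3 : \forall t' \near t, ball 0 d t' by apply: open_nbhs_nbhs; split=> //; exact: ball_open.
near=> t'.
have bt' : ball 0 d t' by near: t'.
have [td' _ _] := Hd _ bt'; have [q1 q2] := sgP t' bt'.
have M1 : s (pt t' (sg t - e1)) < s u0 by near: t'.
have M2 : s u0 < s (pt t' (sg t + e1)) by near: t'.
have B1 : sg t - e1 <= sg t'.
  rewrite leNgt; apply/negP => H; have := mono _ _ _ td' (ltW q1) A1 H.
  by rewrite q2 ltNge (ltW M1).
have B2 : sg t' <= sg t + e1.
  rewrite leNgt; apply/negP => H; have := mono _ _ _ td' A2 (ltW q1) H.
  by rewrite q2 ltNge (ltW M2).
rewrite ler_norml; lra.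
Unshelve. all: by end_near. Qed.

End Implicit.
End Calculus3.

Section Implicit2.
Variables (R : realType) (k n : nat) (U : set 'rV[R]_n) (s : 'rV[R]_n -> R)
  (u0 v0 : 'rV[R]_n) (L : 'M[R]_(k, n)) (r : R) (sg : 'rV[R]_k -> R).
Hypotheses (oU : open U) (sU : smooth_on U s).

Local Notation E t := (u0 + t *m L + sg t *: v0).

Hypothesis Hsg : forall t, ball 0 r t -> [/\ U (E t), s (E t) = s u0,
  'D_v0 s (E t) != 0 & {for t, continuous sg}].

(** Comparing the constraint at two nearby parameters gives [De = l h] up to an error, where [l]
    comes from formal differentiation and the error is small relative to the displacement [w]. As
    [w] contains [De] itself, that part is absorbed on the left. *)
Lemma implicit_diff t : ball 0 r t -> differentiable sg t /\
  forall v, 'D_v sg t = - ('D_v0 s (E t))^-1 * 'D_(v *m L) s (E t).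
Proof.
move=> bt; have [Ut st at0 ct] := Hsg bt.
set y := E t in Ut st at0 *; set a := 'D_v0 s y in at0 *.
have dsy : differentiable s y by exact: (sU [::] Ut).
have cds := diff_continuous dsy.
have cL := @mulmxr_cont R k n L.
have [K K0 HK] := linear_lipschitz cL.
have [K' K'0 HK'] := linear_lipschitz cds.
have aE : 'd s y v0 = a by rewrite /a deriveE.
pose l : {linear 'rV[R]_k -> R} := *:%R (- a^-1 : R) \o ('d s y \o mulmxr L).
have cl : continuous l.
  move=> h; apply: differentiable_continuous.
  apply: (@differentiable_comp _ _ _ _ ('d s y \o mulmxr L) ( *:%R (- a^-1 : R))).
    apply: (@differentiable_comp _ _ _ _ (mulmxr L) ('d s y)).
      exact: linear_differentiable.
    exact: linear_differentiable.
  by [].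
have lE h : l h = - a^-1 * 'd s y (h *m L) by [].
have a0 : 0 < `|a| by rewrite normr_gt0.
pose Q := `|a|^-1 * (K' * K).
have Q0 : 0 < Q by rewrite mulr_gt0 ?invr_gt0// mulr_gt0.
have lQ h : `|l h| <= Q * `|h|.
  rewrite lE normrM normrN normfV /Q -!mulrA ler_pM2l ?invr_gt0//.
  by apply: le_trans (HK' _) _; rewrite ler_pM2l//; exact: HK.
suff H : forall e, 0 < e -> \forall h \near 0, `|sg (h + t) - sg t - l h| <= e * `|h|.
  have [dsg dE] := eps_differentiable cl H; split=> // v.
  by rewrite deriveE// dE lE [in RHS]deriveE.
move=> e e0.
(* The factor [q] has to meet three bounds: [q |v0| <= 1/2] absorbs the part of [w] along [v0], with
   [q <= 1] this yields [|w| <= B |h|], and [q B <= e] concludes. *)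
pose B := K + 2 * (Q + K) * `|v0|.
have B0 : 0 < B by rewrite ltr_wpDr// mulr_ge0// mulr_ge0// addr_ge0// ltW.
pose D0 := B / e + 2 * `|v0| + 1.
have Be : 0 < B / e by rewrite divr_gt0.
have D00 : 0 < D0 by rewrite /D0; have := normr_ge0 v0; lra.
pose q := D0^-1.
have q0 : 0 < q by rewrite invr_gt0.
have q1 : q * B <= e.
  rewrite /q mulrC ler_pdivrMr// -ler_pdivrMl// mulrC /D0.
  by have := normr_ge0 v0; lra.
have q2 : q * `|v0| <= 2^-1.
  by rewrite /q mulrC ler_pdivrMr// /D0; lra.
have q3 : q <= 1.
  by rewrite /q invf_le1// /D0; have := normr_ge0 v0; lra.
have e10 : 0 < q * `|a| by rewrite mulr_gt0.
have := differentiable_eps dsy e10 => /nbhs_ballP[d /= d0 Hd].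
have dv : 0 < d / (2 * (`|v0| + 1)) by rewrite divr_gt0// mulr_gt0// ltr_wpDl.
have N1 : \forall h \near (0 : 'rV[R]_k), `|sg t - sg (h + t)| < d / (2 * (`|v0| + 1)).
  exact: near_shift0 ((cvgrPdist_lt (F:=nbhs t) _ _).1 ct _ dv).
have dK : 0 < d / (2 * K) by rewrite divr_gt0// mulr_gt0.
have N2 : \forall h \near (0 : 'rV[R]_k), `|h| < d / (2 * K).
  by apply/nbhs_ballP; exists (d / (2 * K)) => // h; rewrite -ball_normE/= sub0r normrN.
have N3 : \forall h \near (0 : 'rV[R]_k), ball 0 r (h + t).
  exact: (@near_shift0 _ _ (ball 0 r) _ (open_nbhs_nbhs (conj (ball_open _ _) bt))).
near=> h.
have H1 : `|sg (h + t) - sg t| < d / (2 * (`|v0| + 1)).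
  by rewrite distrC; near: h.
have H2 : `|h| < d / (2 * K) by near: h.
have bht : ball 0 r (h + t) by near: h.
have [_ sht _ _] := Hsg bht.
set De := sg (h + t) - sg t in H1 *.
pose w := h *m L + De *: v0.
have wE : E (h + t) = w + y.
  rewrite /w /y /De mulmxDl scalerBl.
  set A := h *m L; set C := t *m L; set F := _ *: v0; set G := _ *: v0.
  by apply/rowP => j; rewrite !mxE; ring.
have nh := normr_ge0 h; have nD := normr_ge0 De; have nv := normr_ge0 v0.
have wn : `|w| <= K * `|h| + `|De| * `|v0|.
  apply: le_trans (ler_normD _ _) _; rewrite normrZ.
  by apply: lerD; [exact: HK|].
have wd : `|w| < d.
  apply: le_lt_trans wn _; rewrite [ltRHS]splitr; apply: ltr_leD.
    move: H2; rewrite ltr_pdivlMr ?mulr_gt0//; lra.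
  move: H1; rewrite ltr_pdivlMr ?mulr_gt0// ?ltr_wpDl//; lra.
have := Hd w; rewrite -ball_normE/= sub0r normrN => /(_ wd).
rewrite -wE sht -st subrr sub0r normrN => dw.
have dwE : De - l h = a^-1 * 'd s y w.
  rewrite lE /w linearD [X in _ * (_ + X)]linearZ/= aE.
  by rewrite -[De *: a]/(De * a); field.
have m1 : `|De - l h| <= q * `|w|.
  rewrite dwE normrM normfV ler_pdivrMl//.
  by apply: le_trans dw _; rewrite mulrA [`|a| * q]mulrC.
have m2 : `|De| <= `|l h| + `|De - l h|.
  by have := ler_normD (l h) (De - l h); rewrite addrC subrK.
have m3 : q * `|w| <= q * (K * `|h|) + q * `|v0| * `|De|.
  by rewrite [X in _ + X]mulrAC -mulrA -mulrDr ler_pM2l.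
have m4 : q * `|v0| * `|De| <= 2^-1 * `|De| by rewrite ler_wpM2r.
have m5 : q * (K * `|h|) <= K * `|h| by rewrite ler_piMl// mulr_ge0// ltW.
have m6 : `|De| <= 2 * (Q + K) * `|h|.
  by have := lQ h; lra.
have m7 : `|w| <= B * `|h|.
  apply: le_trans wn _; rewrite /B mulrDl lerD2l mulrAC.
  exact: ler_wpM2r.
apply: le_trans m1 _; apply: (@le_trans _ _ (q * (B * `|h|))).
  by rewrite ler_pM2l.
by rewrite mulrA ler_wpM2r.
Unshelve. all: by end_near. Qed.

(** Bootstrap: if [sg] is smooth to order [p], so is the point [E t], hence so is the quotient of
    [implicit_diff] giving the derivatives of [sg], which is then smooth to order [p.+1]. *)
Lemma implicit_ksmooth p : ksmooth p (ball 0 r) sg /\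
  ksmooth p (ball 0 r) (fun t => E t).
Proof.
have ob : open (ball (0 : 'rV[R]_k) r) by exact: ball_open.
have EK q : ksmooth q (ball 0 r) sg -> ksmooth q (ball 0 r) (fun t => E t).
  move=> H; apply/ksmooth_rVP => // i.
  apply: (@ksmooth_eq _ _ _ _ _
     (fun t : 'rV[R]_k => u0 0 i + \sum_j t 0 j * L j i + sg t * v0 0 i)) => //.
    by move=> t _; rewrite !mxE.
  apply: ksmoothD => //.
    apply: ksmoothD => //; first exact: (ksmooth_cst (u0 0 i : R)).
    apply: ksmooth_sum => // j; apply: ksmoothM => //; last exact: (ksmooth_cst (L j i : R)).
    exact: ksmooth_coord.
  by apply: ksmoothM => //; exact: (ksmooth_cst (v0 0 i : R)).
suff S : ksmooth p (ball 0 r) sg by split=> //; exact: EK.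
elim: p => [|p IH].
  by apply/ksmooth0 => t /implicit_diff[].
apply/ksmoothS; split=> [t /implicit_diff[]//|v].
apply: (@ksmooth_eq _ _ _ _ _ (fun t => - (('D_v0 s (E t))^-1 * 'D_(v *m L) s (E t)))) => //.
  by move=> t /implicit_diff[_ ->]; rewrite mulNr.
have EU t : ball 0 r t -> U (E t) by move=> /Hsg[].
have sp w : ksmooth p U ('D_w s).
  by have /smooth_onP/(_ p.+1)/ksmoothS[_ /(_ w)] := sU.
have sE w : ksmooth p (ball 0 r) (fun t => 'D_w s (E t)).
  exact: ksmooth_comp ob oU EU (EK _ IH) (sp w).
have nz t : ball 0 r t -> 'D_v0 s (E t) != 0 by move=> /Hsg[].
exact: (ksmoothN ob (ksmoothM ob (ksmoothV ob nz (sE v0)) (sE (v *m L)))).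
Qed.

End Implicit2.

Theorem implicit_function (R : realType) (k n : nat) (U : set 'rV[R]_n)
    (s : 'rV[R]_n -> R) (u0 v0 : 'rV[R]_n) (L : 'M[R]_(k, n)) :
  open U -> smooth_on U s -> U u0 -> 'D_v0 s u0 != 0 ->
  exists2 r : R, 0 < r & exists sg : 'rV[R]_k -> R, [/\ sg 0 = 0,
    smooth_on (ball 0 r) sg,
    smooth_on (ball 0 r) (fun t => u0 + t *m L + sg t *: v0) &
    forall t, ball 0 r t -> [/\ U (u0 + t *m L + sg t *: v0),
      s (u0 + t *m L + sg t *: v0) = s u0 &
      'D_v0 s (u0 + t *m L + sg t *: v0) != 0]].
Proof.
move=> oU sU Uu0; rewrite neq_lt => /orP[neg|pos]; last first.
  have [r r0 [sg [sg0 H]]] := implicit_pos L oU sU Uu0 pos.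
  exists r => //; exists sg; split=> //.
  - by apply/smooth_onP => p; case: (implicit_ksmooth oU sU H p).
  - by apply/smooth_onP => p; case: (implicit_ksmooth oU sU H p).
  - by move=> t /H[].
(* A negative derivative along [v0] is a positive one along [- v0]; the solution found for [- v0] is
   read with the opposite sign. *)
have DN x : U x -> 'D_(- v0) s x = - 'D_v0 s x.
  by move=> Ux; have dx := sU [::] _ Ux; rewrite !deriveE// linearN.
have pos : 0 < 'D_(- v0) s u0 by rewrite DN// oppr_gt0.
have [r r0 [sg [sg0 H]]] := implicit_pos L oU sU Uu0 pos.
have flip t : u0 + t *m L + - sg t *: v0 = u0 + t *m L + sg t *: - v0.
  by rewrite scalerN scaleNr.
have ob : open (ball (0 : 'rV[R]_k) r) by exact: ball_open.
exists r => //; exists (fun t => - sg t); split.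
- by rewrite sg0 oppr0.
- apply/smooth_onP => p; have [sgp _] := implicit_ksmooth oU sU H p.
  exact: (ksmoothN ob sgp).
- apply/smooth_onP => p; have [_ Ep] := implicit_ksmooth oU sU H p.
  by apply: ksmooth_eq Ep => // t _; rewrite flip.
- move=> t /H; rewrite flip => -[H1 H2 H3 _]; split=> //.
  by move: H3; rewrite DN// oppr_eq0.
Qed.

(** * Linear algebra at a point of CP^m *)

Section HermitianAlgebra.
Variables (R : realType) (m : nat).
Local Notation C := (R[i]).
Local Notation mat := 'M[R[i]]_m.+1.
Local Notation Re := (@complex.Re R).
Local Notation Im := (@complex.Im R).
Local Notation ii := (0 +i* 1 : R[i]).
Implicit Types (P X Y Z N V : mat).

Lemma cReD (a b : C) : Re (a + b) = Re a + Re b. Proof. by case: a; case: b. Qed.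
Lemma cReN (a : C) : Re (- a) = - Re a. Proof. by case: a. Qed.
Lemma cReB (a b : C) : Re (a - b) = Re a - Re b. Proof. by rewrite cReD cReN. Qed.
Lemma cImD (a b : C) : Im (a + b) = Im a + Im b. Proof. by case: a; case: b. Qed.
Lemma cImN (a : C) : Im (- a) = - Im a. Proof. by case: a. Qed.
Lemma cImB (a b : C) : Im (a - b) = Im a - Im b. Proof. by rewrite cImD cImN. Qed.
Lemma cReM (a b : C) : Re (a * b) = Re a * Re b - Im a * Im b. Proof. by case: a; case: b. Qed.
Lemma cImM (a b : C) : Im (a * b) = Re a * Im b + Im a * Re b. Proof. by case: a; case: b. Qed.
Lemma cRe_conj (a : C) : Re (Num.conj a) = Re a. Proof. by case: a. Qed.
Lemma cIm_conj (a : C) : Im (Num.conj a) = - Im a. Proof. by case: a. Qed.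
Lemma cRe_sum I (r : seq I) (p : pred I) (f : I -> C) :
  Re (\sum_(i <- r | p i) f i) = \sum_(i <- r | p i) Re (f i).
Proof. exact: (big_morph Re cReD (erefl (Re 0))). Qed.
Lemma cIm_sum I (r : seq I) (p : pred I) (f : I -> C) :
  Im (\sum_(i <- r | p i) f i) = \sum_(i <- r | p i) Im (f i).
Proof. exact: (big_morph Im cImD (erefl (Im 0))). Qed.
Lemma complex_eq (a b : C) : Re a = Re b -> Im a = Im b -> a = b.
Proof. by case: a => x y; case: b => z t /= -> ->. Qed.
Lemma iiM : ii * ii = -1.
Proof. by apply: complex_eq; rewrite ?cReM ?cImM /=; ring. Qed.
Lemma conj_ii : Num.conj ii = - ii.
Proof. by apply: complex_eq; rewrite ?cReN ?cImN ?cRe_conj ?cIm_conj /=; ring. Qed.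

Lemma adjE p q (A : 'M[C]_(p, q)) i j : A^t* i j = Num.conj (A j i).
Proof. by rewrite !mxE. Qed.
Lemma adjD p q (A B : 'M[C]_(p, q)) : (A + B)^t* = A^t* + B^t*.
Proof. by apply/matrixP => i j; rewrite !mxE rmorphD. Qed.
Lemma adjN p q (A : 'M[C]_(p, q)) : (- A)^t* = - A^t*.
Proof. by apply/matrixP => i j; rewrite !mxE rmorphN. Qed.
Lemma adjB p q (A B : 'M[C]_(p, q)) : (A - B)^t* = A^t* - B^t*.
Proof. by rewrite adjD adjN. Qed.
Lemma adjZ p q a (A : 'M[C]_(p, q)) : (a *: A)^t* = Num.conj a *: A^t*.
Proof. by apply/matrixP => i j; rewrite !mxE rmorphM. Qed.
Lemma adjM p q r (A : 'M[C]_(p, q)) (B : 'M[C]_(q, r)) : (A *m B)^t* = B^t* *m A^t*.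
Proof. by rewrite trmx_mul map_mxM. Qed.
Lemma adjK p q (A : 'M[C]_(p, q)) : (A ^t* ) ^t* = A.
Proof. by apply/matrixP => i j; rewrite !mxE conjCK. Qed.
Lemma adj1 : (1%:M : mat)^t* = 1%:M.
Proof. by rewrite tr_scalar_mx map_scalar_mx rmorph1. Qed.
Lemma tr_adj p (A : 'M[C]_p) : \tr (A ^t* ) = Num.conj (\tr A).
Proof. by rewrite /mxtrace rmorph_sum; apply: eq_bigr => i _; rewrite adjE. Qed.

Lemma mxtrace_sub p (A B : 'M[C]_p) : \tr (A - B) = \tr A - \tr B.
Proof. by rewrite raddfB. Qed.
Lemma mxtrace_opp p (A : 'M[C]_p) : \tr (- A) = - \tr A.
Proof. by rewrite raddfN. Qed.

Lemma metricC X Y : CP_metric X Y = CP_metric Y X.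
Proof. by rewrite /CP_metric mxtrace_mulC. Qed.
Lemma metricDl X Y Z : CP_metric (X + Y) Z = CP_metric X Z + CP_metric Y Z.
Proof. by rewrite /CP_metric mulmxDl mxtraceD cReD mulrDl. Qed.
Lemma metricDr X Y Z : CP_metric X (Y + Z) = CP_metric X Y + CP_metric X Z.
Proof. by rewrite !(metricC X) metricDl. Qed.
Lemma metricNl X Y : CP_metric (- X) Y = - CP_metric X Y.
Proof. by rewrite /CP_metric mulNmx mxtrace_opp cReN mulNr. Qed.
Lemma metricNr X Y : CP_metric X (- Y) = - CP_metric X Y.
Proof. by rewrite !(metricC X) metricNl. Qed.
Lemma metricBl X Y Z : CP_metric (X - Y) Z = CP_metric X Z - CP_metric Y Z.
Proof. by rewrite metricDl metricNl. Qed.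
Lemma metricBr X Y Z : CP_metric X (Y - Z) = CP_metric X Y - CP_metric X Z.
Proof. by rewrite metricDr metricNr. Qed.
Lemma metricZl (a : R) X Y : CP_metric (a%:C *: X) Y = a * CP_metric X Y.
Proof. by rewrite /CP_metric -scalemxAl mxtraceZ cReM /= mul0r subr0 mulrA. Qed.
Lemma metricZr (a : R) X Y : CP_metric X (a%:C *: Y) = a * CP_metric X Y.
Proof. by rewrite !(metricC X) metricZl. Qed.
Lemma metric0l X : CP_metric 0 X = 0.
Proof. by rewrite /CP_metric mul0mx mxtrace0 mul0r. Qed.
Lemma metric0r X : CP_metric X 0 = 0.
Proof. by rewrite metricC metric0l. Qed.

Lemma tr_adj_mul X : \tr (X *m X^t* ) = (\sum_i \sum_j (Re (X i j) ^+ 2 + Im (X i j) ^+ 2))%:C.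
Proof.
rewrite /mxtrace rmorph_sum; apply: eq_bigr => i _.
rewrite mxE rmorph_sum; apply: eq_bigr => j _; rewrite adjE.
by apply: complex_eq; rewrite ?cReM ?cImM ?cRe_conj ?cIm_conj /=; ring.
Qed.

Lemma metric_ge0 X : X^t* = X -> 0 <= CP_metric X X.
Proof.
move=> HX; rewrite /CP_metric -{2}HX tr_adj_mul /= divr_ge0//.
by apply: sumr_ge0 => i _; apply: sumr_ge0 => j _; rewrite addr_ge0// sqr_ge0.
Qed.

Lemma metric_eq0 X : X^t* = X -> CP_metric X X = 0 -> X = 0.
Proof.
move=> HX; rewrite /CP_metric -{2}HX tr_adj_mul /= => /eqP.
rewrite mulf_eq0 invr_eq0 pnatr_eq0 orbF psumr_eq0; last first.
  by move=> i _; apply: sumr_ge0 => j _; rewrite addr_ge0// sqr_ge0.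
move=> /allP H; apply/matrixP => i j; rewrite mxE.
have := H i (mem_index_enum _); rewrite psumr_eq0; last first.
  by move=> k _; rewrite addr_ge0// sqr_ge0.
move=> /allP/(_ j (mem_index_enum _)) /=.
rewrite paddr_eq0 ?sqr_ge0// !sqrf_eq0 => /andP[/eqP r0 /eqP i0].
by apply: complex_eq; rewrite ?r0 ?i0.
Qed.

(** Take a full rank factorization [P = a b]. Cancelling the factors in [P P = P] gives [b a = 1],
    so the trace of [P] is the inner dimension, which is therefore 1. That dimension is kept as a
    variable [r] so that [r = 1] can be substituted in the types. *)
Lemma CP_factor P : CP P -> exists (a : 'cV[C]_m.+1) (b : 'rV[C]_m.+1),
  P = a *m b /\ b *m a = 1%:M.
Proof.
move=> [_ PP trP].
have [r [a [b [E ba]]]] : exists r (a : 'M[C]_(m.+1, r)) (b : 'M[C]_(r, m.+1)),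
    P = a *m b /\ b *m a = 1%:M.
  exists (\rank P), (col_base P), (row_base P).
  have E := mulmx_base P; split; first by rewrite E.
  have : col_base P *m ((row_base P *m col_base P) *m row_base P) =
         col_base P *m (1%:M *m row_base P).
    by rewrite mul1mx E -[row_base P *m _ *m _]mulmxA E mulmxA E PP.
  move=> /(row_full_inj (col_base_full _)).
  by move=> /(row_free_inj (row_base_free _)).
have r1 : r = 1%N.
  have : \tr (b *m a) = 1 by rewrite mxtrace_mulC -E.
  by rewrite ba mxtrace1 => /eqP; rewrite -[1]/(1%:R) eqr_nat => /eqP.
by subst r; exists a, b.
Qed.

(** With [P = a b], the middle factor [b M a] is a 1 by 1 matrix, equal to its trace. Traces such as
    [hprod] are turned back into matrix identities in this way. *)
Lemma CP_rank1 P (M : mat) : CP P -> P *m M *m P = \tr (P *m M) *: P.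
Proof.
move=> /CP_factor[a [b [-> ba]]].
have E : b *m (M *m a) = (\tr (a *m b *m M))%:M.
  by rewrite -mulmxA mxtrace_mulC -mulmxA [LHS]mx11_scalar /mxtrace big_ord1.
by rewrite mulmxA -!mulmxA [M *m (a *m b)]mulmxA [b *m _]mulmxA E mul_scalar_mx -scalemxAr mulmxA.
Qed.

Section AtPoint.
Variable P : mat.
Hypothesis CPP : CP P.

Let PH : P^t* = P. Proof. by case: CPP. Qed.
Let PP : P *m P = P. Proof. by case: CPP. Qed.
Let trP : \tr P = 1. Proof. by case: CPP. Qed.

Lemma CP_neq0 : exists z : 'cV[C]_m.+1, z != 0 /\ P *m z = z.
Proof.
have [a [b [E ba]]] := CP_factor CPP; exists a; split; last first.
  by rewrite E -mulmxA ba mulmx1.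
apply/eqP => a0; move: ba; rewrite a0 mulmx0 => /matrixP/(_ 0 0).
by rewrite !mxE/= => /eqP; rewrite eq_sym oner_eq0.
Qed.

Lemma tangent_adj X : CP_tangent P X -> X^t* = X. Proof. by case. Qed.
Lemma tangentE X : CP_tangent P X -> X *m P + P *m X = X. Proof. by case. Qed.

Lemma tangent0 : CP_tangent P 0.
Proof. by split; rewrite ?mul0mx ?mulmx0 ?addr0//; apply/matrixP => i j; rewrite !mxE rmorph0. Qed.
Lemma tangentD X Y : CP_tangent P X -> CP_tangent P Y -> CP_tangent P (X + Y).
Proof.
move=> [X1 X2] [Y1 Y2]; split; first by rewrite adjD X1 Y1.
by rewrite mulmxDl mulmxDr addrACA X2 Y2.
Qed.
Lemma tangentZ (a : R) X : CP_tangent P X -> CP_tangent P (a%:C *: X).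
Proof.
move=> [X1 X2]; split; last by rewrite -scalemxAl -scalemxAr -scalerDr X2.
by rewrite adjZ X1; congr (_ *: _); apply: complex_eq; rewrite ?cRe_conj ?cIm_conj /= ?oppr0.
Qed.
Lemma tangentN X : CP_tangent P X -> CP_tangent P (- X).
Proof.
by move=> [X1 X2]; split; rewrite ?adjN ?X1// mulNmx mulmxN -opprD X2.
Qed.
Lemma tangentB X Y : CP_tangent P X -> CP_tangent P Y -> CP_tangent P (X - Y).
Proof. by move=> TX TY; apply: tangentD => //; exact: tangentN. Qed.

Lemma tangentPP X : CP_tangent P X -> P *m X *m P = 0.
Proof.
move=> TX; have := congr1 (fun Z => P *m Z *m P) (tangentE TX).
rewrite mulmxDr mulmxDl !mulmxA PP -!mulmxA PP => /eqP.
by rewrite -subr_eq0 addrK => /eqP.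
Qed.

(** A tangent matrix maps the line of [P] and its orthogonal complement into each other, so a
    product of two of them preserves both. *)
Lemma tangent_mul_comm X Y : CP_tangent P X -> CP_tangent P Y ->
  X *m Y *m P = P *m (X *m Y).
Proof.
move=> TX TY.
have -> : X *m Y *m P = X *m Y - X *m P *m Y.
  by rewrite -{2}(tangentE TY) mulmxDr !mulmxA addrK.
by rewrite -{1}(tangentE TX) mulmxDl addrAC subrr add0r mulmxA.
Qed.

(** Off-diagonal blocks against diagonal blocks, in the splitting given by [P]. Parts normal to CP^m
    are discarded through this lemma. *)
Lemma tr_tangent_comm X D : CP_tangent P X -> D *m P = P *m D -> \tr (X *m D) = 0.
Proof.
move=> TX DP.
have E : \tr (X *m P *m D) = 0.
  have -> : X *m P *m D = X *m P *m D *m P.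
    by rewrite -[RHS]mulmxA DP mulmxA -[X *m P *m P]mulmxA PP.
  by rewrite mxtrace_mulC mulmxA mulmxA tangentPP// mul0mx mxtrace0.
rewrite -{1}(tangentE TX) mulmxDl mxtraceD E add0r mxtrace_mulC mulmxA DP.
by rewrite mxtrace_mulC mulmxA.
Qed.

Lemma JE X : CP_J P X = ii *: (X *m P - P *m X). Proof. by []. Qed.

Lemma J_tangent X : CP_tangent P X -> CP_tangent P (CP_J P X).
Proof.
move=> TX; have XX := tangentPP TX; split.
  by rewrite adjZ adjB !adjM PH (tangent_adj TX) conj_ii scaleNr -scalerN opprB.
rewrite -scalemxAl -scalemxAr -scalerDr mulmxBl mulmxBr !mulmxA PP XX.
by rewrite -mulmxA PP subr0 sub0r.
Qed.

Lemma JJ X : CP_tangent P X -> CP_J P (CP_J P X) = - X.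
Proof.
move=> TX; have XX := tangentPP TX.
rewrite !JE -scalemxAl -scalemxAr -scalerBr scalerA iiM scaleN1r; congr (- _).
rewrite mulmxBl mulmxBr !mulmxA PP XX -mulmxA PP subr0 sub0r opprK.
exact: tangentE.
Qed.

Lemma JD X Y : CP_J P (X + Y) = CP_J P X + CP_J P Y.
Proof. by rewrite !JE -scalerDr mulmxDl mulmxDr opprD addrACA. Qed.
Lemma JN X : CP_J P (- X) = - CP_J P X.
Proof. by rewrite !JE -scalerN mulNmx mulmxN opprB opprK addrC. Qed.

Lemma JZ a X : CP_J P (a *: X) = a *: CP_J P X.
Proof. by rewrite !JE -scalemxAl -scalemxAr -scalerBr !scalerA mulrC. Qed.

(* The Hermitian product <x, y> of the vectors with X = x z^H + z x^H and Y = y z^H + z y^H *)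
Definition hprod X Y : C := \tr (P *m X *m Y).

Lemma hprod_conj X Y : CP_tangent P X -> CP_tangent P Y ->
  hprod Y X = Num.conj (hprod X Y).
Proof.
move=> TX TY; rewrite /hprod -tr_adj !adjM PH (tangent_adj TX) (tangent_adj TY).
by rewrite -mulmxA mxtrace_mulC !mulmxA.
Qed.

Lemma metric_hprod X Y : CP_tangent P X -> CP_tangent P Y -> CP_metric X Y = Re (hprod X Y).
Proof.
move=> TX TY; rewrite /CP_metric -{1}(tangentE TX) mulmxDl mxtraceD.
have -> : \tr (X *m P *m Y) = hprod Y X.
  by rewrite /hprod -mulmxA mxtrace_mulC.
by rewrite hprod_conj// cReD cRe_conj /hprod; field.
Qed.

Lemma metricJ X Y : CP_tangent P X -> CP_tangent P Y -> CP_metric (CP_J P X) Y = Im (hprod X Y).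
Proof.
move=> TX TY; rewrite metric_hprod//; last exact: J_tangent.
rewrite /hprod JE -scalemxAr -scalemxAl mxtraceZ mulmxBr [P *m (X *m P)]mulmxA tangentPP// sub0r.
by rewrite mulmxA PP mulNmx mxtrace_opp cReM cReN cImN /=; ring.
Qed.

Lemma metricJJ X Y : CP_tangent P X -> CP_tangent P Y ->
  CP_metric (CP_J P X) (CP_J P Y) = CP_metric X Y.
Proof.
move=> TX TY; rewrite metricJ//; last exact: J_tangent.
rewrite metric_hprod// [in RHS]hprod_conj// cRe_conj.
have -> : hprod X (CP_J P Y) = ii * hprod X Y.
  rewrite /hprod JE -scalemxAr mxtraceZ; congr (_ * _).
  rewrite mulmxBr mxtrace_sub !mulmxA tangentPP// mul0mx mxtrace0 subr0.
  by rewrite mxtrace_mulC !mulmxA PP.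
by rewrite cImM /= hprod_conj// cRe_conj; ring.
Qed.

Lemma metricJl X Y : CP_tangent P X -> CP_tangent P Y ->
  CP_metric (CP_J P X) Y = - CP_metric X (CP_J P Y).
Proof.
move=> TX TY; rewrite -(metricJJ (X := X))//; last exact: J_tangent.
by rewrite JJ// metricNr opprK.
Qed.

Lemma metricJ0 X : CP_tangent P X -> CP_metric (CP_J P X) X = 0.
Proof.
by move=> TX; have := metricJl TX TX; rewrite (metricC X); lra.
Qed.

End AtPoint.
End HermitianAlgebra.

Ltac mxring :=
  repeat match goal with |- context [@mulmx ?R ?a ?b ?c ?x ?y] =>
    let t := fresh "t" in move: (@mulmx R a b c x y) => t end;
  let i := fresh "i" in let j := fresh "j" in
  apply/matrixP => i j; rewrite !mxE; ring.

(** * A unit normal at a point and the line it determines *)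

Section NormalAlgebra.
Variables (R : realType) (m : nat).
Local Notation C := (R[i]).
Local Notation mat := 'M[R[i]]_m.+1.
Local Notation Re := (@complex.Re R).
Local Notation Im := (@complex.Im R).
Local Notation ii := (0 +i* 1 : R[i]).
Implicit Types (P X Y Z N V : mat).

Variable P : mat.
Hypothesis CPP : CP P.

Let PH : P^t* = P. Proof. by case: CPP. Qed.
Let PP : P *m P = P. Proof. by case: CPP. Qed.
Let trP : \tr P = 1. Proof. by case: CPP. Qed.

Lemma proj_tangent Z : Z^t* = Z -> CP_tangent P (CP_proj P Z).
Proof.
move=> HZ; split.
  by rewrite /CP_proj adjD !adjM adjB adj1 PH HZ addrC !mulmxA.
rewrite /CP_proj; set Q := 1%:M - P.
have QP : Q *m P = 0 by rewrite mulmxBl mul1mx PP subrr.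
have PQ : P *m Q = 0 by rewrite mulmxBr mulmx1 PP subrr.
by rewrite mulmxDl mulmxDr -!mulmxA QP PP !mulmxA PP PQ !mul0mx !mulmx0 add0r addr0 addrC.
Qed.

Lemma projE Z : CP_proj P Z = P *m Z + Z *m P - P *m Z *m P - P *m Z *m P.
Proof.
by rewrite /CP_proj mulmxBr mulmx1 mulmxBl mul1mx mulmxBl; mxring.
Qed.

Lemma proj_id X : CP_tangent P X -> CP_proj P X = X.
Proof.
by move=> TX; rewrite projE tangentPP// -[RHS](tangentE TX); mxring.
Qed.

Lemma metric_proj Z Y : CP_tangent P Y -> CP_metric (CP_proj P Z) Y = CP_metric Z Y.
Proof.
move=> TY; apply/eqP; rewrite -subr_eq0 -metricBl; apply/eqP.
rewrite /CP_metric mxtrace_mulC (tr_tangent_comm CPP TY) ?mul0r//.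
rewrite projE !mulmxBl !mulmxBr !mulmxDl !mulmxDr !mulmxA PP.
rewrite -![_ *m P *m P]mulmxA PP.
by mxring.
Qed.

Lemma tangent_mul_comm2 X Y : CP_tangent P X -> CP_tangent P Y ->
  (X *m Y + Y *m X) *m P = P *m (X *m Y + Y *m X).
Proof. by move=> TX TY; rewrite mulmxDl mulmxDr !tangent_mul_comm. Qed.

(** The hypothesis on [Z] is [N P + P N = N] differentiated, with [K = N X + X N]. Its diagonal
    blocks give [P Z P = - P K] and [(1 - P) Z (1 - P) = K (1 - P)], which make up the part of [Z]
    normal to CP^m. *)
Lemma dnormal_decomp Z K : K *m P = P *m K -> Z = Z *m P + K + P *m Z ->
  Z = CP_proj P Z + K *m (1%:M - 2%:R *: P).
Proof.
move=> KP E.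
have PZP : P *m Z *m P = - (P *m K).
  have : P *m Z *m P = P *m (Z *m P + K + P *m Z) *m P by rewrite -E.
  rewrite 2!mulmxDr 2!mulmxDl [P *m (Z *m P)]mulmxA [P *m (P *m Z)]mulmxA PP.
  rewrite -[P *m Z *m P *m P]mulmxA -[P *m K *m P]mulmxA KP [P *m (P *m K)]mulmxA !PP.
  move=> /eqP; rewrite -subr_eq0 => /eqP H; apply/eqP; rewrite -subr_eq0 -oppr_eq0 -{}H.
  by apply/eqP; mxring.
rewrite projE PZP mulmxBr mulmx1 -scalemxAr KP {1}E.
by mxring.
Qed.

Section Normal.
Variable N : mat.
Hypotheses (TN : CP_tangent P N) (N1 : CP_metric N N = 1).

Let NPN0 : P *m N *m P = 0. Proof. exact: tangentPP. Qed.

Lemma hprodNN : hprod P N N = 1.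
Proof.
apply: complex_eq; first by rewrite -metric_hprod.
by rewrite -metricJ// metricJ0.
Qed.

Lemma PNN : P *m N *m N = P.
Proof.
have := CP_rank1 (N *m N) CPP; rewrite mulmxA -/(hprod P N N) hprodNN scale1r => E.
by rewrite -[RHS]E -[P *m N *m N]mulmxA -[RHS]mulmxA tangent_mul_comm// !mulmxA PP.
Qed.

Lemma NNP : N *m N *m P = P.
Proof. by rewrite tangent_mul_comm// mulmxA PNN. Qed.

Definition nproj : mat := N *m P *m N.

Lemma nproj_CP : CP nproj.
Proof.
have NH := tangent_adj TN; split.
- by rewrite /nproj !adjM NH PH mulmxA.
- by rewrite /nproj !mulmxA -[N *m P *m N *m N]mulmxA -[N *m P *m (N *m N)]mulmxA
    [P *m (N *m N)]mulmxA PNN -[N *m P *m P]mulmxA PP.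
- by rewrite /nproj -mulmxA mxtrace_mulC PNN.
Qed.

Lemma P_nproj : P *m nproj = 0.
Proof. by rewrite /nproj !mulmxA NPN0 mul0mx. Qed.

Lemma nproj_P : nproj *m P = 0.
Proof. by rewrite /nproj -!mulmxA [P *m (N *m P)]mulmxA NPN0 mulmx0. Qed.

Lemma NN : N *m N = P + nproj.
Proof.
by rewrite -{2}(tangentE TN) mulmxDr mulmxA NNP mulmxA.
Qed.

Definition holo X : Prop := [/\ CP_tangent P X, CP_metric X N = 0 & CP_metric X (CP_J P N) = 0].

Lemma holo_tangent X : holo X -> CP_tangent P X. Proof. by case. Qed.

Lemma holoD X Y : holo X -> holo Y -> holo (X + Y).
Proof.
move=> [X1 X2 X3] [Y1 Y2 Y3]; split; first exact: tangentD.
  by rewrite metricDl X2 Y2 addr0.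
by rewrite metricDl X3 Y3 addr0.
Qed.
Lemma holoZ (a : R) X : holo X -> holo (a%:C *: X).
Proof.
move=> [X1 X2 X3]; split; first exact: tangentZ.
  by rewrite metricZl X2 mulr0.
by rewrite metricZl X3 mulr0.
Qed.
Lemma holoJ X : holo X -> holo (CP_J P X).
Proof.
move=> [X1 X2 X3]; split; first exact: J_tangent.
  by rewrite (metricJl CPP)// X3 oppr0.
by rewrite (metricJJ CPP).
Qed.

Section HoloVector.
Variable X : mat.
Hypothesis DX : holo X.

Let TX : CP_tangent P X. Proof. by case: DX. Qed.

Lemma hprod_holo : hprod P N X = 0 /\ hprod P X N = 0.
Proof.
have [_ X2 X3] := DX.
suff H : hprod P X N = 0.
  by split=> //; rewrite (hprod_conj CPP TX TN) H rmorph0.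
apply: complex_eq; first by rewrite -(metric_hprod CPP).
by rewrite -(metricJ CPP)// (metricJl CPP)// X3 oppr0.
Qed.

Lemma PNX : P *m N *m X = 0.
Proof.
have := CP_rank1 (N *m X) CPP; rewrite mulmxA -/(hprod P N X) hprod_holo.1 scale0r => E.
by rewrite -[RHS]E -[P *m N *m X]mulmxA -[RHS]mulmxA tangent_mul_comm// !mulmxA PP.
Qed.

Lemma PXN : P *m X *m N = 0.
Proof.
have := CP_rank1 (X *m N) CPP; rewrite mulmxA -/(hprod P X N) hprod_holo.2 scale0r => E.
by rewrite -[RHS]E -[P *m X *m N]mulmxA -[RHS]mulmxA tangent_mul_comm// !mulmxA PP.
Qed.

Lemma NXP : N *m X *m P = 0.
Proof. by rewrite tangent_mul_comm// mulmxA PNX. Qed.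

Lemma XNP : X *m N *m P = 0.
Proof. by rewrite tangent_mul_comm// mulmxA PXN. Qed.

Lemma NXN : N *m X *m N = 0.
Proof.
rewrite -{2}(tangentE TN) mulmxDr -mulmxA [X *m (N *m P)]mulmxA XNP mulmx0 add0r.
by rewrite mulmxA NXP mul0mx.
Qed.

End HoloVector.
End Normal.
End NormalAlgebra.

Section NormalAlgebra2.
Variables (R : realType) (m : nat).
Local Notation C := (R[i]).
Local Notation mat := 'M[R[i]]_m.+1.
Local Notation Re := (@complex.Re R).
Local Notation Im := (@complex.Im R).
Local Notation ii := (0 +i* 1 : R[i]).
Implicit Types (P X Y Z N V : mat).

Lemma col_norm_eq0 n (v : 'cV[C]_n) : v^t* *m v = 0 -> v = 0.
Proof.
move=> /matrixP/(_ 0 0); rewrite !mxE => /eqP.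
rewrite psumr_eq0 => [/allP H|i _]; last by rewrite !mxE mulrC mul_conjC_ge0.
apply/matrixP => i j; rewrite (ord1 j) mxE.
have := H i (mem_index_enum _); rewrite /= !mxE mulrC mul_conjC_eq0.
by move=> /eqP.
Qed.

(** A rank one projection fixing [w] is [w w^H] divided by its trace. *)
Lemma rank1_fixed P P' (w : 'cV[C]_m.+1) : CP P -> CP P' -> w != 0 ->
  P *m w = w -> P' *m w = w -> P = P'.
Proof.
move=> CP1 CP2 w0.
have H Q : CP Q -> Q *m w = w -> w *m w^t* = \tr (w *m w^t*) *: Q.
  move=> CQ Qw; have := CP_rank1 (w *m w^t*) CQ; rewrite mulmxA Qw => <-.
  by case: CQ => QH _ _; rewrite -[in RHS]QH -mulmxA -adjM Qw.
move=> /(H _ CP1) E1 /(H _ CP2) E2; move: E2; rewrite {1}E1 => E.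
have t0 : \tr (w *m w^t*) != 0.
  apply/eqP; rewrite mxtrace_mulC /mxtrace big_ord1 => t0.
  move/eqP: w0; apply; apply: col_norm_eq0; apply/matrixP => i j.
  by rewrite !ord1 t0 mxE.
by apply: (scalerI t0).
Qed.

Variable P : mat.
Hypothesis CPP : CP P.

Let PH : P^t* = P. Proof. by case: CPP. Qed.
Let PP : P *m P = P. Proof. by case: CPP. Qed.
Let trP : \tr P = 1. Proof. by case: CPP. Qed.

Variable N : mat.
Hypotheses (TN : CP_tangent P N) (N1 : CP_metric N N = 1).

Let NPN0 : P *m N *m P = 0. Proof. exact: tangentPP. Qed.

(* the value, for Z = dN(X), of the derivative in the direction X of N P N *)
Definition dnproj X Z : mat := Z *m P *m N + N *m X *m N + N *m P *m Z.

Section Holo.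
Variables X Z : mat.
Hypotheses (DX : holo P N X) (HZ : Z = Z *m P + (N *m X + X *m N) + P *m Z).
Let TX : CP_tangent P X. Proof. by case: DX. Qed.

Let K := N *m X + X *m N.

Let KP : K *m P = 0.
Proof. by rewrite mulmxDl (NXP CPP TN DX) (XNP CPP TN DX) addr0. Qed.

Let PK : P *m K = 0.
Proof. by rewrite -tangent_mul_comm2. Qed.

Lemma dnormal_holo : Z = CP_proj P Z + K.
Proof.
have KPK : K *m P = P *m K by rewrite KP PK.
by rewrite {1}(dnormal_decomp CPP KPK HZ) mulmxBr mulmx1 -scalemxAr KP scaler0 subr0.
Qed.

Lemma dnproj_holo :
  dnproj X Z = CP_proj P Z *m P *m N + N *m P *m CP_proj P Z.
Proof.
rewrite /dnproj (NXN CPP TN DX) addr0.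
move: dnormal_holo KP PK; generalize K => k E kP Pk; rewrite {1 2}E.
by rewrite !mulmxDl !mulmxDr kP mul0mx addr0 -[N *m P *m k]mulmxA Pk mulmx0 addr0.
Qed.

(** A tangential part of dN along [J N] only turns the phase of the vector [w] in
    [N = w z^H + z w^H], and the projection onto its line does not see it. *)
Lemma dnproj_shape (c : R) : CP_proj P Z = c%:C *: CP_J P N -> dnproj X Z = 0.
Proof.
move=> E; rewrite dnproj_holo E JE scalerA -!scalemxAl -scalemxAr -scalerDr.
have -> : (N *m P - P *m N) *m P *m N = N *m P *m N.
  by rewrite mulmxBl NPN0 subr0 -[N *m P *m P]mulmxA PP.
have -> : N *m P *m (N *m P - P *m N) = - (N *m P *m N).
  by rewrite mulmxBr -[N *m P *m (N *m P)]mulmxA [P *m (N *m P)]mulmxA NPN0 mulmx0 sub0r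
     mulmxA -[N *m P *m P]mulmxA PP.
by rewrite subrr scaler0.
Qed.

(** Multiplying the vanishing derivative on the right by [N P] isolates [V P] and shows it to be a
    complex multiple of [N P]. So [V] lies in the complex line of [N], to which D is orthogonal. *)
Lemma shape_dnproj Y : dnproj X Z = 0 -> holo P N Y -> Z^t* = Z ->
  CP_metric (CP_proj P Z) Y = 0.
Proof.
rewrite dnproj_holo; set V := CP_proj P Z => E DY ZH.
have TV : CP_tangent P V by exact: proj_tangent.
have VP : V *m P = - (hprod P V N *: (N *m P)).
  have := congr1 (fun M => M *m (N *m P)) E; rewrite mul0mx mulmxDl.
  have -> : V *m P *m N *m (N *m P) = V *m P.
    by rewrite -!mulmxA [N *m (N *m P)]mulmxA (NNP CPP TN N1) PP.
  have -> : N *m P *m V *m (N *m P) = hprod P V N *: (N *m P).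
    have := CP_rank1 (V *m N) CPP; rewrite [P *m (V *m N)]mulmxA -/(hprod P V N) => E1.
    by rewrite scalemxAr -E1 !mulmxA.
  by move=> /eqP; rewrite addr_eq0 => /eqP.
have PV : P *m V = - (Num.conj (hprod P V N) *: (P *m N)).
  have := congr1 (fun M => M^t*) VP.
  by rewrite adjM adjN adjZ adjM PH (tangent_adj TV) (tangent_adj TN).
have TY : CP_tangent P Y by case: DY.
rewrite (metric_hprod CPP)// /hprod PV mulNmx -scalemxAl (PNX CPP TN DY).
by rewrite scaler0 oppr0 mxtrace0.
Qed.

End Holo.

Section Codazzi.
Variables X Y Zx Zy : mat.
Hypotheses (DX : holo P N X) (HZx : Zx = Zx *m P + (N *m X + X *m N) + P *m Zx).
Hypotheses (DY : holo P N Y) (HZy : Zy = Zy *m P + (N *m Y + Y *m N) + P *m Zy).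
Hypotheses (ZHx : Zx^t* = Zx) (ZHy : Zy^t* = Zy).

(* the value of the derivative of -J N in the direction Y *)
Definition dxi Y Zy : mat := - (ii *: (Zy *m P + N *m Y - (Y *m N + P *m Zy))).

Let Vx := CP_proj P Zx.
Let Vy := CP_proj P Zy.

Lemma dxi_holo : dxi Y Zy = - CP_J P Vy - ii *: (N *m Y - Y *m N).
Proof.
have KP : (N *m Y + Y *m N) *m P = 0.
  by rewrite mulmxDl (NXP CPP TN DY) (XNP CPP TN DY) addr0.
have PK : P *m (N *m Y + Y *m N) = 0.
  have TY : CP_tangent P Y by case: DY.
  by rewrite -tangent_mul_comm2.
have E1 : Zy *m P = Vy *m P by rewrite {1}(dnormal_holo DY HZy) mulmxDl KP addr0.
have E2 : P *m Zy = P *m Vy by rewrite {1}(dnormal_holo DY HZy) mulmxDr PK addr0.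
rewrite /dxi E1 E2 JE; mxring.
Qed.

Lemma tr_codazzi : \tr ((N *m X + X *m N) *m (N *m Y - Y *m N)) =
  \tr (P *m Y *m X) - \tr (P *m X *m Y).
Proof.
have TX : CP_tangent P X by case: DX.
have TY : CP_tangent P Y by case: DY.
have NYN := NXN CPP TN DY.
have aux A B : holo P N A -> holo P N B -> \tr (N *m N *m A *m B) = \tr (P *m A *m B).
  move=> DA DB; rewrite (NN CPP TN N1) !mulmxDl mxtraceD /nproj.
  by rewrite -!mulmxA [P *m (N *m (A *m B))]mulmxA [P *m N *m (A *m B)]mulmxA
    (PNX CPP TN DA) mul0mx mulmx0 mxtrace0 addr0.
have E1 : N *m X *m (N *m Y) = 0 by rewrite mulmxA (NXN CPP TN DX) mul0mx.
have E2 : \tr (N *m X *m (Y *m N)) = \tr (P *m X *m Y).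
  by rewrite mulmxA mxtrace_mulC !mulmxA aux.
have E3 : \tr (X *m N *m (N *m Y)) = \tr (P *m Y *m X).
  by rewrite -mulmxA mxtrace_mulC !mulmxA aux.
have E4 : X *m N *m (Y *m N) = 0 by rewrite -mulmxA [N *m (Y *m N)]mulmxA NYN mulmx0.
rewrite (mulmxDl (N *m X)) (mulmxBr (N *m X)) (mulmxBr (X *m N)) E1 E4 sub0r subr0.
by rewrite mxtraceD mxtrace_opp E2 E3 addrC.
Qed.

(** Both factors split into a tangential part and a part commuting with [P], and mixed products have
    no trace. The tangential parts give the shape operator term; the commuting parts, computed in
    [tr_codazzi], give what the curvature of CP^m contributes to the Codazzi equation. *)
Lemma metric_codazzi : CP_metric Zx (dxi Y Zy) =
  - CP_metric Vx (CP_J P Vy) + CP_metric (CP_J P Y) X.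
Proof.
have TX : CP_tangent P X by case: DX.
have TY : CP_tangent P Y by case: DY.
have TVx : CP_tangent P Vx by exact: proj_tangent.
have TVy : CP_tangent P (CP_J P Vy) by apply: (J_tangent CPP); exact: proj_tangent.
rewrite dxi_holo {1}(dnormal_holo DX HZx) metricDl !metricBr !metricNr -/Vx.
have c1 : CP_metric Vx (ii *: (N *m Y - Y *m N)) = 0.
  rewrite /CP_metric (tr_tangent_comm CPP TVx) ?mul0r//.
  by rewrite -scalemxAl -scalemxAr mulmxBl mulmxBr !tangent_mul_comm.
have c2 : CP_metric (N *m X + X *m N) (CP_J P Vy) = 0.
  rewrite metricC /CP_metric (tr_tangent_comm CPP TVy) ?mul0r//.
  by rewrite tangent_mul_comm2.
rewrite c1 c2 subr0 oppr0 add0r; congr (_ + _).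
rewrite /CP_metric -scalemxAr mxtraceZ tr_codazzi -/(hprod P Y X) -/(hprod P X Y).
rewrite -/(CP_metric _ _) (metricJ CPP)// (hprod_conj CPP TX TY).
by rewrite cReM cReB cImB cRe_conj cIm_conj /=; field.
Qed.

End Codazzi.

(** For [X = xi] one has [N X = - i (P - G)] and [X N = - N X], so that dN(xi) is tangent and two of
    the three terms of [dnproj] have no trace against [X]. The third gives the trace of
    [(N X)^2 = - (P + G)], that is -2, halved by the metric. *)
Lemma dnproj_xi Z : Z^t* = Z ->
  Z = Z *m P + (N *m (- CP_J P N) + (- CP_J P N) *m N) + P *m Z ->
  CP_metric (dnproj (- CP_J P N) Z) (- CP_J P N) = - 1.
Proof.
move=> ZH; set X := - CP_J P N; set G := nproj P N.
have NX : N *m X = - (ii *: (P - G)).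
  rewrite /X JE mulmxN -scalemxAr mulmxBr !mulmxA (NNP CPP TN N1).
  by [].
have XN : X *m N = - (ii *: (G - P)).
  by rewrite /X JE mulNmx -scalemxAl mulmxBl (PNN CPP TN N1).
have K0 : N *m X + X *m N = 0 by rewrite NX XN -opprD -scalerDr -opprB addNr scaler0 oppr0.
rewrite K0 addr0 => HZ.
have TZ : CP_tangent P Z by split.
have [GH GG trG] := nproj_CP CPP TN N1.
have PG : P *m G = 0 by exact: (P_nproj CPP TN).
have GP : G *m P = 0 by exact: (nproj_P CPP TN).
have Z0 : \tr (Z *m P) = 0 by exact: (tr_tangent_comm CPP TZ).
have E1 : \tr (Z *m P *m N *m X) = 0.
  have -> : Z *m P *m N *m X = - ii *: (Z *m P).
    by rewrite -mulmxA NX mulmxN -scalemxAr mulmxBr -[Z *m P *m G]mulmxA PG mulmx0 subr0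
       -mulmxA PP scaleNr.
  by rewrite mxtraceZ Z0 mulr0.
have E2 : \tr (N *m P *m Z *m X) = 0.
  rewrite mxtrace_mulC !mulmxA XN mulNmx mulNmx -!scalemxAl mulmxBl GP PP sub0r.
  by rewrite mulNmx mxtrace_opp mxtraceZ mxtrace_opp [\tr (P *m Z)]mxtrace_mulC Z0 oppr0 mulr0 oppr0.
have E3 : \tr (N *m X *m N *m X) = - 2%:R.
  rewrite -mulmxA NX mulNmx mulmxN opprK -scalemxAl -scalemxAr scalerA iiM scaleN1r.
  rewrite mulmxBl !mulmxBr PP PG GP GG mxtrace_opp subr0 sub0r opprK mxtraceD trP trG.
  by rewrite -[2%:R]/(1 + 1).
rewrite /CP_metric /dnproj !mulmxDl !mxtraceD E1 E2 E3 add0r addr0 cReN.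
have -> : Re 2%:R = 2 by rewrite -[2%:R]/(1 + 1) cReD.
by rewrite mulNr divff// pnatr_eq0.
Qed.

(** The matrix [S] projects onto the complement of the lines of [P] and [G]. If [S w] were nonzero,
    the tangent vector [S w z^H + z (S w)^H], which lies in D, would not kill [w]. *)
Lemma holo_kernel (w : 'cV[C]_m.+1) : P *m w = 0 ->
  (forall X, holo P N X -> X *m w = 0) -> nproj P N *m w = w.
Proof.
move=> Pw HX; set G := nproj P N.
have [GH GG trG] := nproj_CP CPP TN N1.
have PG : P *m G = 0 by exact: (P_nproj CPP TN).
have GP : G *m P = 0 by exact: (nproj_P CPP TN).
pose S := 1%:M - P - G.
have SH : S^t* = S by rewrite !adjB adj1 PH GH.
have SP : S *m P = 0 by rewrite !mulmxBl mul1mx PP GP subrr subr0.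
have PS : P *m S = 0 by rewrite !mulmxBr mulmx1 PP PG subrr subr0.
have SNP : S *m N *m P = 0.
  rewrite !mulmxBl mul1mx NPN0 subr0 /G /nproj -!mulmxA [N *m (N *m P)]mulmxA (NNP CPP TN N1).
  by rewrite PP subrr.
have hX M : holo P N (S *m M *m P + P *m M^t* *m S).
  set X := _ + _.
  have TX : CP_tangent P X.
    split; first by rewrite /X adjD !adjM adjK PH SH addrC !mulmxA.
    rewrite /X mulmxDl mulmxDr !mulmxA PP PS !mul0mx add0r.
    by rewrite -[S *m M *m P *m P]mulmxA PP -[P *m _ *m S *m P]mulmxA SP mulmx0 addr0.
  have h0 : hprod P X N = 0.
    rewrite /hprod /X mulmxDr !mulmxA PS !mul0mx add0r PP -mulmxA mxtrace_mulC !mulmxA.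
    by rewrite SNP mul0mx mxtrace0.
  have TJ := J_tangent CPP TN.
  split=> //; first by rewrite (metric_hprod CPP)// h0.
  by rewrite -[LHS]opprK -(metricJl CPP)// (metricJ CPP)// h0 oppr0.
have [z [z0 Pz]] := CP_neq0 CPP.
have := HX _ (hX (S *m w *m z^t*)).
rewrite mulmxDl -[_ *m P *m w]mulmxA Pw mulmx0 add0r !adjM adjK SH.
rewrite !mulmxA Pz => H.
have : S *m w = 0.
  apply: col_norm_eq0; rewrite adjM SH.
  have : z *m (w^t* *m S *m (S *m w)) = 0 by rewrite !mulmxA.
  move: (w^t* *m S *m (S *m w)) => u; rewrite [u]mx11_scalar mul_mx_scalar => /eqP.
  by rewrite scaler_eq0 (negbTE z0) orbF => /eqP ->; rewrite raddf0.
by rewrite !mulmxBl mul1mx Pw subr0 => /eqP; rewrite subr_eq0 => /eqP.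
Qed.

End NormalAlgebra2.

(** The model is [a X = g(AX, xi)] and [b X Y = g(AX, Y)] on D; the long identity is purity paired
    with [Z]. The scaling [sc] is abstract because D is a real subspace of a space of complex
    matrices. *)
Lemma bilinear_vanish (R : realType) (V : zmodType) (sc : R -> V -> V) (D : V -> Prop)
    (J : V -> V) (a : V -> R) (b : V -> V -> R) :
  (forall X Y, D X -> D Y -> D (X + Y)) -> (forall c X, D X -> D (sc c X)) ->
  (forall X, D X -> D (J X)) -> (forall X, D X -> J (J X) = - X) ->
  (forall X Y, J (X + Y) = J X + J Y) -> (forall c X, J (sc c X) = sc c (J X)) ->
  (forall X Y, D X -> D Y -> a (X + Y) = a X + a Y) ->
  (forall c X, D X -> a (sc c X) = c * a X) -> (forall X, D X -> a (- X) = - a X) ->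
  (forall X Y, D X -> D Y -> b (- X) Y = - b X Y) ->
  (forall X Y, D X -> D Y -> b X (- Y) = - b X Y) ->
  (forall X Y Z, D X -> D Y -> D Z ->
    a Y * b (J X) (J Z) + a Z * (b (J X) (J Y) + b X Y) = a (J Y) * b X (J Z)) ->
  (exists2 Z, D Z & a Z != 0) -> forall X Y, D X -> D Y -> b X Y = 0.
Proof.
move=> DD DZ DJ JJ JD JZ aD aZ aN bNl bNr E [Y0 DY0 a0].
have DJ0 := DJ _ DY0.
have DN0 : D (- Y0) by rewrite -JJ//; exact: DJ.
pose p := a Y0; pose q := a (J Y0).
(* A vector of the plane of [Y0] and [J Y0] adapted to [a]: the value of [a] is [p^2 + q^2] at [Y]
   and [p q - q p = 0] at [J Y]. *)
pose Y := sc p Y0 + sc q (J Y0).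
have DY : D Y by apply: DD; apply: DZ.
have JYE : J Y = sc p (J Y0) + sc q (- Y0) by rewrite JD JZ JZ JJ.
have aJY : a (J Y) = 0.
  rewrite JYE aD; [|exact: DZ|exact: DZ].
  by rewrite !aZ// aN// -/p -/q; ring.
have aY : 0 < a Y.
  rewrite aD; [|exact: DZ|exact: DZ].
  rewrite !aZ// -/p -/q -!expr2 ltr_pwDl ?sqr_ge0//.
  by rewrite exprn_even_gt0.
have DJY := DJ _ DY.
(* At [(X, J Y, J Y)] the identity reduces to [a(Y) b(X, Y) = 0]. *)
have bY X : D X -> b X Y = 0.
  move=> DX; have := E _ _ _ DX DJY DJY; rewrite aJY !mul0r add0r JJ// aN// bNr//.
  by rewrite mulrNN => /esym/eqP; rewrite mulf_eq0 (gt_eqF aY)/= => /eqP.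
(* At [(X, Y, Y)] the identity reads [2 a(Y) b(JX, JY) = 0]; at [(X, Y, Z)] only [a(Y) b(JX, JZ)]
   then survives. *)
have c0 X Z : D X -> D Z -> b (J X) (J Z) = 0.
  move=> DX DZ'; have := E _ _ _ DX DY DY; rewrite aJY mul0r bY// addr0.
  move=> /eqP; rewrite -mulrDr mulf_eq0 (gt_eqF aY)/= -mulr2n mulrn_eq0/= => /eqP cY.
  have := E _ _ _ DX DY DZ'; rewrite aJY mul0r bY// cY addr0 mulr0 addr0 => /eqP.
  by rewrite mulf_eq0 (gt_eqF aY)/= => /eqP.
move=> X Z DX DZ'; have := c0 _ _ (DJ _ DX) (DJ _ DZ').
have DNZ : D (- Z) by rewrite -JJ//; exact: DJ (DJ _ _).
by rewrite !JJ// bNl// bNr// opprK.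
Qed.

(** The first equation is the xi-component of purity at [(X, X)], the next two are the Codazzi
    equation for [(JX, X)] and [(X, JX)]. After substitution all terms in [al] cancel and [2 nn = 0]
    remains, with [nn = |X|^2]. *)
Lemma hopf_arith (R : realFieldType) (al a1 a2 b1 b2 c1 d1 n1 n2 s nn : R) :
  a1 - al * b1 = a2 - al * b2 -> 2 * a1 = al * (b1 + c1) + 2 * n1 ->
  2 * a2 = al * (b2 + d1) + 2 * n2 ->
  c1 = - s -> n1 = - nn -> b2 = s -> n2 = nn -> b1 = - d1 -> nn = 0.
Proof. by move=> E C1 C2 ? ? ? ? ?; subst c1 n1 b2 n2 b1; lra. Qed.

(** * Eta-purity as a condition on the shape operator at one point *)

Section EtaPureAlgebra.
Variables (R : realType) (m : nat).
Local Notation C := (R[i]).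
Local Notation mat := 'M[R[i]]_m.+1.
Implicit Types (X Y Z W : mat).

(** Copies at one point of the notions of the theorem, for an operator [A] on matrices. Assumptions
    on [A] are restricted to tangent vectors because [shape] only has a default value elsewhere. *)
Definition xi_at (P N : mat) : mat := - CP_J P N.
Definition eta_at (P N X : mat) : R := CP_metric X (xi_at P N).
Definition phi_at (P N X : mat) : mat := CP_J P X - (eta_at P N X)%:C *: N.
Definition cho_at (P N : mat) (A : mat -> mat) (X Y : mat) : mat :=
  (CP_metric (phi_at P N (A X)) Y)%:C *: xi_at P N
  - (eta_at P N Y)%:C *: phi_at P N (A X).
Definition cho_shape_at (P N : mat) (A : mat -> mat) (X Y : mat) : mat :=
  cho_at P N A X (A Y) - A (cho_at P N A X Y).
Definition tang_at (P N X : mat) : Prop := CP_tangent P X /\ CP_metric X N = 0.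

Variables (P N : mat) (A : mat -> mat).
Hypotheses (CPP : CP P) (TN : CP_tangent P N) (N1 : CP_metric N N = 1).
Local Notation xi := (xi_at P N).
Local Notation eta := (eta_at P N).
Local Notation phi := (phi_at P N).
Local Notation choA := (cho_shape_at P N A).
Local Notation tang := (tang_at P N).

Hypothesis A_tang : forall X, tang X -> tang (A X).
Hypothesis AD : forall X Y, tang X -> tang Y -> A (X + Y) = A X + A Y.
Hypothesis AZ : forall (c : R) X, tang X -> A (c%:C *: X) = c%:C *: A X.
Hypothesis A_sym : forall X Y, tang X -> tang Y -> CP_metric (A X) Y = CP_metric (A Y) X.

Local Notation D := (holo P N).

Let TJN : CP_tangent P (CP_J P N). Proof. exact: J_tangent. Qed.

Let xi_tang : tang xi.
Proof.
split; first exact: tangentN.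
by rewrite /xi_at metricNl metricJ0// oppr0.
Qed.

Let D_tang X : D X -> tang X. Proof. by case. Qed.

Let eta_D X : D X -> eta X = 0.
Proof. by move=> [_ _ H]; rewrite /eta_at /xi_at metricNr H oppr0. Qed.

Let xi_xi : CP_metric xi xi = 1.
Proof. by rewrite /xi_at metricNl metricNr opprK metricJJ. Qed.

Let phi_D X : D X -> phi X = CP_J P X.
Proof. by move=> DX; rewrite /phi_at eta_D// scale0r subr0. Qed.

Let holJ X : D X -> D (CP_J P X). Proof. exact: holoJ. Qed.

Let phi_metric X Y : CP_metric Y N = 0 -> CP_metric (phi X) Y = CP_metric (CP_J P X) Y.
Proof.
by move=> YN; rewrite /phi_at metricBl metricZl (metricC N) YN mulr0 subr0.
Qed.

Let AN X : tang X -> A (- X) = - A X.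
Proof.
move=> tX; have E : (-1)%:C = -1 :> C by apply: complex_eq => //=; rewrite oppr0.
by have := AZ (-1) tX; rewrite E !scaleN1r.
Qed.

Definition bform X Y : R := CP_metric (A X) Y.
Definition aform X : R := CP_metric (A X) xi.

(** This is the D-component of A_F. Pairing with [Z] in D removes the first half of [F_X AY], and
    [eta Y = 0] removes the second half of [F_X Y]; the rest is J moved across the metric. *)
Let cho_metric X Y Z : D X -> D Y -> D Z ->
  CP_metric (choA X Y) Z = aform Y * bform X (CP_J P Z) + bform X (CP_J P Y) * aform Z.
Proof.
move=> DX DY DZ; have tX := D_tang DX; have tY := D_tang DY; have tZ := D_tang DZ.
have [TAX AXN] := A_tang tX; have [TAY AYN] := A_tang tY.
have [TZ ZN] := tZ; have [TY YN] := tY.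
rewrite /cho_shape_at /cho_at (eta_D DY).
have := phi_metric (A X); move: (phi (A X)) => F HF.
rewrite (scale0r F) subr0 (AZ _ xi_tang) 2!metricBl 3!metricZl (metricC xi Z).
rewrite -/(eta Z) (eta_D DZ) mulr0 sub0r !HF// !(metricJl CPP)// (A_sym xi_tang tZ).
by rewrite /bform /eta_at -/(aform Z) -/(aform Y) mulrN mulNr !opprK.
Qed.

Hypothesis pure : forall X Y, D X -> D Y -> choA (phi X) Y = choA X (phi Y).

Let aD X Y : D X -> D Y -> aform (X + Y) = aform X + aform Y.
Proof. by move=> DX DY; rewrite /aform AD ?metricDl//; exact: D_tang. Qed.
Let aZ c X : D X -> aform (c%:C *: X) = c * aform X.
Proof. by move=> DX; rewrite /aform AZ ?metricZl//; exact: D_tang. Qed.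
Let aN X : D X -> aform (- X) = - aform X.
Proof. by move=> DX; rewrite /aform AN ?metricNl//; exact: D_tang. Qed.

Let E X Y Z : D X -> D Y -> D Z ->
  aform Y * bform (CP_J P X) (CP_J P Z) + aform Z * (bform (CP_J P X) (CP_J P Y) + bform X Y) =
  aform (CP_J P Y) * bform X (CP_J P Z).
Proof.
move=> DX DY DZ; have H := pure DX DY; rewrite (phi_D DX) (phi_D DY) in H.
have := etrans (esym (cho_metric (holJ DX) DY DZ))
  (etrans (congr1 (fun M => CP_metric M Z) H) (cho_metric DX (holJ DY) DZ)).
rewrite (JJ CPP (holo_tangent DY)).
have -> : bform X (- Y) = - bform X Y by rewrite /bform metricNr.
move: (aform Y) (aform Z) (aform (CP_J P Y)) (bform (CP_J P X) (CP_J P Z))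
  (bform (CP_J P X) (CP_J P Y)) (bform X Y) (bform X (CP_J P Z)) => a1 a2 a3 b1 b2 b3 b4 E.
have -> : a1 * b1 + a2 * (b2 + b3) = (a1 * b1 + b2 * a2) + a2 * b3 by ring.
by rewrite E; ring.
Qed.

Lemma eta_pure_nonhopf : (exists2 Z, D Z & aform Z != 0) ->
  forall X Y, D X -> D Y -> bform X Y = 0.
Proof.
apply: (@bilinear_vanish R mat (fun c X => c%:C *: X) _ (CP_J P)).
- exact: holoD.
- by move=> c X; exact: holoZ.
- exact: holJ.
- by move=> X /holo_tangent; exact: JJ.
- exact: JD.
- by move=> c X; exact: JZ.
- exact: aD.
- exact: aZ.
- exact: aN.
- by move=> X Y DX _; rewrite /bform (AN (D_tang DX)) metricNl.
- by move=> X Y DX _; rewrite /bform metricNr.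
- exact: E.
Qed.

Hypothesis hopf : forall X, D X -> aform X = 0.
Local Notation alpha := (CP_metric (A xi) xi).

Hypothesis codazzi : forall X Y, D X -> D Y ->
  2 * CP_metric (CP_J P (A X)) (A Y) =
  alpha * (CP_metric (CP_J P (A X)) Y + CP_metric (A (CP_J P X)) Y)
  + 2 * CP_metric (CP_J P X) Y.

Let cho_xi X Y : D X -> D Y -> CP_metric (choA X Y) xi =
  CP_metric (CP_J P (A X)) (A Y) - alpha * CP_metric (CP_J P (A X)) Y.
Proof.
move=> DX DY; have tX := D_tang DX; have tY := D_tang DY.
have [TAX AXN] := A_tang tX; have [TAY AYN] := A_tang tY.
have [TY YN] := tY.
rewrite /cho_shape_at /cho_at (eta_D DY).
have := phi_metric (A X); move: (phi (A X)) => F HF.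
rewrite (scale0r F) subr0 (AZ _ xi_tang) 2!metricBl 3!metricZl xi_xi mulr1.
by rewrite /eta_at -/(aform Y) (hopf DY) mul0r subr0 !HF// mulrC [alpha * _]mulrC.
Qed.

(** The conclusion serves as a contradiction: it is applied to a vector on which the second
    fundamental form is nonzero. *)
Lemma eta_pure_hopf X : D X -> X = 0.
Proof.
move=> DX; have TX := holo_tangent DX; have DJX := holJ DX.
have [TAX _] := A_tang (D_tang DX).
apply: (metric_eq0 (tangent_adj TX)).
have H := pure DX DX; rewrite (phi_D DX) in H.
have E0 := etrans (esym (cho_xi DJX DX))
  (etrans (congr1 (fun M => CP_metric M xi) H) (cho_xi DX DJX)).
have [TAJX _] := A_tang (D_tang DJX).
have F1 : CP_metric (A (CP_J P (CP_J P X))) X = - CP_metric (A X) X.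
  by rewrite (JJ CPP TX) (AN (D_tang DX)) metricNl.
have F2 : CP_metric (CP_J P (CP_J P X)) X = - CP_metric X X.
  by rewrite (JJ CPP TX) metricNl.
exact: (hopf_arith E0 (codazzi DJX DX) (codazzi DX DJX) F1 F2 (metricJJ CPP TAX TX)
  (metricJJ CPP TX TX) (metricJl CPP TAJX TX)).
Qed.

End EtaPureAlgebra.

Lemma hyperplane_basis (F : fieldType) (k n : nat) (d : 'cV[F]_n) :
  n = k.+1 -> d != 0 -> exists L : 'M[F]_(k, n), [/\ row_free L, L *m d = 0 &
    forall x : 'rV_n, x *m d = 0 -> exists v : 'rV_k, x = v *m L].
Proof.
move=> nk d0.
have [r [L [rk fL Ld sL]]] : exists r (L : 'M[F]_(r, n)), [/\ r = k, row_free L, L *m d = 0 &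
    forall x : 'rV_n, x *m d = 0 -> exists v : 'rV_r, x = v *m L].
  exists (\rank (kermx d)), (row_base (kermx d)); split.
  - rewrite mxrank_ker; suff -> : \rank d = 1%N by rewrite nk subn1.
    by apply/eqP; rewrite eqn_leq rank_leq_col lt0n mxrank_eq0.
  - exact: row_base_free.
  - by apply/sub_kermxP; rewrite eq_row_base.
  - move=> x /sub_kermxP; rewrite -[in X in X -> _](eq_row_base (kermx d)) => /submxP[v ->].
    by exists v.
by subst r; exists L.
Qed.

Lemma row_freeI (F : fieldType) p q (A : 'M[F]_(p, q)) :
  (forall v : 'rV_p, v *m A = 0 -> v = 0) -> row_free A.
Proof.
by move=> H; rewrite -kermx_eq0; apply/rowV0P => v /sub_kermxP; exact: H.
Qed.

(** * Real bases of the tangent spaces of CP^m, and dimension counts *)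

Section TangentBasis.
Variables (R : realType) (m : nat).
Local Notation C := (R[i]).
Local Notation mat := 'M[R[i]]_m.+1.
Local Notation Re := (@complex.Re R).
Local Notation Im := (@complex.Im R).
Local Notation ii := (0 +i* 1 : R[i]).

Definition rcomb n (e : 'I_n -> mat) (v : 'rV[R]_n) : mat :=
  \sum_i (v 0 i)%:C *: e i.

Lemma metric_rcomb n (e : 'I_n -> mat) v Y :
  CP_metric (rcomb e v) Y = \sum_i v 0 i * CP_metric (e i) Y.
Proof.
rewrite /rcomb; elim/big_rec2: _ => [|i y1 y2 _ <-]; first exact: metric0l.
by rewrite metricDl metricZl.
Qed.

Lemma tangent_rcomb P n (e : 'I_n -> mat) v : (forall i, CP_tangent P (e i)) ->
  CP_tangent P (rcomb e v).
Proof.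
move=> Te; rewrite /rcomb; elim/big_rec: _ => [|i x _ Tx]; first exact: tangent0.
by apply: tangentD => //; exact: tangentZ.
Qed.

Lemma rcombZ n (e : 'I_n -> mat) c v : rcomb e (c *: v) = c%:C *: rcomb e v.
Proof.
rewrite /rcomb scaler_sumr; apply: eq_bigr => i _.
by rewrite mxE rmorphM scalerA.
Qed.

Lemma rcomb0 n (e : 'I_n -> mat) : rcomb e 0 = 0.
Proof. by rewrite -[0 in LHS](scale0r 0) rcombZ scale0r. Qed.

(** Write [P = a b] and let the rows of [B] span the row vectors killed by [a]. A vector [c] of C^m
    corresponds to [a c B] plus its adjoint, and the real basis comes from the [e_j] and the
    [i e_j]. *)
Lemma tangent_basis (P : mat) : CP P -> exists E : 'I_(m + m) -> mat,
  [/\ forall k, CP_tangent P (E k),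
      forall r, rcomb E r = 0 -> r = 0 &
      forall X, CP_tangent P X -> exists r, X = rcomb E r].
Proof.
move=> CPP; have [PH PP _] := CPP; have [a [b [PE ba]]] := CP_factor CPP.
have a0 : a != 0.
  apply/eqP => a0; move: ba; rewrite a0 mulmx0 => /matrixP/(_ 0 0).
  by rewrite !mxE/= => /eqP; rewrite eq_sym oner_eq0.
have [B [fB Ba sB]] := hyperplane_basis (erefl _) a0.
have Pa : P *m a = a by rewrite PE -mulmxA ba mulmx1.
have bP : b *m P = b by rewrite PE mulmxA ba mul1mx.
pose H (c : 'rV[C]_m) := a *m (c *m B).
have PHc c : P *m H c = H c by rewrite /H mulmxA Pa.
have HcP c : H c *m P = 0 by rewrite /H PE -!mulmxA [B *m _]mulmxA Ba mul0mx !mulmx0.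
have HD c d : H (c + d) = H c + H d.
  by rewrite /H mulmxDl mulmxDr.
have HZ (t : C) c : H (t *: c) = t *: H c.
  by rewrite /H -scalemxAl -scalemxAr.
pose T c := H c + (H c)^t*.
have TT c : CP_tangent P (T c).
  split; first by rewrite adjD adjK addrC.
  rewrite /T mulmxDl mulmxDr HcP PHc add0r.
  have -> : (H c)^t* *m P = (H c)^t* by rewrite -{1}PH -adjM PHc.
  have -> : P *m (H c)^t* = 0 by rewrite -{1}PH -adjM HcP; apply/matrixP => i j; rewrite !mxE rmorph0.
  by rewrite addr0 addrC.
have TD c d : T (c + d) = T c + T d by rewrite /T HD adjD addrACA.
have TZ (t : R) c : T (t%:C *: c) = t%:C *: T c.
  rewrite /T HZ adjZ scalerDr; congr (_ + _ *: _).
  by apply: complex_eq; rewrite ?cRe_conj ?cIm_conj //= oppr0.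
have Tinj c : T c = 0 -> c = 0.
  move=> Tc; have := congr1 (mulmx P) Tc; rewrite mulmx0 /T mulmxDr PHc.
  have -> : P *m (H c)^t* = 0 by rewrite -{1}PH -adjM HcP; apply/matrixP => i j; rewrite !mxE rmorph0.
  rewrite addr0 => /(congr1 (mulmx b)); rewrite /H mulmxA ba mul1mx mulmx0.
  by move/eqP; rewrite mul_mx_rowfree_eq0// => /eqP.
have Tsurj X : CP_tangent P X -> exists c, X = T c.
  move=> TX; have bXa : b *m X *m a = 0.
    rewrite -bP -Pa -!mulmxA [X *m _]mulmxA [P *m _]mulmxA [P *m (X *m P)]mulmxA tangentPP//.
    by rewrite mul0mx mulmx0.
  have [c cE] := sB _ bXa; exists c; rewrite /T /H -cE mulmxA -PE adjM PH (tangent_adj TX).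
  by rewrite addrC tangentE.
pose basis (k : 'I_(m + m)) : 'rV[C]_m :=
  match fintype.split k with inl j => delta_mx 0 j | inr j => ii *: delta_mx 0 j end.
have bL i : basis (lshift m i) = delta_mx 0 i.
  by rewrite /basis; have /= -> := unsplitK (inl i : 'I_m + 'I_m).
have bR i : basis (rshift m i) = ii *: delta_mx 0 i.
  by rewrite /basis; have /= -> := unsplitK (inr i : 'I_m + 'I_m).
have E (r : 'rV[R]_(m + m)) : rcomb (T \o basis) r =
    T (\row_j (r 0 (lshift m j) +i* r 0 (rshift m j))).
  rewrite /rcomb; transitivity (T (\sum_k (r 0 k)%:C *: basis k)).
    rewrite (big_morph T TD (_ : T 0 = 0)); last first.
      by rewrite -(scale0r 0) -[0]/(0%:C) TZ scale0r.
    by apply: eq_bigr => k _; rewrite TZ.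
  congr T; apply/rowP => j; rewrite summxE mxE big_split_ord/=.
  have S1 : \sum_(i < m) ((r 0 (lshift m i))%:C *: basis (lshift m i)) 0 j =
      (r 0 (lshift m j))%:C.
    rewrite (bigD1 j)//= big1 => [|i ij]; rewrite bL !mxE.
      by rewrite !eqxx mulr1 addr0.
    by rewrite eqxx/= eq_sym (negbTE ij) mulr0.
  have S2 : \sum_(i < m) ((r 0 (rshift m i))%:C *: basis (rshift m i)) 0 j =
      (r 0 (rshift m j))%:C * ii.
    rewrite (bigD1 j)//= big1 => [|i ij]; rewrite bR !mxE.
      by rewrite !eqxx mulr1 addr0.
    by rewrite eqxx/= eq_sym (negbTE ij) !mulr0.
  rewrite S1 S2.
  by apply: complex_eq; rewrite ?cReD ?cImD ?cReM ?cImM /=; ring.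
exists (T \o basis); split=> [k|r|X]; first exact: TT.
  rewrite E => /Tinj /rowP H0; apply/rowP => k; rewrite mxE -(fintype.splitK k).
  case: (fintype.split k) => j /=; have := H0 j; rewrite !mxE => -[] //.
move=> /Tsurj[c ->]; exists (row_mx (map_mx Re c) (map_mx Im c)); rewrite E; congr T.
by apply/rowP => j; rewrite mxE row_mxEl row_mxEr !mxE; apply: complex_eq.
Qed.

(** The matrix of products of a tangent basis with the [e i] has more rows than columns, hence a
    nonzero kernel vector: the coordinates of a normal. *)
Lemma exists_unit_normal (P : mat) n (e : 'I_n -> mat) : CP P -> (n < m + m)%N ->
  (forall i, CP_tangent P (e i)) ->
  exists N, [/\ CP_tangent P N, CP_metric N N = 1 & forall i, CP_metric (e i) N = 0].
Proof.
move=> CPP nm Te; have [E [TE Ei _]] := tangent_basis CPP.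
pose K := \matrix_(k, i) CP_metric (E k) (e i).
have : kermx K != 0.
  rewrite -mxrank_eq0 mxrank_ker -lt0n subn_gt0.
  exact: leq_ltn_trans (rank_leq_col _) nm.
move=> /rowV0Pn[r /sub_kermxP rK r0].
pose X := rcomb E r.
have TX : CP_tangent P X by exact: tangent_rcomb.
have Xe i : CP_metric X (e i) = 0.
  have H : (r *m K) 0 i = 0 by rewrite rK mxE.
  rewrite mxE in H; rewrite metric_rcomb -[RHS]H.
  by apply: eq_bigr => k _; rewrite mxE.
have X0 : X != 0 by apply/eqP => /Ei /eqP; rewrite (negbTE r0).
have gX : 0 < CP_metric X X.
  rewrite lt_neqAle metric_ge0 ?(tangent_adj TX)// andbT eq_sym.
  by apply: contra X0 => /eqP /(metric_eq0 (tangent_adj TX)) ->.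
exists ((Num.sqrt (CP_metric X X))^-1%:C *: X); split; first exact: tangentZ.
  rewrite metricZl metricZr mulrA -invfM -expr2 sqr_sqrtr ?ltW//.
  by rewrite mulVf// gt_eqF.
by move=> i; rewrite metricZr metricC Xe mulr0.
Qed.

(** Adding [N] as vector number 0 gives 2m independent vectors in dimension 2m, so the square matrix
    of their coordinates is invertible. *)
Lemma span_normal (P N : mat) n (e : 'I_n -> mat) : CP P -> n.+1 = (m + m)%N ->
  (forall i, CP_tangent P (e i)) -> (forall v, rcomb e v = 0 -> v = 0) ->
  CP_tangent P N -> CP_metric N N = 1 -> (forall i, CP_metric (e i) N = 0) ->
  forall X, CP_tangent P X -> CP_metric X N = 0 -> exists v, X = rcomb e v.
Proof.
move=> CPP nm Te ei TN N1 eN X TX XN; have [E [TE Ei Es]] := tangent_basis CPP.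
pose vec (i : 'I_n.+1) := if unlift ord0 i is Some j then e j else N.
have Tvec i : CP_tangent P (vec i) by rewrite /vec; case: unliftP.
have vecE u : rcomb vec u = (u 0 0)%:C *: N + rcomb e (\row_i u 0 (lift ord0 i)).
  rewrite /rcomb big_ord_recl /vec unlift_none; congr (_ + _).
  by apply: eq_bigr => i _; rewrite liftK mxE.
have gN u : CP_metric (rcomb vec u) N = u 0 0.
  rewrite vecE metricDl metricZl N1 mulr1 metric_rcomb big1 ?addr0// => i _.
  by rewrite eN mulr0.
pose cd i := projT1 (cid (Es _ (Tvec i))).
have cdE i : vec i = rcomb E (cd i) by rewrite /cd; case: cid.
pose L := \matrix_i cd i.
have LE u : rcomb E (u *m L) = rcomb vec u.
  rewrite /rcomb; under [RHS]eq_bigr do rewrite cdE /rcomb scaler_sumr.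
  rewrite exchange_big/=; apply: eq_bigr => k _.
  rewrite mxE rmorph_sum scaler_suml; apply: eq_bigr => i _.
  by rewrite !mxE rmorphM scalerA.
have fL : row_free L.
  apply: row_freeI => u uL; have := LE u; rewrite uL rcomb0 => /esym vu.
  have u0 : u 0 0 = 0 by rewrite -gN vu metric0l.
  move: vu; rewrite vecE u0 scale0r add0r => /ei /rowP H.
  apply/rowP => i; rewrite mxE; case: (unliftP ord0 i) => [j ->|->//].
  by have := H j; rewrite !mxE.
have fullL : row_full L by rewrite /row_full (eqP fL) nm.
have [r rE] := Es X TX.
have /submxP[u uE] : (r <= L)%MS by rewrite submx_full.
have XE : X = rcomb vec u by rewrite rE uE LE.
exists (\row_i u 0 (lift ord0 i)).
by move: XN; rewrite {1}XE gN => u0; rewrite XE vecE u0 scale0r add0r.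
Qed.

End TangentBasis.

(** * Matrix-valued maps *)

Section ComplexCalculus.
Variable R : realType.
Local Notation C := (R[i]).
Local Notation Re := (@complex.Re R).
Local Notation Im := (@complex.Im R).
Variable V : normedModType R.
Implicit Types (f g : V -> C) (x v : V).

Definition cdiff f x := differentiable (fun y => Re (f y) : R) x /\
  differentiable (fun y => Im (f y) : R) x.

Definition cderive f x v : C :=
  'D_v (fun y => Re (f y) : R) x +i* 'D_v (fun y => Im (f y) : R) x.

Lemma dderiv (W : normedModType R) (v : V) (f : V -> W) x (df : differentiable f x) :
  derivable f x v.
Proof. exact: diff_derivable. Qed.

Lemma derivative_mul (f g : V -> R) x v : differentiable f x -> differentiable g x ->
  'D_v (fun y => f y * g y) x = 'D_v f x * g x + f x * 'D_v g x.
Proof.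
move=> df dg; rewrite (@deriveM R V f g x v); [|exact: diff_derivable|exact: diff_derivable].
by rewrite addrC mulrC.
Qed.

Lemma derive_linear (f : V -> R) x (a : R) v w : differentiable f x ->
  'D_(a *: v + w) f x = a * 'D_v f x + 'D_w f x.
Proof. by move=> df; rewrite !(deriveE _ df) linearP. Qed.

Lemma cdiffD f g x : cdiff f x -> cdiff g x -> cdiff (fun y => f y + g y) x /\
  forall v, cderive (fun y => f y + g y) x v = cderive f x v + cderive g x v.
Proof.
move=> [f1 f2] [g1 g2].
have E1 : (fun y => Re (f y + g y)) = (fun y => Re (f y) + Re (g y)).
  by apply/funext => y; rewrite cReD.
have E2 : (fun y => Im (f y + g y)) = (fun y => Im (f y) + Im (g y)).
  by apply/funext => y; rewrite cImD.
split; first by split; rewrite ?E1 ?E2; exact: differentiableD.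
move=> v; rewrite /cderive E1 E2.
by rewrite (deriveD (dderiv f1) (dderiv g1))
  (deriveD (dderiv f2) (dderiv g2)).
Qed.

Lemma cdiffM f g x : cdiff f x -> cdiff g x -> cdiff (fun y => f y * g y) x /\
  forall v, cderive (fun y => f y * g y) x v = cderive f x v * g x + f x * cderive g x v.
Proof.
move=> [f1 f2] [g1 g2].
have E1 : (fun y => Re (f y * g y)) = (fun y => Re (f y) * Re (g y) - Im (f y) * Im (g y)).
  by apply/funext => y; rewrite cReM.
have E2 : (fun y => Im (f y * g y)) = (fun y => Re (f y) * Im (g y) + Im (f y) * Re (g y)).
  by apply/funext => y; rewrite cImM.
have d11 := differentiableM f1 g1; have d22 := differentiableM f2 g2.
have d12 := differentiableM f1 g2; have d21 := differentiableM f2 g1.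
split; first by split; rewrite ?E1 ?E2; [exact: differentiableB|exact: differentiableD].
move=> v; rewrite /cderive E1 E2.
rewrite (deriveB (dderiv d11) (dderiv d22)).
rewrite (deriveD (dderiv d12) (dderiv d21)).
by rewrite !derivative_mul//; apply: complex_eq; rewrite ?cReD ?cImD ?cReM ?cImM /=; ring.
Qed.

Lemma cdiff_cst (c : C) x : cdiff (fun=> c) x /\ forall v, cderive (fun=> c) x v = 0.
Proof.
split; first by split; exact: differentiable_cst.
move=> v; rewrite /cderive.
by rewrite (@derive_cst R V R (Re c)) (@derive_cst R V R (Im c)).
Qed.

Lemma cdiff_conj f x : cdiff f x -> cdiff (fun y => Num.conj (f y)) x /\
  forall v, cderive (fun y => Num.conj (f y)) x v = Num.conj (cderive f x v).
Proof.
move=> [f1 f2].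
have E1 : (fun y => Re (Num.conj (f y))) = (fun y => Re (f y)).
  by apply/funext => y; rewrite cRe_conj.
have E2 : (fun y => Im (Num.conj (f y))) = (fun y => - Im (f y)).
  by apply/funext => y; rewrite cIm_conj.
split; first by split; rewrite ?E1 ?E2//; exact: differentiableN.
by move=> v; rewrite /cderive E1 E2 (deriveN (dderiv f2)).
Qed.

Lemma cdiff_sum (I : Type) (r : seq I) (F : I -> V -> C) x : (forall i, cdiff (F i) x) ->
  cdiff (fun y => \sum_(i <- r) F i y) x /\
  forall v, cderive (fun y => \sum_(i <- r) F i y) x v = \sum_(i <- r) cderive (F i) x v.
Proof.
move=> dF; elim: r => [|i r [IH1 IH2]].
  have E : (fun y => \sum_(i <- [::]) F i y) = fun=> 0 by apply/funext => y; rewrite big_nil.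
  by rewrite E; have [H1 H2] := cdiff_cst 0 x; split=> // v; rewrite H2 big_nil.
have E : (fun y => \sum_(i <- i :: r) F i y) = (fun y => F i y + \sum_(i <- r) F i y).
  by apply/funext => y; rewrite big_cons.
have [H1 H2] := cdiffD (dF i) IH1.
by rewrite E; split=> // v; rewrite H2 big_cons IH2.
Qed.

Section Matrix.
Variable p : nat.
Local Notation mat := 'M[R[i]]_p.
Implicit Types (F G : V -> mat).

Definition mdiff F x := forall i j, cdiff (fun y => F y i j) x.

Lemma mderiveE F x v i j : mderive F x v i j = cderive (fun y => F y i j) x v.
Proof. by rewrite mxE. Qed.

Lemma mdiffD F G x : mdiff F x -> mdiff G x -> mdiff (fun y => F y + G y) x /\
  forall v, mderive (fun y => F y + G y) x v = mderive F x v + mderive G x v.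
Proof.
move=> dF dG; have E i j : (fun y => (F y + G y) i j) = (fun y => F y i j + G y i j).
  by apply/funext => y; rewrite mxE.
split=> [i j|v]; first by rewrite E; have [] := cdiffD (dF i j) (dG i j).
by apply/matrixP => i j; rewrite mderiveE E (cdiffD _ _).2// mxE !mderiveE.
Qed.

Lemma mdiffM F G x : mdiff F x -> mdiff G x -> mdiff (fun y => F y *m G y) x /\
  forall v, mderive (fun y => F y *m G y) x v = mderive F x v *m G x + F x *m mderive G x v.
Proof.
move=> dF dG; have E i j : (fun y => (F y *m G y) i j) =
    (fun y => \sum_k (fun k y => F y i k * G y k j) k y).
  by apply/funext => y; rewrite mxE.
have H i j k : cdiff (fun y => F y i k * G y k j) x by have [] := cdiffM (dF i k) (dG k j).
split=> [i j|v]; first by rewrite E; exact: (cdiff_sum _ (H i j)).1.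
apply/matrixP => i j; rewrite mderiveE E (cdiff_sum _ (H i j)).2 !mxE -big_split/=.
by apply: eq_bigr => k _; rewrite (cdiffM (dF i k) (dG k j)).2 !mderiveE.
Qed.

Lemma mdiff_cst (A : mat) x : mdiff (fun=> A) x /\ forall v, mderive (fun=> A) x v = 0.
Proof.
split=> [i j|v]; first exact: (cdiff_cst (A i j) x).1.
by apply/matrixP => i j; rewrite mderiveE (cdiff_cst (A i j) x).2 mxE.
Qed.

Lemma mdiff_adj F x : mdiff F x -> mdiff (fun y => (F y)^t*) x /\
  forall v, mderive (fun y => (F y)^t*) x v = (mderive F x v)^t*.
Proof.
move=> dF; have E i j : (fun y => ((F y)^t*) i j) = (fun y => Num.conj (F y j i)).
  by apply/funext => y; rewrite !mxE.
split=> [i j|v]; first by rewrite E; exact: (cdiff_conj (dF j i)).1.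
by apply/matrixP => i j; rewrite mderiveE E (cdiff_conj (dF j i)).2 adjE mderiveE.
Qed.

Lemma mdiff_conj F x : mdiff F x -> mdiff (fun y => map_mx Num.conj (F y)) x /\
  forall v, mderive (fun y => map_mx Num.conj (F y)) x v = map_mx Num.conj (mderive F x v).
Proof.
move=> dF; have E i j : (fun y => (map_mx Num.conj (F y)) i j) = (fun y => Num.conj (F y i j)).
  by apply/funext => y; rewrite !mxE.
split=> [i j|v]; first by rewrite E; exact: (cdiff_conj (dF i j)).1.
by apply/matrixP => i j; rewrite mderiveE E (cdiff_conj (dF i j)).2 mxE mderiveE.
Qed.

Lemma mdiffZ (s : V -> C) F x : cdiff s x -> mdiff F x -> mdiff (fun y => s y *: F y) x /\
  forall v, mderive (fun y => s y *: F y) x v = cderive s x v *: F x + s x *: mderive F x v.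
Proof.
move=> ds dF; have E i j : (fun y => (s y *: F y) i j) = (fun y => s y * F y i j).
  by apply/funext => y; rewrite !mxE.
split=> [i j|v]; first by rewrite E; exact: (cdiffM ds (dF i j)).1.
by apply/matrixP => i j; rewrite mderiveE E (cdiffM ds (dF i j)).2 !mxE.
Qed.

Lemma mdiffZc (c : C) F x : mdiff F x -> mdiff (fun y => c *: F y) x /\
  forall v, mderive (fun y => c *: F y) x v = c *: mderive F x v.
Proof.
move=> dF; have [dc Dc] := cdiff_cst c x; have [H1 H2] := mdiffZ dc dF.
by split=> // v; rewrite H2 Dc scale0r add0r.
Qed.

Lemma mdiffN F x : mdiff F x -> mdiff (fun y => - F y) x /\
  forall v, mderive (fun y => - F y) x v = - mderive F x v.
Proof.
move=> /(mdiffZc (-1)); have -> : (fun y => -1 *: F y) = (fun y => - F y).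
  by apply/funext => y; rewrite scaleN1r.
by move=> [H1 H2]; split=> // v; rewrite H2 scaleN1r.
Qed.

Lemma mdiffB F G x : mdiff F x -> mdiff G x -> mdiff (fun y => F y - G y) x /\
  forall v, mderive (fun y => F y - G y) x v = mderive F x v - mderive G x v.
Proof.
move=> dF /mdiffN[dG DG]; have [H1 H2] := mdiffD dF dG.
by split=> // v; rewrite H2 DG.
Qed.

Lemma mderive_lin F x : mdiff F x -> forall a v w,
  mderive F x (a *: v + w) = a%:C *: mderive F x v + mderive F x w.
Proof.
move=> dF a v w; apply/matrixP => i j; rewrite !mxE.
have [d1 d2] := dF i j; rewrite (derive_linear _ _ _ d1) (derive_linear _ _ _ d2).
move: ('D_v _ x) ('D_w _ x) ('D_v _ x) ('D_w _ x) => a1 a2 a3 a4.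
by apply: complex_eq; rewrite ?cReD ?cImD ?cReM ?cImM /=; ring.
Qed.

Lemma mderiveD F x v w : mdiff F x -> mderive F x (v + w) = mderive F x v + mderive F x w.
Proof. by move=> dF; rewrite -[v in LHS]scale1r mderive_lin// scale1r. Qed.

Lemma mderive0 F x : mderive F x 0 = 0.
Proof. by apply/matrixP => i j; rewrite !mxE !derive0. Qed.

Lemma mderive_scale F x a v : mdiff F x -> mderive F x (a *: v) = a%:C *: mderive F x v.
Proof. by move=> dF; rewrite -[a *: v]addr0 mderive_lin// mderive0 addr0. Qed.

Lemma near_mdiff F G x : (\near x, F x = G x) -> mdiff F x -> mdiff G x /\
  forall v, mderive F x v = mderive G x v.
Proof.
move=> FG dF.
have H1 i j : \near x, Re (F x i j) = Re (G x i j).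
  by apply: filterS FG => y ->.
have H2 i j : \near x, Im (F x i j) = Im (G x i j).
  by apply: filterS FG => y ->.
split=> [i j|v].
  have [d1 d2] := dF i j; split; first exact: near_eq_differentiable d1.
  exact: near_eq_differentiable d2.
apply/matrixP => i j; rewrite !mxE (near_eq_derive _ (H1 i j)).
by rewrite (near_eq_derive _ (H2 i j)).
Qed.

End Matrix.

Lemma metric_diff m (F G : V -> 'M[R[i]]_m.+1) x : mdiff F x -> mdiff G x ->
  differentiable (fun y => CP_metric (F y) (G y)) x /\
  forall v, 'D_v (fun y => CP_metric (F y) (G y)) x =
    CP_metric (mderive F x v) (G x) + CP_metric (F x) (mderive G x v).
Proof.
move=> dF dG; have [dM DM] := mdiffM dF dG.
have [dt Dt] := cdiff_sum (index_enum 'I_m.+1) (fun i => dM i i).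
have E : (fun y => CP_metric (F y) (G y)) =
    (fun y => 2^-1 *: Re (\sum_i (F y *m G y) i i) : R).
  by apply/funext => y; rewrite /CP_metric mulrC.
split; first by rewrite E; apply: differentiableZ; case: dt.
move=> v; rewrite E (deriveZ 2^-1 (dderiv dt.1)).
have -> : 'D_v (fun y => Re (\sum_i (F y *m G y) i i)) x =
   Re (cderive (fun y => \sum_i (F y *m G y) i i) x v) by [].
rewrite Dt /CP_metric -mulrDl -cReD -mxtraceD -DM mulrC; congr (_ * _).
by congr Re; apply: eq_bigr => i _; rewrite mderiveE.
Qed.

End ComplexCalculus.

Lemma mdiff_comp (R : realType) (V W : normedModType R) p (F : W -> 'M[R[i]]_p)
    (e : V -> W) x : differentiable e x -> mdiff F (e x) -> mdiff (F \o e) x /\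
  forall v, mderive (F \o e) x v = mderive F (e x) ('D_v e x).
Proof.
move=> de dF; split=> [i j|v].
  have [d1 d2] := dF i j; split.
    exact: (@differentiable_comp _ _ _ _ e (fun y => complex.Re (F y i j) : R)).
  exact: (@differentiable_comp _ _ _ _ e (fun y => complex.Im (F y i j) : R)).
apply/matrixP => i j; rewrite !mxE; have [d1 d2] := dF i j.
by rewrite -(derivative_comp v de d1) -(derivative_comp v de d2).
Qed.

Section SmoothFunctions.
Variables (R : realType) (V : normedModType R) (U : set V).
Hypothesis oU : open U.
Implicit Types f g : V -> R.

Lemma smooth_diff (W : normedModType R) (f : V -> W) x :
  smooth_on U f -> U x -> differentiable f x.
Proof. by move=> sf Ux; exact: (sf [::]). Qed.

Lemma smooth_eq (W : normedModType R) (f g : V -> W) :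
  (forall x, U x -> f x = g x) -> smooth_on U f -> smooth_on U g.
Proof.
move=> fg sf; apply/smooth_onP => k.
by apply: (ksmooth_eq oU fg); move/smooth_onP: sf; exact.
Qed.

Lemma smooth_derive (W : normedModType R) (f : V -> W) v :
  smooth_on U f -> smooth_on U ('D_v f).
Proof. by move=> sf vs; exact: (sf (v :: vs)). Qed.

Lemma smooth_cst (W : normedModType R) (c : W) : smooth_on U (fun=> c).
Proof. by apply/smooth_onP => k; exact: ksmooth_cst. Qed.

Lemma smoothD f g : smooth_on U f -> smooth_on U g -> smooth_on U (fun x => f x + g x).
Proof. by move=> /smooth_onP sf /smooth_onP sg; apply/smooth_onP => k; exact: (ksmoothD oU (sf k) (sg k)). Qed.

Lemma smoothM f g : smooth_on U f -> smooth_on U g -> smooth_on U (fun x => f x * g x).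
Proof. by move=> /smooth_onP sf /smooth_onP sg; apply/smooth_onP => k; exact: (ksmoothM oU (sf k) (sg k)). Qed.

Lemma smoothN f : smooth_on U f -> smooth_on U (fun x => - f x).
Proof. by move=> /smooth_onP sf; apply/smooth_onP => k; exact: (ksmoothN oU (sf k)). Qed.

Lemma smoothB f g : smooth_on U f -> smooth_on U g -> smooth_on U (fun x => f x - g x).
Proof. by move=> sf sg; apply: (smoothD sf); exact: smoothN. Qed.

Lemma smooth_sum (I : Type) (r : seq I) (p : pred I) (f : I -> V -> R) :
  (forall i, smooth_on U (f i)) -> smooth_on U (fun x => \sum_(i <- r | p i) f i x).
Proof.
move=> sf; apply/smooth_onP => k; apply: (ksmooth_sum _ _ oU) => i.
by move/smooth_onP: (sf i); exact.
Qed.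

Lemma smooth_prod (I : Type) (r : seq I) (p : pred I) (f : I -> V -> R) :
  (forall i, smooth_on U (f i)) -> smooth_on U (fun x => \prod_(i <- r | p i) f i x).
Proof.
move=> sf; apply/smooth_onP => k; apply: (ksmooth_prod _ _ oU) => i.
by move/smooth_onP: (sf i); exact.
Qed.

Lemma smoothV f : (forall x, U x -> f x != 0) -> smooth_on U f ->
  smooth_on U (fun x => (f x)^-1).
Proof. by move=> f0 /smooth_onP sf; apply/smooth_onP => k; exact: (ksmoothV oU f0 (sf k)). Qed.

Lemma smooth_sqrt f : (forall x, U x -> 0 < f x) -> smooth_on U f ->
  smooth_on U (fun x => Num.sqrt (f x)).
Proof. by move=> f0 /smooth_onP sf; apply/smooth_onP => k; exact: (ksmooth_sqrt oU f0 (sf k)). Qed.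

Lemma smooth_det n (G : V -> 'M[R]_n) : (forall i j, smooth_on U (fun x => G x i j)) ->
  smooth_on U (fun x => \det (G x)).
Proof.
move=> sG; apply: smooth_sum => s; apply: smoothM; first exact: smooth_cst.
by apply: smooth_prod => i; exact: sG.
Qed.

Lemma smooth_adj n (G : V -> 'M[R]_n) : (forall i j, smooth_on U (fun x => G x i j)) ->
  forall i j, smooth_on U (fun x => (\adj (G x)) i j).
Proof.
move=> sG i j.
apply: (@smooth_eq _ (fun x => (-1) ^+ (j + i) * \det (row' j (col' i (G x))))).
  by move=> x _; rewrite mxE.
apply: smoothM; first exact: smooth_cst.
apply: smooth_det => k l; apply: smooth_eq (sG (lift j k) (lift i l)) => x _.
by rewrite !mxE.
Qed.

Variable p : nat.
Local Notation mat := 'M[R[i]]_p.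
Implicit Types F G : V -> mat.
Local Notation Re := (@complex.Re R).
Local Notation Im := (@complex.Im R).

Lemma msmooth_mdiff F x : msmooth_on U F -> U x -> mdiff F x.
Proof. by move=> sF Ux i j; have [s1 s2] := sF i j; split; exact: smooth_diff Ux. Qed.

Lemma msmooth_eq F G : (forall x, U x -> F x = G x) -> msmooth_on U F -> msmooth_on U G.
Proof.
move=> FG sF i j; have [s1 s2] := sF i j.
by split; [apply: smooth_eq s1|apply: smooth_eq s2] => x Ux; rewrite FG.
Qed.

Lemma msmooth_cst (A : mat) : msmooth_on U (fun=> A).
Proof. by move=> i j; split; exact: smooth_cst. Qed.

Lemma msmoothD F G : msmooth_on U F -> msmooth_on U G -> msmooth_on U (fun x => F x + G x).
Proof.
move=> sF sG i j; have [f1 f2] := sF i j; have [g1 g2] := sG i j.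
split; [apply: smooth_eq (smoothD f1 g1)|apply: smooth_eq (smoothD f2 g2)] => x _;
  by rewrite mxE ?cReD ?cImD.
Qed.

Lemma msmoothM F G : msmooth_on U F -> msmooth_on U G -> msmooth_on U (fun x => F x *m G x).
Proof.
move=> sF sG i j; split.
  apply: (@smooth_eq _ (fun x => \sum_k (Re (F x i k) * Re (G x k j) - Im (F x i k) * Im (G x k j)))).
    by move=> x _; rewrite mxE cRe_sum; apply: eq_bigr => k _; rewrite cReM.
  apply: smooth_sum => k; have [f1 f2] := sF i k; have [g1 g2] := sG k j.
  by apply: smoothB; exact: smoothM.
apply: (@smooth_eq _ (fun x => \sum_k (Re (F x i k) * Im (G x k j) + Im (F x i k) * Re (G x k j)))).
  by move=> x _; rewrite mxE cIm_sum; apply: eq_bigr => k _; rewrite cImM.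
apply: smooth_sum => k; have [f1 f2] := sF i k; have [g1 g2] := sG k j.
by apply: smoothD; exact: smoothM.
Qed.

Lemma msmoothZ (s : V -> R) F : smooth_on U s -> msmooth_on U F ->
  msmooth_on U (fun x => (s x)%:C *: F x).
Proof.
move=> ss sF i j; have [f1 f2] := sF i j.
split; [apply: smooth_eq (smoothM ss f1)|apply: smooth_eq (smoothM ss f2)] => x _;
  by rewrite mxE ?cReM ?cImM /=; ring.
Qed.

Lemma msmoothZc (c : R[i]) F : msmooth_on U F -> msmooth_on U (fun x => c *: F x).
Proof.
move=> sF; apply: msmooth_eq (msmoothM (msmooth_cst c%:M) sF) => x _.
by rewrite mul_scalar_mx.
Qed.

Lemma msmoothN F : msmooth_on U F -> msmooth_on U (fun x => - F x).
Proof.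
move=> sF; apply: msmooth_eq (msmoothZc (-1) sF) => x _.
by rewrite scaleN1r.
Qed.

Lemma msmoothB F G : msmooth_on U F -> msmooth_on U G -> msmooth_on U (fun x => F x - G x).
Proof. by move=> sF sG; apply: msmoothD => //; exact: msmoothN. Qed.

Lemma msmooth_sum (I : Type) (r : seq I) (F : I -> V -> mat) :
  (forall i, msmooth_on U (F i)) -> msmooth_on U (fun x => \sum_(i <- r) F i x).
Proof.
move=> sF; elim: r => [|i r IH].
  by apply: msmooth_eq (msmooth_cst 0) => x _; rewrite big_nil.
by apply: msmooth_eq (msmoothD (sF i) IH) => x _; rewrite big_cons.
Qed.

Lemma msmooth_mderive F v : msmooth_on U F -> msmooth_on U (fun x => mderive F x v).
Proof.
move=> sF i j; have [f1 f2] := sF i j.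
split; [apply: smooth_eq (smooth_derive v f1)|apply: smooth_eq (smooth_derive v f2)] => x _;
  by rewrite mxE.
Qed.

Lemma mderive_swap F x v w : msmooth_on U F -> U x ->
  mderive (fun y => mderive F y v) x w = mderive (fun y => mderive F y w) x v.
Proof.
move=> sF Ux.
have sw (f : V -> R) : smooth_on U f -> 'D_w ('D_v f) x = 'D_v ('D_w f) x.
  move=> sf; apply: derivative_swap.
  - by apply: filterS (open_nbhs_nbhs (conj oU Ux)) => y; exact: smooth_diff.
  - exact: smooth_diff (smooth_derive _ sf) Ux.
  - exact: smooth_diff (smooth_derive _ sf) Ux.
have E u u' i j : mderive (fun y => mderive F y u) x u' i j =
    'D_u' ('D_u (fun y => Re (F y i j) : R)) x +i*
    'D_u' ('D_u (fun y => Im (F y i j) : R)) x.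
  rewrite mderiveE /cderive; congr (_ +i* _); congr ('D_u' _ x);
    by apply/funext => y; rewrite mderiveE; reflexivity.
apply/matrixP => i j; have [f1 f2] := sF i j.
apply: (etrans (E v w i j)); apply: etrans (esym (E w v i j)).
have S1 := sw _ f1; have S2 := sw _ f2.
rewrite S1 S2; reflexivity.
Qed.

End SmoothFunctions.

Lemma smooth_metric (R : realType) (V : normedModType R) (U : set V) m
    (F G : V -> 'M[R[i]]_m.+1) : open U ->
  msmooth_on U F -> msmooth_on U G -> smooth_on U (fun x => CP_metric (F x) (G x)).
Proof.
move=> oU sF sG; have sM := msmoothM oU sF sG.
apply: (@smooth_eq _ _ _ oU _ (fun x => (\sum_i complex.Re ((F x *m G x) i i)) * 2^-1)).
  by move=> x _; rewrite /CP_metric /mxtrace cRe_sum.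
apply: smoothM => //; last exact: smooth_cst.
by apply: smooth_sum => // i; have [] := sM i i.
Qed.

Lemma smooth_comp (R : realType) (V : normedModType R) n (U : set V) (U' : set 'rV[R]_n)
    (e : V -> 'rV[R]_n) (g : 'rV[R]_n -> R) : open U -> open U' ->
  (forall x, U x -> U' (e x)) -> smooth_on U e -> smooth_on U' g -> smooth_on U (g \o e).
Proof.
move=> oU oU' eU /smooth_onP se /smooth_onP sg; apply/smooth_onP => k.
exact: ksmooth_comp oU oU' eU (se k) (sg k).
Qed.

Lemma smooth_comp_rV (R : realType) (V : normedModType R) n q (U : set V) (U' : set 'rV[R]_n)
    (e : V -> 'rV[R]_n) (g : 'rV[R]_n -> 'rV[R]_q) : open U -> open U' ->
  (forall x, U x -> U' (e x)) -> smooth_on U e -> smooth_on U' g -> smooth_on U (g \o e).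
Proof.
move=> oU oU' eU /smooth_onP se /smooth_onP sg; apply/smooth_onP => k.
exact: ksmooth_comp_rV oU oU' eU (se k) (sg k).
Qed.

Lemma smooth_sub (R : realType) (V W : normedModType R) (U U' : set V) (f : V -> W) :
  U `<=` U' -> smooth_on U' f -> smooth_on U f.
Proof. by move=> UU' sf vs x /UU'; exact: sf. Qed.

Lemma msmooth_sub (R : realType) (V : normedModType R) (U U' : set V) p (F : V -> 'M[R[i]]_p) :
  U `<=` U' -> msmooth_on U' F -> msmooth_on U F.
Proof. by move=> UU' sF i j; have [s1 s2] := sF i j; split; exact: smooth_sub UU' _. Qed.

Lemma msmooth_comp (R : realType) (V : normedModType R) n (U : set V) (U' : set 'rV[R]_n) p
    (e : V -> 'rV[R]_n) (F : 'rV[R]_n -> 'M[R[i]]_p) : open U -> open U' ->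
  (forall x, U x -> U' (e x)) -> smooth_on U e -> msmooth_on U' F -> msmooth_on U (F \o e).
Proof.
move=> oU oU' eU se sF i j; have [s1 s2] := sF i j.
by split; [exact: (smooth_comp oU oU' eU se s1)|exact: (smooth_comp oU oU' eU se s2)].
Qed.

(** * Isometries of CP^m *)

Section Isometry.
Variables (R : realType) (m : nat).
Local Notation mat := 'M[R[i]]_m.+1.
Implicit Types (P X Y : mat) (Psi : mat -> mat).

Local Notation cj := (map_mx (@Num.conj R[i])).

Lemma cjM p q r (A : 'M[R[i]]_(p, q)) (B : 'M[R[i]]_(q, r)) : cj (A *m B) = cj A *m cj B.
Proof. exact: map_mxM. Qed.

Lemma cjK p q (A : 'M[R[i]]_(p, q)) : cj (cj A) = A.
Proof. by apply/matrixP => i j; rewrite !mxE conjCK. Qed.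

Lemma cj_adj p q (A : 'M[R[i]]_(p, q)) : cj (A^t*) = (cj A)^t*.
Proof. by apply/matrixP => i j; rewrite !mxE. Qed.

Lemma cjD p q (A B : 'M[R[i]]_(p, q)) : cj (A + B) = cj A + cj B.
Proof. by apply/matrixP => i j; rewrite !mxE rmorphD. Qed.

Lemma cjN p q (A : 'M[R[i]]_(p, q)) : cj (- A) = - cj A.
Proof. by apply/matrixP => i j; rewrite !mxE rmorphN. Qed.

Lemma cjB p q (A B : 'M[R[i]]_(p, q)) : cj (A - B) = cj A - cj B.
Proof. by rewrite cjD cjN. Qed.

Lemma cjZ p q c (A : 'M[R[i]]_(p, q)) : cj (c *: A) = Num.conj c *: cj A.
Proof. by apply/matrixP => i j; rewrite !mxE rmorphM. Qed.

Lemma sandwich (A B X : mat) : B *m A = 1%:M -> B *m (A *m X *m B) *m A = X.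
Proof.
move=> BA; have -> : B *m (A *m X *m B) *m A = (B *m A) *m X *m (B *m A).
  by rewrite !mulmxA.
by rewrite BA mul1mx mulmx1.
Qed.

Section Conjugation.
Variable U : mat.
Hypotheses (UU : U *m U^t* = 1%:M) (UU' : U^t* *m U = 1%:M).

Let Ad X := U *m X *m U^t*.

Lemma AdM X Y : Ad X *m Ad Y = Ad (X *m Y).
Proof.
rewrite /Ad; have -> : U *m X *m U^t* *m (U *m Y *m U^t*) =
  U *m X *m ((U^t* *m U) *m (Y *m U^t*)) by rewrite !mulmxA.
by rewrite UU' mul1mx !mulmxA.
Qed.

Lemma AdD X Y : Ad (X + Y) = Ad X + Ad Y.
Proof. by rewrite /Ad mulmxDr mulmxDl. Qed.

Lemma AdB X Y : Ad X - Ad Y = Ad (X - Y).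
Proof. by rewrite /Ad mulmxBr mulmxBl. Qed.

Lemma AdZ c X : Ad (c *: X) = c *: Ad X.
Proof. by rewrite /Ad -scalemxAr -scalemxAl. Qed.

Lemma Ad_adj X : (Ad X)^t* = Ad (X^t*).
Proof. by rewrite /Ad !adjM adjK mulmxA. Qed.

Lemma Ad_tr X : \tr (Ad X) = \tr X.
Proof. by rewrite /Ad mxtrace_mulC mulmxA UU' mul1mx. Qed.

End Conjugation.

Lemma unitarymxK (U : mat) : U \is unitarymx -> U *m U^t* = 1%:M /\ U^t* *m U = 1%:M.
Proof. by move=> /unitarymxP UU; split=> //; apply: mulmx1C. Qed.

Lemma isometry_inv Psi : CP_isometry Psi -> exists Phi : mat -> mat,
  [/\ CP_isometry Phi, cancel Psi Phi & cancel Phi Psi].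
Proof.
move=> [U [/unitarymxK[UU UU'] H]].
have VV : U^t* *m (U^t* )^t* = 1%:M by rewrite adjK.
have K1 X : U^t* *m (U *m X *m U^t* ) *m U = X by exact: sandwich.
have K2 X : U *m (U^t* *m X *m U) *m U^t* = X by exact: sandwich.
case: H => H.
  exists (fun X => U^t* *m X *m (U^t* )^t* ); split.
  - by exists (U^t* ); split; [apply/unitarymxP|left].
  - by move=> X; rewrite H adjK K1.
  - by move=> X; rewrite H adjK K2.
(* The inverse of [X |-> U conj(X) U^H] is [X |-> conj(U^H X U)], which has the same form with
   [V = conj(U^H)]. *)
pose V := cj (U^t* ).
have VH : V^t* = cj U by rewrite /V -cj_adj adjK.
have VV1 : V *m V^t* = 1%:M by rewrite VH /V -cjM UU' map_mx1.
exists (fun X => V *m cj X *m V^t* ); split.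
- by exists V; split; [apply/unitarymxP|right].
- by move=> X; rewrite H VH /V -!cjM K1 cjK.
- by move=> X; rewrite H VH /V -!cjM cjK K2.
Qed.

Section IsometryFacts.
Variable Psi : mat -> mat.
Hypothesis iso : CP_isometry Psi.

Lemma isometryD X Y : Psi (X + Y) = Psi X + Psi Y.
Proof.
case: iso => U [_ []] H; rewrite !H; first exact: AdD.
by rewrite cjD AdD.
Qed.

Lemma isometryM X Y : Psi (X *m Y) = Psi X *m Psi Y.
Proof.
case: iso => U [/unitarymxK[UU UU'] []] H; rewrite !H; first by rewrite AdM.
by rewrite cjM AdM.
Qed.

Lemma isometry_adj X : (Psi X)^t* = Psi (X^t* ).
Proof.
case: iso => U [_ []] H; rewrite !H; first exact: Ad_adj.
by rewrite Ad_adj cj_adj.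
Qed.

Lemma isometry_tangent P X : CP_tangent P X -> CP_tangent (Psi P) (Psi X).
Proof.
move=> [X1 X2]; split; first by rewrite isometry_adj X1.
by rewrite -!isometryM -isometryD X2.
Qed.

Lemma isometry_metric X Y : CP_metric (Psi X) (Psi Y) = CP_metric X Y.
Proof.
rewrite /CP_metric -isometryM; congr (_ / _); move: (X *m Y) => Z.
case: iso => U [/unitarymxK[UU UU'] []] H; rewrite H Ad_tr//.
have -> : \tr (cj Z) = Num.conj (\tr Z).
  by rewrite /mxtrace rmorph_sum; apply: eq_bigr => i _; rewrite mxE.
exact: cRe_conj.
Qed.

(** The second case is the antiunitary one, as conjugation sends [i] to [- i]. A sign on J leaves
    the distribution D unchanged. *)
Lemma isometry_J : (forall P X, CP_J (Psi P) (Psi X) = Psi (CP_J P X)) \/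
  (forall P X, CP_J (Psi P) (Psi X) = - Psi (CP_J P X)).
Proof.
have conj_i : Num.conj (0 +i* 1 : R[i]) = - (0 +i* 1).
  by apply: complex_eq; rewrite /= ?oppr0.
case: iso => U [/unitarymxK[UU UU'] []] H; [left|right] => P X; rewrite !H /CP_J.
  by rewrite (AdM UU' X P) (AdM UU' P X) AdB AdZ.
rewrite (AdM UU' (cj X) (cj P)) (AdM UU' (cj P) (cj X)) AdB cjZ AdZ conj_i scaleNr opprK.
by rewrite cjB !cjM.
Qed.

Lemma isometry_mderive (V : normedModType R) (F : V -> mat) x : mdiff F x ->
  mdiff (Psi \o F) x /\ forall v, mderive (Psi \o F) x v = Psi (mderive F x v).
Proof.
move=> dF; case: iso => U [_ H].
have [dU DU] := mdiff_cst U x; have [dV DV] := mdiff_cst (U^t* ) x.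
have gen G : mdiff G x -> mdiff (fun y => U *m G y *m U^t* ) x /\
    forall v, mderive (fun y => U *m G y *m U^t* ) x v = U *m mderive G x v *m U^t*.
  move=> dG; have [d1 D1] := mdiffM dU dG; have [d2 D2] := mdiffM d1 dV.
  by split=> // v; rewrite D2 D1 DU DV mulmx0 addr0 mul0mx add0r.
case: H => H.
  have -> : Psi \o F = (fun y => U *m F y *m U^t* ) by apply/funext => y /=; rewrite H.
  by have [d D] := gen _ dF; split=> // v; rewrite D H.
have -> : Psi \o F = (fun y => U *m cj (F y) *m U^t* ) by apply/funext => y /=; rewrite H.
have [dc Dc] := mdiff_conj dF.
by have [d D] := gen _ dc; split=> // v; rewrite D Dc H.
Qed.

Lemma isometry_hyperplane (w : 'cV[R[i]]_m.+1) : w != 0 ->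
  exists2 w' : 'cV[R[i]]_m.+1, w' != 0 & forall P, P *m w = 0 -> Psi P *m w' = 0.
Proof.
case: iso => U [/unitarymxK[UU UU'] H] w0.
have U0 (v : 'cV[R[i]]_m.+1) : U *m v = 0 -> v = 0.
  by move=> /(congr1 (mulmx (U^t* ))); rewrite mulmx0 mulmxA UU' mul1mx.
case: H => H.
  exists (U *m w); first by apply/eqP => /U0 /eqP; rewrite (negbTE w0).
  move=> P Pw; rewrite H; have -> : U *m P *m U^t* *m (U *m w) = U *m (P *m ((U^t* *m U) *m w)).
    by rewrite !mulmxA.
  by rewrite UU' mul1mx Pw mulmx0.
exists (U *m cj w).
  apply/eqP => /U0 /(congr1 (@map_mx _ _ (@Num.conj R[i]) _ _)).
  by rewrite cjK raddf0 => /eqP; rewrite (negbTE w0).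
move=> P Pw; rewrite H.
have -> : U *m cj P *m U^t* *m (U *m cj w) = U *m (cj P *m ((U^t* *m U) *m cj w)).
  by rewrite !mulmxA.
by rewrite UU' mul1mx -cjM Pw raddf0 mulmx0.
Qed.

End IsometryFacts.
End Isometry.

(** * Hypersurfaces in a chart *)

Section TangentFacts.
Variables (R : realType) (m : nat) (P N : 'M[R[i]]_m.+1).
Hypotheses (CPP : CP P) (TN : CP_tangent P N) (N1 : CP_metric N N = 1).

Lemma metricJNN : CP_metric (CP_J P N) (CP_J P N) = 1.
Proof. exact: etrans (metricJJ CPP TN TN) N1. Qed.

Lemma holo_decomp X : CP_tangent P X -> CP_metric X N = 0 ->
  holo P N (X - (CP_metric X (CP_J P N))%:C *: CP_J P N).
Proof.
move=> TX XN; have TJ := J_tangent CPP TN; split.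
- by apply: tangentB => //; exact: tangentZ.
- by rewrite metricBl XN metricZl (metricJ0 CPP TN) mulr0 subr0.
- by rewrite metricBl metricZl metricJNN mulr1 subrr.
Qed.

Lemma orth_holo V : CP_tangent P V -> CP_metric V N = 0 ->
  (forall Y, holo P N Y -> CP_metric V Y = 0) ->
  V = (CP_metric V (CP_J P N))%:C *: CP_J P N.
Proof.
move=> TV VN HV; have DX := holo_decomp TV VN; set X := V - _ in DX.
have [TX _ XJ] := DX.
apply/eqP; rewrite -subr_eq0; apply/eqP; rewrite -/X.
apply: (metric_eq0 (tangent_adj TX)).
have E : CP_metric X X = CP_metric V X - CP_metric V (CP_J P N) * CP_metric (CP_J P N) X.
  by rewrite {1}/X metricBl metricZl.
by rewrite E (HV X DX) (metricC _ X) XJ mulr0 subr0.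
Qed.

End TangentFacts.

Lemma adj_sum (A : comPzRingType) n (G : 'M[A]_n) (c : 'I_n -> A) k :
  \sum_j (\sum_i c i * (\adj G) i j) * G j k = \det G * c k.
Proof.
transitivity (\sum_i c i * (\adj G *m G) i k).
  under eq_bigr do rewrite mulr_suml; rewrite exchange_big/=; apply: eq_bigr => i _.
  by rewrite mxE mulr_sumr; apply: eq_bigr => j _; rewrite mulrA.
rewrite mul_adj_mx (bigD1 k)//= big1 => [|i ik]; rewrite mxE.
  by rewrite eqxx mulr1n addr0 mulrC.
by rewrite (negbTE ik) mulr0.
Qed.

Section LocalHypersurface.
Variables (R : realType) (m n : nat).
Local Notation mat := 'M[R[i]]_m.+1.
Variables (Om : set 'rV[R]_n) (F : 'rV[R]_n -> mat).
Hypotheses (oOm : open Om) (sF : msmooth_on Om F) (CPF : forall u, Om u -> CP (F u)).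

Let nearOm u : Om u -> \near u, Om u.
Proof. by move=> Ou; exact: (open_nbhs_nbhs (conj oOm Ou)). Qed.

Let dF u : Om u -> mdiff F u.
Proof. exact: msmooth_mdiff. Qed.

Lemma tangent_mderive u v : Om u -> CP_tangent (F u) (mderive F u v).
Proof.
move=> Ou; have dFu := dF Ou; split.
  have [da Da] := mdiff_adj dFu; rewrite -Da.
  apply: (near_mdiff _ da).2; apply: filterS (nearOm Ou) => y Oy.
  by have [] := CPF Oy.
have [dM DM] := mdiffM dFu dFu; rewrite -DM.
apply: (near_mdiff _ dM).2; apply: filterS (nearOm Ou) => y Oy.
by have [] := CPF Oy.
Qed.

Lemma rcomb_mderive u v : Om u ->
  rcomb (fun i => mderive F u (delta_mx 0 i)) v = mderive F u v.
Proof.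
move=> Ou; have dFu := dF Ou; rewrite [in RHS](row_sum_delta v) /rcomb.
rewrite (big_morph (mderive F u) (fun a b => mderiveD a b dFu) (mderive0 F u)).
by apply: eq_bigr => i _; rewrite (mderive_scale _ _ dFu).
Qed.

Hypothesis immF : forall u, Om u -> forall v, mderive F u v = 0 -> v = 0.
Hypothesis nm : n.+1 = (m + m)%N.

(* Gram-Schmidt without inverse: this field is orthogonal to the frame by Cramer's rule. *)
Lemma local_normal u0 : Om u0 -> exists (Om' : set 'rV[R]_n) (N : 'rV[R]_n -> mat),
  [/\ open Om', Om' `<=` Om, Om' u0, msmooth_on Om' N &
  forall u, Om' u -> [/\ CP_tangent (F u) (N u), CP_metric (N u) (N u) = 1 &
    forall v, CP_metric (mderive F u v) (N u) = 0]].
Proof.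
move=> O0; pose e i u := mderive F u (delta_mx 0 i).
have Te i u : Om u -> CP_tangent (F u) (e i u) by exact: tangent_mderive.
have nm' : (n < m + m)%N by rewrite -nm.
have [n0 [Tn0 n01 en0]] := exists_unit_normal (CPF O0) nm' (fun i => Te i u0 O0).
(* The normal [n0] at [u0], kept constant and projected onto the tangent space of CP^m at the other
   points. *)
pose N0 u := F u *m n0 *m (1%:M - F u) + (1%:M - F u) *m n0 *m F u.
pose Gr u : 'M[R]_n := \matrix_(i, j) CP_metric (e i u) (e j u).
pose coef u i j := CP_metric (N0 u) (e i u) * (\adj (Gr u)) i j.
pose N1 u := (\det (Gr u))%:C *: N0 u - \sum_j (\sum_i coef u i j)%:C *: e j u.
have sN0 : msmooth_on Om N0.
  have s1F : msmooth_on Om (fun u => 1%:M - F u).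
    exact: (msmoothB oOm (msmooth_cst _ _) sF).
  have sn0 : msmooth_on Om (fun u => n0) by exact: msmooth_cst.
  exact: (msmoothD oOm (msmoothM oOm (msmoothM oOm sF sn0) s1F)
    (msmoothM oOm (msmoothM oOm s1F sn0) sF)).
have se i : msmooth_on Om (e i) by exact: msmooth_mderive.
have sGr i j : smooth_on Om (fun u => Gr u i j).
  apply: (@smooth_eq _ _ _ oOm _ (fun u => CP_metric (e i u) (e j u))).
    by move=> u _; rewrite mxE.
  exact: smooth_metric.
have scoef i j : smooth_on Om (fun u => coef u i j).
  apply: (smoothM oOm); first exact: (smooth_metric oOm sN0 (se i)).
  exact: (smooth_adj oOm sGr).
have sN1 : msmooth_on Om N1.
  apply: (msmoothB oOm); first exact: (msmoothZ oOm (smooth_det oOm sGr) sN0).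
  apply: (msmooth_sum oOm) => j; apply: (msmoothZ oOm) (se j).
  by apply: smooth_sum => // i; exact: scoef.
have TN0 u : Om u -> CP_tangent (F u) (N0 u).
  by move=> Ou; apply: (proj_tangent (CPF Ou)); exact: tangent_adj Tn0.
have TN1 u : Om u -> CP_tangent (F u) (N1 u).
  move=> Ou; apply: tangentB; first by apply: tangentZ; exact: TN0.
  elim/big_rec: _ => [|j x _ Tx]; first exact: tangent0.
  by apply: tangentD => //; apply: tangentZ; exact: Te.
have eN1 u k : Om u -> CP_metric (N1 u) (e k u) = 0.
  move=> Ou; rewrite /N1 metricBl metricZl.
  rewrite (big_morph (fun X => CP_metric X (e k u)) (fun X Y => metricDl X Y _) (metric0l _)).
  apply/eqP; rewrite subr_eq0; apply/eqP.
  rewrite -(adj_sum (Gr u) (fun i => CP_metric (N0 u) (e i u)) k).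
  by apply: eq_bigr => j _; rewrite metricZl [Gr u j k]mxE.
(* At [u0] the correction vanishes, [n0] being already normal. The Gram determinant is nonzero there
   by immersion, so the field is nonzero at [u0] and then nearby. *)
have N1u0 : N1 u0 = (\det (Gr u0))%:C *: n0.
  have E0 : N0 u0 = n0 by exact: (proj_id (CPF O0) Tn0).
  rewrite /N1 E0 (_ : \sum_j _ = 0) ?subr0// big1// => j _.
  rewrite big1 ?scale0r// => i _; rewrite /coef E0 metricC en0.
  by rewrite mul0r.
have det0 : \det (Gr u0) != 0.
  suff : row_free (Gr u0) by rewrite row_free_unit unitmxE unitfE.
  apply: row_freeI => v vG.
  have E : rcomb (fun i => e i u0) v = mderive F u0 v by exact: rcomb_mderive.
  have Tv := tangent_mderive v O0.
  apply: (immF O0); apply: (metric_eq0 (tangent_adj Tv)).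
  have H j : CP_metric (mderive F u0 v) (e j u0) = 0.
    rewrite -E metric_rcomb; have := congr1 (fun M : 'rV[R]_n => M 0 j) vG; rewrite mxE.
    rewrite (_ : \sum_k _ = \sum_i v 0 i * CP_metric (e i u0) (e j u0)); last first.
      by apply: eq_bigr => i _; rewrite mxE.
    by move=> ->; rewrite mxE.
  rewrite -{1}E metric_rcomb big1// => i _.
  by rewrite metricC H mulr0.
pose q u := CP_metric (N1 u) (N1 u).
have sq : smooth_on Om q by exact: smooth_metric.
have q0 : 0 < q u0.
  rewrite /q N1u0 metricZl metricZr n01 mulr1 -expr2 lt_neqAle sqr_ge0 andbT eq_sym.
  by rewrite sqrf_eq0.
have cq : {for u0, continuous q}.
  by apply: differentiable_continuous; exact: (smooth_diff sq).
have /nbhs_ballP[r r0 sub] : \forall u \near u0, Om u /\ 0 < q u.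
  have H1 := nearOm O0; have H2 : \forall u \near u0, 0 < q u by exact: (cvgr_gt _ cq).
  by near do split.
pose Om' := ball u0 r; have oO' : open Om' by exact: ball_open.
have Ou0' : Om' u0 by exact: ballxx.
have OO : Om' `<=` Om by move=> u /sub[].
have qp u : Om' u -> 0 < q u by move=> /sub[].
exists Om', (fun u => (Num.sqrt (q u))^-1%:C *: N1 u); split=> //.
  apply: (msmoothZ oO'); last exact: msmooth_sub OO sN1.
  apply: (smoothV oO'); first by move=> u Ou; rewrite gt_eqF// sqrtr_gt0 qp.
  by apply: (smooth_sqrt oO') => //; exact: smooth_sub OO sq.
move=> u O'u; have Ou := OO _ O'u; split.
- by apply: tangentZ; exact: TN1.
- rewrite metricZl metricZr mulrA -invfM -expr2 sqr_sqrtr; last exact/ltW/qp.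
  exact: (mulVf (lt0r_neq0 (qp _ O'u))).
- move=> v; rewrite metricZr -(rcomb_mderive v Ou) metric_rcomb big1 ?mulr0// => i _.
  by rewrite metricC (eN1 u i Ou) mulr0.
Unshelve. all: by end_near. Qed.

End LocalHypersurface.

(** What local computations see of a hypersurface: a parametrization and a unit normal, with no
    manifold left. The equation on [n] says 2m - 1 without subtraction. *)
Record normal_chart (R : realType) (m n : nat) (Om : set 'rV[R]_n)
    (F N : 'rV[R]_n -> 'M[R[i]]_m.+1) : Prop := NormalChart {
  nc_open : open Om;
  nc_smooth : msmooth_on Om F;
  nc_CP : forall u, Om u -> CP (F u);
  nc_imm : forall u, Om u -> forall v, mderive F u v = 0 -> v = 0;
  nc_dim : n.+1 = (m + m)%N;
  nc_nsmooth : msmooth_on Om N;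
  nc_tangent : forall u, Om u -> CP_tangent (F u) (N u);
  nc_unit : forall u, Om u -> CP_metric (N u) (N u) = 1;
  nc_orth : forall u v, Om u -> CP_metric (mderive F u v) (N u) = 0 }.

Lemma metric_commutator (R : realType) (m : nat) (P N X Y : 'M[R[i]]_m.+1) c : CP P ->
  CP_tangent P N -> CP_tangent P X -> CP_tangent P Y ->
  CP_metric X (c *: (N *m Y - Y *m N)) = 0.
Proof.
move=> CPP TN TX TY; rewrite /CP_metric (tr_tangent_comm CPP TX) ?mul0r//.
rewrite -scalemxAl -scalemxAr mulmxBl mulmxBr.
by rewrite (tangent_mul_comm TN TY) (tangent_mul_comm TY TN).
Qed.

Lemma sub_common (V : zmodType) (a b c d : V) : a = b -> (a + c) - (b + d) = c - d.
Proof. by move=> ->; rewrite opprD addrACA subrr add0r. Qed.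

(** * Shape operator and the forms eta and theta in coordinates *)

Section LocalNormal.
Variables (R : realType) (m n : nat).
Local Notation mat := 'M[R[i]]_m.+1.
Local Notation ii := (0 +i* 1 : R[i]).
Variables (Om : set 'rV[R]_n) (F N : 'rV[R]_n -> mat).
Hypothesis nc : normal_chart Om F N.
Let oOm := nc_open nc.
Let sF := nc_smooth nc.
Let CPF := nc_CP nc.
Let immF := nc_imm nc.
Let nm := nc_dim nc.
Let sN := nc_nsmooth nc.
Let TN := nc_tangent nc.
Let N1 := nc_unit nc.
Let FN := nc_orth nc.

Let nearOm u : Om u -> \near u, Om u.
Proof. by move=> Ou; exact: (open_nbhs_nbhs (conj oOm Ou)). Qed.

Let dF u : Om u -> mdiff F u. Proof. exact: msmooth_mdiff. Qed.
Let dN u : Om u -> mdiff N u. Proof. exact: msmooth_mdiff. Qed.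

Lemma chart_tangent u v : Om u -> CP_tangent (F u) (mderive F u v).
Proof. exact: tangent_mderive. Qed.

Lemma normal_span u X : Om u -> CP_tangent (F u) X -> CP_metric X (N u) = 0 ->
  exists v, X = mderive F u v.
Proof.
move=> Ou TX XN; pose e i := mderive F u (delta_mx 0 i).
have rE v : rcomb e v = mderive F u v by exact: (rcomb_mderive sF v Ou).
have h1 i : CP_tangent (F u) (e i) by exact: chart_tangent.
have h2 v : rcomb e v = 0 -> v = 0 by rewrite rE; exact: immF.
have h3 i : CP_metric (e i) (N u) = 0 by exact: FN.
have [v ->] := span_normal (CPF Ou) nm h1 h2 (TN Ou) (N1 Ou) h3 TX XN.
by exists v.
Qed.

Lemma dnormal_adj u v : Om u -> (mderive N u v)^t* = mderive N u v.
Proof.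
move=> Ou; have [da Da] := mdiff_adj (dN Ou); rewrite -Da.
apply: (near_mdiff _ da).2; apply: filterS (nearOm Ou) => y Oy.
exact: tangent_adj (TN Oy).
Qed.

Lemma dnormal_eq u v : Om u -> mderive N u v = mderive N u v *m F u +
  (N u *m mderive F u v + mderive F u v *m N u) + F u *m mderive N u v.
Proof.
move=> Ou; have [d1 D1] := mdiffM (dN Ou) (dF Ou); have [d2 D2] := mdiffM (dF Ou) (dN Ou).
have [d D] := mdiffD d1 d2.
have E : mderive (fun y => N y *m F y + F y *m N y) u v = mderive N u v.
  apply: (near_mdiff _ d).2; apply: filterS (nearOm Ou) => y Oy.
  exact: tangentE (TN Oy).
rewrite -{1}E D D1 D2 -!addrA; congr (_ + (_ + _)).
Qed.

Lemma dnormal_orth u v : Om u -> CP_metric (mderive N u v) (N u) = 0.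
Proof.
move=> Ou; have [d D] := metric_diff (dN Ou) (dN Ou).
have E : 'D_v (fun y => CP_metric (N y) (N y)) u = 0.
  rewrite (@near_eq_derive _ _ _ _ (cst (1 : R))) ?derive_cst//.
  by apply: filterS (nearOm Ou) => y Oy; rewrite N1.
move: (D v); rewrite E (metricC (N u)); lra.
Qed.

(** Differentiating [g(dF(b), N) = 0] trades dN for a second derivative of [F], which is symmetric.
    This is the self-adjointness of the shape operator. *)
Lemma second_form_sym u v w : Om u ->
  CP_metric (mderive N u v) (mderive F u w) = CP_metric (mderive N u w) (mderive F u v).
Proof.
move=> Ou.
have H a b : CP_metric (mderive N u a) (mderive F u b) =
    - CP_metric (mderive (fun y => mderive F y b) u a) (N u).
  have dFb : mdiff (fun y => mderive F y b) u.
    exact: (msmooth_mdiff (msmooth_mderive oOm b sF) Ou).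
  have [d D] := metric_diff dFb (dN Ou).
  have E : 'D_a (fun y => CP_metric (mderive F y b) (N y)) u = 0.
    rewrite (@near_eq_derive _ _ _ _ (cst (0 : R))) ?derive_cst//.
    by apply: filterS (nearOm Ou) => y Oy; rewrite FN.
  move: (D a); rewrite E (metricC (mderive F u b)) => /eqP; rewrite eq_sym addrC addr_eq0.
  by move=> /eqP.
apply: (etrans (H v w)); apply: etrans (esym (H w v)).
have E := mderive_swap oOm w v sF Ou.
exact (congr1 (fun X => - CP_metric X (N u)) E).
Qed.

Definition chart_shape u v : mat := - CP_proj (F u) (mderive N u v).

Lemma proj_dN_tangent u v : Om u -> CP_tangent (F u) (CP_proj (F u) (mderive N u v)).
Proof. by move=> Ou; apply: (proj_tangent (CPF Ou)); exact: dnormal_adj. Qed.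

Lemma chart_shape_tang u v : Om u -> tang_at (F u) (N u) (chart_shape u v).
Proof.
move=> Ou; split; first by apply: tangentN; exact: proj_dN_tangent.
by rewrite /chart_shape metricNl (metric_proj (CPF Ou) _ (TN Ou)) dnormal_orth// oppr0.
Qed.

Lemma projD (P X Y : mat) : CP_proj P (X + Y) = CP_proj P X + CP_proj P Y.
Proof.
rewrite /CP_proj; move: (1%:M - P) => Q.
by rewrite [P *m (X + Y)]mulmxDr [Q *m (X + Y)]mulmxDr 2!mulmxDl addrACA.
Qed.

Lemma projZ (P X : mat) c : CP_proj P (c *: X) = c *: CP_proj P X.
Proof. by rewrite /CP_proj -!scalemxAr -!scalemxAl scalerDr. Qed.

Lemma chart_shapeD u v w : Om u -> chart_shape u (v + w) = chart_shape u v + chart_shape u w.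
Proof. by move=> Ou; rewrite /chart_shape (mderiveD _ _ (dN Ou)) projD opprD. Qed.

Lemma chart_shapeZ u c v : Om u -> chart_shape u (c *: v) = c%:C *: chart_shape u v.
Proof. by move=> Ou; rewrite /chart_shape (mderive_scale _ _ (dN Ou)) projZ scalerN. Qed.

Lemma metric_chart_shape u v w : Om u ->
  CP_metric (chart_shape u v) (mderive F u w) = - CP_metric (mderive N u v) (mderive F u w).
Proof.
by move=> Ou; rewrite /chart_shape metricNl (metric_proj (CPF Ou) _ (chart_tangent w Ou)).
Qed.

(* N P N is the orthogonal projection onto the line C N z, for P = z z^H *)
Definition normal_line u : mat := nproj (F u) (N u).

Lemma normal_line_smooth : msmooth_on Om normal_line.
Proof. by apply: (msmoothM oOm) sN; exact: (msmoothM oOm sN sF). Qed.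

Lemma normal_line_derive u v : Om u ->
  mderive normal_line u v = dnproj (F u) (N u) (mderive F u v) (mderive N u v).
Proof.
move=> Ou; have [d1 D1] := mdiffM (dN Ou) (dF Ou).
by have [d D] := mdiffM d1 (dN Ou); rewrite D D1 mulmxDl.
Qed.

Lemma normal_line_derive0 u v : Om u -> holo (F u) (N u) (mderive F u v) ->
  (forall Y, holo (F u) (N u) Y -> CP_metric (mderive N u v) Y = 0) ->
  mderive normal_line u v = 0.
Proof.
move=> Ou DX H; rewrite normal_line_derive//.
apply: (dnproj_shape (CPF Ou) (TN Ou) DX (dnormal_eq v Ou)).
apply: (orth_holo (CPF Ou) (TN Ou) (N1 Ou)).
- exact: proj_dN_tangent.
- by rewrite (metric_proj (CPF Ou) _ (TN Ou)) dnormal_orth.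
- move=> Y DY; rewrite (metric_proj (CPF Ou) _ (holo_tangent DY)); exact: H.
Qed.

Lemma shape_of_normal_line u v Y : Om u -> holo (F u) (N u) (mderive F u v) ->
  mderive normal_line u v = 0 -> holo (F u) (N u) Y -> CP_metric (mderive N u v) Y = 0.
Proof.
move=> Ou DX; rewrite normal_line_derive// => G0 DY.
rewrite -(metric_proj (CPF Ou) _ (holo_tangent DY)).
exact: (shape_dnproj (CPF Ou) (TN Ou) (N1 Ou) DX (dnormal_eq v Ou) G0 DY (dnormal_adj v Ou)).
Qed.


Definition xi_field u : mat := xi_at (F u) (N u).

Lemma xi_field_smooth : msmooth_on Om xi_field.
Proof.
apply: (msmoothN oOm); apply: (msmoothZc oOm).
by apply: (msmoothB oOm); [exact: (msmoothM oOm sN sF)|exact: (msmoothM oOm sF sN)].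
Qed.

Lemma xi_field_derive u v : Om u ->
  mderive xi_field u v = dxi (F u) (N u) (mderive F u v) (mderive N u v).
Proof.
move=> Ou; have [d1 D1] := mdiffM (dN Ou) (dF Ou); have [d2 D2] := mdiffM (dF Ou) (dN Ou).
have [d3 D3] := mdiffB d1 d2; have [d4 D4] := mdiffZc ii d3; have [d5 D5] := mdiffN d4.
by apply: (etrans (D5 v)); rewrite D4 D3 D1 D2.
Qed.

Lemma xi_tangent u : Om u -> CP_tangent (F u) (xi_field u).
Proof. by move=> Ou; apply: tangentN; exact: (J_tangent (CPF Ou) (TN Ou)). Qed.

Lemma xi_normal u : Om u -> CP_metric (xi_field u) (N u) = 0.
Proof.
by move=> Ou; rewrite /xi_field /xi_at metricNl (metricJ0 (CPF Ou) (TN Ou)) oppr0.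
Qed.

Lemma xi_unit u : Om u -> CP_metric (xi_field u) (xi_field u) = 1.
Proof.
move=> Ou; rewrite /xi_field /xi_at metricNl metricNr opprK.
exact: metricJNN (CPF Ou) (TN Ou) (N1 Ou).
Qed.

Lemma holo_mderiveP u v : Om u ->
  holo (F u) (N u) (mderive F u v) <-> CP_metric (mderive F u v) (xi_field u) = 0.
Proof.
move=> Ou; rewrite /xi_field /xi_at metricNr; split=> [[_ _ ->]|H]; first exact: oppr0.
split; [exact: chart_tangent|exact: FN|].
by apply/eqP; rewrite -oppr_eq0 H.
Qed.

Lemma xi_coord u : Om u -> exists e, mderive F u e = xi_field u.
Proof.
move=> Ou; have [e E] := normal_span Ou (xi_tangent Ou) (xi_normal Ou).
by exists e.
Qed.

(** For a fixed coordinate vector these are scalar functions of the point, so the exterior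
    derivative of a form is a difference of two partial derivatives, with no bracket. Up to sign,
    [theta_coord] is [g(AX, xi)] and [form_coord] is the second fundamental form. *)
Definition eta_coord v u : R := CP_metric (mderive F u v) (xi_field u).
Definition theta_coord v u : R := CP_metric (mderive N u v) (xi_field u).
Definition form_coord v w u : R := CP_metric (mderive N u v) (mderive F u w).

Lemma eta_coord_smooth v : smooth_on Om (eta_coord v).
Proof. exact: (smooth_metric oOm (msmooth_mderive oOm v sF) xi_field_smooth). Qed.

Lemma theta_coord_smooth v : smooth_on Om (theta_coord v).
Proof. exact: (smooth_metric oOm (msmooth_mderive oOm v sN) xi_field_smooth). Qed.

Lemma form_coord_smooth v w : smooth_on Om (form_coord v w).
Proof. exact: (smooth_metric oOm (msmooth_mderive oOm v sN) (msmooth_mderive oOm w sF)). Qed.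

Lemma eta_coord_lin a b v w u : Om u ->
  eta_coord (a *: v + b *: w) u = a * eta_coord v u + b * eta_coord w u.
Proof.
move=> Ou; rewrite /eta_coord (mderive_lin (dF Ou)) (mderive_scale _ _ (dF Ou)).
by rewrite metricDl !metricZl.
Qed.

Lemma theta_coord_lin a b v w u : Om u ->
  theta_coord (a *: v + b *: w) u = a * theta_coord v u + b * theta_coord w u.
Proof.
move=> Ou; rewrite /theta_coord (mderive_lin (dN Ou)) (mderive_scale _ _ (dN Ou)).
by rewrite metricDl !metricZl.
Qed.

Lemma form_coord_linl a b v w z u : Om u ->
  form_coord (a *: v + b *: w) z u = a * form_coord v z u + b * form_coord w z u.
Proof.
move=> Ou; rewrite /form_coord (mderive_lin (dN Ou)) (mderive_scale _ _ (dN Ou)).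
by rewrite metricDl !metricZl.
Qed.

Lemma form_coord_linr a b v w z u : Om u ->
  form_coord z (a *: v + b *: w) u = a * form_coord z v u + b * form_coord z w u.
Proof.
move=> Ou; rewrite /form_coord (mderive_lin (dF Ou)) (mderive_scale _ _ (dF Ou)).
by rewrite metricDr !metricZr.
Qed.

(* Symmetry of second derivatives: only the derivative of xi is left in the exterior
   derivatives of the forms eta and theta = g(dN, xi). *)
Lemma eta_coord_derive v w u : Om u ->
  'D_w (eta_coord v) u - 'D_v (eta_coord w) u =
  CP_metric (mderive F u v) (mderive xi_field u w)
  - CP_metric (mderive F u w) (mderive xi_field u v).
Proof.
move=> Ou; have dx := msmooth_mdiff xi_field_smooth Ou.
have D a := (metric_diff (msmooth_mdiff (msmooth_mderive oOm a sF) Ou) dx).2.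
have E := congr1 (fun X => CP_metric X (xi_field u)) (mderive_swap oOm v w sF Ou).
exact (etrans (congr2 (fun a b => a - b) (D v w) (D w v)) (sub_common _ _ E)).
Qed.

Lemma theta_coord_derive v w u : Om u ->
  'D_w (theta_coord v) u - 'D_v (theta_coord w) u =
  CP_metric (mderive N u v) (mderive xi_field u w)
  - CP_metric (mderive N u w) (mderive xi_field u v).
Proof.
move=> Ou; have dx := msmooth_mdiff xi_field_smooth Ou.
have D a := (metric_diff (msmooth_mdiff (msmooth_mderive oOm a sN) Ou) dx).2.
have E := congr1 (fun X => CP_metric X (xi_field u)) (mderive_swap oOm v w sN Ou).
exact (etrans (congr2 (fun a b => a - b) (D v w) (D w v)) (sub_common _ _ E)).
Qed.

Lemma chart_shape0 u : chart_shape u 0 = 0.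
Proof.
rewrite /chart_shape mderive0; have := projZ (F u) 0 0.
by rewrite !scale0r => ->; exact: oppr0.
Qed.

Lemma form_coordE v w u : form_coord v w u = CP_metric (mderive N u v) (mderive F u w).
Proof. by []. Qed.

Lemma xi_fieldE u : xi_field u = xi_at (F u) (N u).
Proof. by []. Qed.

Lemma form_coord_sym v w u : Om u -> form_coord v w u = form_coord w v u.
Proof. exact: second_form_sym. Qed.

Lemma chart_shape_form v w u : Om u ->
  CP_metric (chart_shape u v) (mderive F u w) = - form_coord v w u.
Proof. exact: metric_chart_shape. Qed.

Lemma chart_shape_xi v u : Om u ->
  CP_metric (chart_shape u v) (xi_field u) = - theta_coord v u.
Proof.
move=> Ou; rewrite /chart_shape metricNl.
exact (congr1 (fun x => - x) (metric_proj (CPF Ou) _ (xi_tangent Ou))).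
Qed.

Lemma chart_shapeE u v : CP_proj (F u) (mderive N u v) = - chart_shape u v.
Proof. by rewrite /chart_shape opprK. Qed.

Lemma holo_etaP u v : Om u -> holo (F u) (N u) (mderive F u v) <-> eta_coord v u = 0.
Proof. exact: holo_mderiveP. Qed.

Lemma eta_coord_xi u e : Om u -> mderive F u e = xi_field u -> eta_coord e u = 1.
Proof. by move=> Ou E; rewrite /eta_coord E; exact: xi_unit. Qed.

End LocalNormal.

Opaque CP_metric mderive CP_J CP_proj derive theta_coord eta_coord form_coord xi_field chart_shape.

Lemma derivative_mul_rel (R : realType) (V : normedModType R) (f1 f2 g1 g2 : V -> R) x v :
  differentiable f1 x -> differentiable f2 x -> differentiable g1 x -> differentiable g2 x ->
  (\near x, f1 x * f2 x = g1 x * g2 x) ->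
  'D_v f1 x * f2 x + f1 x * 'D_v f2 x = 'D_v g1 x * g2 x + g1 x * 'D_v g2 x.
Proof.
move=> df1 df2 dg1 dg2 H.
by rewrite -(derivative_mul _ df1 df2) -(derivative_mul _ dg1 dg2); exact: near_eq_derive.
Qed.

Lemma cross_mul (R : comPzRingType) (a b : R) : a * b + - b * a = 0.
Proof. by rewrite mulNr mulrC subrr. Qed.

Lemma cross_mul0 (R : comPzRingType) (a b c d : R) : a * c + - b * d = 0 -> c * a = d * b.
Proof. by rewrite mulNr => /eqP; rewrite subr_eq0 => /eqP E; rewrite mulrC E mulrC. Qed.

Lemma key_arith (R : pzRingType) (dt ee t de te' et te dx : R) :
  dt * ee + t * de = te' * et + te * dx -> ee = 1 -> et = 0 -> t = 0 -> dt = te * dx.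
Proof. by move=> E e1 e2 e3; move: E; rewrite e1 e2 e3 mulr1 mul0r addr0 mulr0 add0r. Qed.

(** Here [c] is [g(JAX, AY)], [d] is [g(JX, Y)], [be] is [g(JAX, Y)] and [h] is [g(AJX, Y)]; [dt]
    and [de] are the exterior derivatives of theta and eta, related by [dt = - alpha de]. *)
Lemma codazzi_arith (R : realFieldType) (dt de te a1 a2 b1 b2 c d h al be : R) :
  dt = te * de -> dt = a1 - a2 -> de = b1 - b2 -> a1 = - - c + - d -> a2 = - c + d ->
  b1 = - h -> b2 = - - be -> te = - al -> 2 * c = al * (be + h) + 2 * d.
Proof. by move=> e1 e2 e3 e4 e5 e6 e7 e8; move: e2; rewrite e1 e3 e4 e5 e6 e7 e8; lra. Qed.

(** * Eta-purity in a chart forces g(AX, Y) = 0 on D *)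

Section EtaPureChart.
Variables (R : realType) (m n : nat).
Local Notation mat := 'M[R[i]]_m.+1.
Variables (Om : set 'rV[R]_n) (F N : 'rV[R]_n -> mat).
Hypothesis nc : normal_chart Om F N.
Let CPF := nc_CP nc.
Let TN := nc_tangent nc.
Let N1 := nc_unit nc.
Let oOm := nc_open nc.

Variable A : 'rV[R]_n -> mat -> mat.
Hypothesis AE : forall u v, Om u -> A u (mderive F u v) = chart_shape F N u v.

Let dF u : Om u -> mdiff F u. Proof. exact: (msmooth_mdiff (nc_smooth nc)). Qed.

Let tangP u X : Om u -> tang_at (F u) (N u) X -> exists v, X = mderive F u v.
Proof. by move=> Ou [TX XN]; exact: (normal_span nc Ou TX XN). Qed.

Let A_tang u X : Om u -> tang_at (F u) (N u) X -> tang_at (F u) (N u) (A u X).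
Proof. by move=> Ou /(tangP Ou)[v ->]; rewrite AE//; exact: (chart_shape_tang nc). Qed.

Let A_add u X Y : Om u -> tang_at (F u) (N u) X -> tang_at (F u) (N u) Y ->
  A u (X + Y) = A u X + A u Y.
Proof.
move=> Ou /(tangP Ou)[v ->] /(tangP Ou)[w ->].
rewrite -(mderiveD _ _ (dF Ou)) !AE//; exact: (chart_shapeD nc).
Qed.

Let A_scale u c X : Om u -> tang_at (F u) (N u) X -> A u (c%:C *: X) = c%:C *: A u X.
Proof.
move=> Ou /(tangP Ou)[v ->]; rewrite -(mderive_scale _ _ (dF Ou)) !AE//.
exact: (chart_shapeZ nc).
Qed.

Let A_metric u v w : Om u -> CP_metric (A u (mderive F u v)) (mderive F u w) =
  - form_coord F N v w u.
Proof. by move=> Ou; rewrite AE//; exact: (chart_shape_form nc). Qed.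

Let A_sym u X Y : Om u -> tang_at (F u) (N u) X -> tang_at (F u) (N u) Y ->
  CP_metric (A u X) Y = CP_metric (A u Y) X.
Proof.
move=> Ou /(tangP Ou)[v ->] /(tangP Ou)[w ->].
have E := congr1 (fun x => - x) (form_coord_sym nc v w Ou).
exact (etrans (A_metric v w Ou) (etrans E (esym (A_metric w v Ou)))).
Qed.

Let A_xi u v : Om u -> CP_metric (A u (mderive F u v)) (xi_field F N u) = - theta_coord F N v u.
Proof.
by move=> Ou; rewrite AE//; exact: (chart_shape_xi nc).
Qed.

(** Near [u0] theta is proportional to eta, in the division-free form
    [theta(x) eta(e) = theta(e) eta(x)], since [eta(e) x - eta(x) e] is in D. At [u0] one has
    [eta(e) = 1] and [theta(x) = eta(x) = 0], so differentiating multiplies the derivatives of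
    [theta(e)] and [eta(e)] by zero. This is d theta = - alpha d eta on D. *)
Lemma hopf_theta u0 : Om u0 ->
  (\near u0, forall v, holo (F u0) (N u0) (mderive F u0 v) -> theta_coord F N v u0 = 0) ->
  forall e v w, mderive F u0 e = xi_field F N u0 ->
  holo (F u0) (N u0) (mderive F u0 v) -> holo (F u0) (N u0) (mderive F u0 w) ->
  'D_w (theta_coord F N v) u0 - 'D_v (theta_coord F N w) u0 =
  theta_coord F N e u0 * ('D_w (eta_coord F N v) u0 - 'D_v (eta_coord F N w) u0).
Proof.
move=> O0 hopf e v w eE Dv Dw.
have rel x : \near u0, theta_coord F N x u0 * eta_coord F N e u0 =
    theta_coord F N e u0 * eta_coord F N x u0.
  have H := open_nbhs_nbhs (conj oOm O0); apply: filterS2 hopf H => u hu Ou.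
  have H0 := theta_coord_lin nc (eta_coord F N e u) (- eta_coord F N x u) x e Ou.
  have H1 := eta_coord_lin nc (eta_coord F N e u) (- eta_coord F N x u) x e Ou.
  have {}H1 := etrans H1 (cross_mul _ _).
  have {}H1 := etrans (esym H0) (hu _ (proj2 (holo_etaP nc _ Ou) H1)).
  exact: (cross_mul0 H1).
have dt x : differentiable (theta_coord F N x) u0 by exact: (smooth_diff (theta_coord_smooth nc x)).
have de x : differentiable (eta_coord F N x) u0 by exact: (smooth_diff (eta_coord_smooth nc x)).
have ee : eta_coord F N e u0 = 1.
  exact: (eta_coord_xi nc O0 eE).
have key x y : holo (F u0) (N u0) (mderive F u0 x) ->
    'D_y (theta_coord F N x) u0 = theta_coord F N e u0 * 'D_y (eta_coord F N x) u0.
  move=> Dx; have := derivative_mul_rel y (dt x) (de e) (dt e) (de x) (rel x).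
  have E0 : eta_coord F N x u0 = 0 by exact: (proj1 (holo_etaP nc _ O0) Dx).
  have t0 : theta_coord F N x u0 = 0 by exact: (nbhs_singleton hopf).
  by move=> H; exact: (key_arith H ee E0 t0).
exact (etrans (congr2 (fun a b => a - b) (key v w Dv) (key w v Dw)) (esym (mulrBr _ _ _))).
Qed.

Let V u v := CP_proj (F u) (mderive N u v).

(** The classical identity [2 A phi A = alpha (A phi + phi A) + 2 phi] for [A xi = alpha xi],
    restricted to D. It compares [hopf_theta] with the values of d theta and d eta obtained from dN
    and the derivative of xi. *)
Lemma hopf_codazzi u0 : Om u0 ->
  (\near u0, forall v, holo (F u0) (N u0) (mderive F u0 v) -> theta_coord F N v u0 = 0) ->
  forall X Y, holo (F u0) (N u0) X -> holo (F u0) (N u0) Y ->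
  2 * CP_metric (CP_J (F u0) (A u0 X)) (A u0 Y) =
  CP_metric (A u0 (xi_at (F u0) (N u0))) (xi_at (F u0) (N u0)) *
   (CP_metric (CP_J (F u0) (A u0 X)) Y + CP_metric (A u0 (CP_J (F u0) X)) Y)
  + 2 * CP_metric (CP_J (F u0) X) Y.
Proof.
move=> O0 hopf X Y DX DY.
have tX : tang_at (F u0) (N u0) X by case: DX.
have tY : tang_at (F u0) (N u0) Y by case: DY.
have TX := holo_tangent DX; have TY := holo_tangent DY.
have tJX : tang_at (F u0) (N u0) (CP_J (F u0) X) by case: (holoJ (CPF O0) (TN O0) DX).
have [x xE] := tangP O0 tX; have [y yE] := tangP O0 tY; have [e eE] := xi_coord nc O0.
have Dx : holo (F u0) (N u0) (mderive F u0 x) by rewrite -xE.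
have Dy : holo (F u0) (N u0) (mderive F u0 y) by rewrite -yE.
have [TAX _] := A_tang O0 tX; have [TAY _] := A_tang O0 tY.
have VX : CP_proj (F u0) (mderive N u0 x) = - A u0 X by rewrite chart_shapeE xE AE.
have VY : CP_proj (F u0) (mderive N u0 y) = - A u0 Y by rewrite chart_shapeE yE AE.
have cod a b (Da : holo (F u0) (N u0) (mderive F u0 a)) (Db : holo (F u0) (N u0) (mderive F u0 b)) :
  CP_metric (mderive N u0 a) (mderive (xi_field F N) u0 b) =
  - CP_metric (CP_proj (F u0) (mderive N u0 a)) (CP_J (F u0) (CP_proj (F u0) (mderive N u0 b)))
  + CP_metric (CP_J (F u0) (mderive F u0 b)) (mderive F u0 a).
  rewrite (xi_field_derive nc b O0).
  exact: (metric_codazzi (CPF O0) (TN O0) (N1 O0) Da (dnormal_eq nc a O0) Db (dnormal_eq nc b O0)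
    (dnormal_adj nc a O0) (dnormal_adj nc b O0)).
have cod2 a b (Da : holo (F u0) (N u0) (mderive F u0 a)) (Db : holo (F u0) (N u0) (mderive F u0 b)) :
  CP_metric (mderive F u0 a) (mderive (xi_field F N) u0 b) =
  - CP_metric (mderive F u0 a) (CP_J (F u0) (CP_proj (F u0) (mderive N u0 b))).
  have Ta := holo_tangent Da; have Tb := holo_tangent Db.
  rewrite (xi_field_derive nc b O0).
  have E := dxi_holo (CPF O0) (TN O0) Db (dnormal_eq nc b O0).
  apply: (etrans (congr1 (CP_metric (mderive F u0 a)) E)).
  by rewrite metricBr metricNr (metric_commutator _ (CPF O0) (TN O0) Ta Tb) subr0.
have Et : theta_coord F N e u0 = - CP_metric (A u0 (xi_at (F u0) (N u0))) (xi_at (F u0) (N u0)).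
  have := A_xi e O0; rewrite eE xi_fieldE => H.
  exact (etrans (esym (opprK _)) (congr1 (fun z => - z) (esym H))).
have F1 : CP_metric (- A u0 X) (CP_J (F u0) (- A u0 Y)) = - CP_metric (CP_J (F u0) (A u0 X)) (A u0 Y).
  by rewrite JN metricNl metricNr opprK (metricJl (CPF O0) TAX TAY) opprK.
have F2 : CP_metric (- A u0 Y) (CP_J (F u0) (- A u0 X)) = CP_metric (CP_J (F u0) (A u0 X)) (A u0 Y).
  by rewrite JN metricNl metricNr opprK metricC.
have F3 : CP_metric (CP_J (F u0) Y) X = - CP_metric (CP_J (F u0) X) Y.
  by rewrite (metricJl (CPF O0) TY TX) metricC.
have F4 : CP_metric X (CP_J (F u0) (- A u0 Y)) = CP_metric (A u0 (CP_J (F u0) X)) Y.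
  rewrite JN metricNr -(metricJl (CPF O0) TX TAY) metricC.
  exact: (A_sym O0 tY tJX).
have F5 : CP_metric Y (CP_J (F u0) (- A u0 X)) = - CP_metric (CP_J (F u0) (A u0 X)) Y.
  by rewrite JN metricNr metricC.
have C1 := cod x y Dx Dy; have C2 := cod y x Dy Dx.
have C3 := cod2 x y Dx Dy; have C4 := cod2 y x Dy Dx.
rewrite VX VY -xE -yE F1 F3 in C1; rewrite VX VY -xE -yE F2 in C2.
rewrite VY -xE F4 in C3; rewrite VX -yE F5 in C4.
have H := hopf_theta O0 hopf eE Dx Dy.
have T1 := theta_coord_derive nc x y O0; have E1 := eta_coord_derive nc x y O0.
rewrite -xE -yE in E1.
exact: (codazzi_arith H T1 E1 C1 C2 C3 C4 Et).
Qed.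

Hypothesis pure : forall u, Om u -> forall X Y, holo (F u) (N u) X -> holo (F u) (N u) Y ->
  cho_shape_at (F u) (N u) (A u) (phi_at (F u) (N u) X) Y =
  cho_shape_at (F u) (N u) (A u) X (phi_at (F u) (N u) Y).

Lemma eta_pure_hopf_at u v w : Om u -> holo (F u) (N u) (mderive F u v) ->
  holo (F u) (N u) (mderive F u w) -> form_coord F N v w u != 0 ->
  forall z, holo (F u) (N u) (mderive F u z) -> theta_coord F N z u = 0.
Proof.
move=> Ou Dv Dw b0 z Dz; apply/eqP/negPn/negP => t0; move/eqP: b0; apply.
have Az : exists2 Z, holo (F u) (N u) Z & aform (F u) (N u) (A u) Z != 0.
  exists (mderive F u z) => //; apply: contra t0 => /eqP H.
  by rewrite -oppr_eq0; apply/eqP; exact (etrans (esym (A_xi z Ou)) H).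
have H := eta_pure_nonhopf (CPF Ou) (TN Ou) (fun X => A_tang Ou) (fun X Y => A_add Ou)
  (fun c X => A_scale c Ou) (fun X Y => A_sym Ou) (pure Ou) Az Dv Dw.
by apply/eqP; rewrite -oppr_eq0; apply/eqP; exact (etrans (esym (A_metric v w Ou)) H).
Qed.

Theorem eta_pure_form0 u0 x y : Om u0 -> holo (F u0) (N u0) (mderive F u0 x) ->
  holo (F u0) (N u0) (mderive F u0 y) -> form_coord F N x y u0 = 0.
Proof.
move=> O0 Dx Dy; apply/eqP/negPn/negP => b0.
have [e eE] := xi_coord nc O0.
(* The vectors [x] and [y] are known to be in D only at [u0]. The combination [ht z] stays in D at
   every point, and equals [z] at [u0] for [z] in D there, because [eta(e) = 1]. *)
pose ht z u := eta_coord F N e u *: z + (- eta_coord F N z u) *: e.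
have Dht z u : Om u -> holo (F u) (N u) (mderive F u (ht z u)).
  move=> Ou; apply: (proj2 (holo_etaP nc _ Ou)).
  exact (etrans (eta_coord_lin nc _ _ _ _ Ou) (cross_mul _ _)).
(* The second fundamental form on the moving vectors [ht x] and [ht y], expanded on fixed ones. It
   is a polynomial in smooth functions, hence continuous, and stays nonzero near [u0]. *)
pose beta u := eta_coord F N e u *
    (eta_coord F N e u * form_coord F N x y u + - eta_coord F N y u * form_coord F N x e u)
  + - eta_coord F N x u *
    (eta_coord F N e u * form_coord F N e y u + - eta_coord F N y u * form_coord F N e e u).
have betaE u : Om u -> form_coord F N (ht x u) (ht y u) u = beta u.
  move=> Ou; rewrite (form_coord_linl nc _ _ _ _ _ Ou).
  by rewrite (form_coord_linr nc _ _ _ _ x Ou) (form_coord_linr nc _ _ _ _ e Ou).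
have se z : smooth_on Om (eta_coord F N z) by exact: (eta_coord_smooth nc z).
have sf z t : smooth_on Om (form_coord F N z t) by exact: (form_coord_smooth nc z t).
have sNe z := smoothN oOm (se z).
have sbeta : smooth_on Om beta.
  exact: (smoothD oOm
    (smoothM oOm (se e) (smoothD oOm (smoothM oOm (se e) (sf x y)) (smoothM oOm (sNe y) (sf x e))))
    (smoothM oOm (sNe x) (smoothD oOm (smoothM oOm (se e) (sf e y)) (smoothM oOm (sNe y) (sf e e))))).
have beta0 : beta u0 != 0.
  rewrite /beta (eta_coord_xi nc O0 eE) (proj1 (holo_etaP nc x O0) Dx).
  by rewrite (proj1 (holo_etaP nc y O0) Dy) oppr0 !mul0r !addr0 !mul1r.
have cb : {for u0, continuous beta}.
  by apply: differentiable_continuous; exact: (smooth_diff sbeta O0).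
have nb : \near u0, beta u0 != 0 by exact: (cvgr_neq0 _ cb).
have hopf : \near u0, forall v, holo (F u0) (N u0) (mderive F u0 v) -> theta_coord F N v u0 = 0.
  apply: filterS2 nb (open_nbhs_nbhs (conj oOm O0)) => u bu Ou.
  apply: (eta_pure_hopf_at Ou (Dht x u Ou) (Dht y u Ou)).
  by rewrite betaE.
have aX X : holo (F u0) (N u0) X -> aform (F u0) (N u0) (A u0) X = 0.
  move=> DX; have [v vE] := tangP O0 (conj (holo_tangent DX) (let: And3 _ H _ := DX in H)).
  subst X; rewrite /aform; apply: (etrans (A_xi v O0)).
  by rewrite (nbhs_singleton hopf v DX) oppr0.
(* As [A xi = alpha xi] holds around [u0], the Codazzi identity is available at [u0] and makes [x]
   vanish, against [b0]. *)
have X0 := eta_pure_hopf (CPF O0) (TN O0) (N1 O0) (fun X => A_tang O0)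
  (fun c X => A_scale c O0) (pure O0) aX (hopf_codazzi O0 hopf) Dx.
have x0 := nc_imm nc O0 X0.
move/eqP: b0; apply; rewrite x0 form_coordE mderive0.
exact: metric0l.
Qed.

End EtaPureChart.

Lemma kernel_arith (K : fieldType) (a b c dx de : K) :
  dx = a * c -> de = b * c -> dx = 0 -> de != 0 -> a = 0.
Proof.
move=> -> -> /eqP; rewrite mulf_eq0 => /orP[/eqP //|/eqP ->].
by rewrite mulr0 eqxx.
Qed.

Lemma quotient_arith (K : fieldType) (a b : K) : b != 0 -> - (a / b) * b + a = 0.
Proof. by move=> b0; rewrite mulNr divfK// addNr. Qed.

Lemma coef_arith (K : idomainType) (c q de : K) : (c - q) * de + 0 = 0 -> de != 0 -> c = q.
Proof.
by rewrite addr0 => /eqP; rewrite mulf_eq0 subr_eq0 => /orP[/eqP//|/eqP ->]; rewrite eqxx.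
Qed.

Lemma derivative_affine_scale (R : realType) k n (u e : 'rV[R]_n) (L : 'M[R]_(k, n))
    (sg : 'rV[R]_k -> R) t v : differentiable sg t ->
  'D_v (fun t => u + t *m L + sg t *: e) t = v *m L + 'D_v sg t *: e.
Proof.
move=> dsg.
have cL := @mulmxr_cont R k n L.
have dL : differentiable (mulmxr L : 'rV[R]_k -> 'rV[R]_n) t by exact: linear_differentiable.
have DL : 'D_v (mulmxr L : 'rV[R]_k -> 'rV[R]_n) t = v *m L.
  by rewrite (deriveE _ dL) (diff_lin _ cL).
have du : differentiable (cst u : 'rV[R]_k -> 'rV[R]_n) t by exact: differentiable_cst.
have ds : differentiable (fun t => sg t *: e) t by exact: differentiableZl.
have Ds : 'D_v (fun t => sg t *: e) t = 'D_v sg t *: e.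
  by rewrite (deriveE _ ds) (diffZl _ dsg) (deriveE _ dsg).
have d1 := differentiableD du dL.
apply: (etrans (deriveD (dderiv d1) (dderiv ds))).
by rewrite (deriveD (dderiv du) (dderiv dL)) derive_cst add0r DL Ds.
Qed.

(** * Integral patches of D and the line of the normal *)

Section RuledChart.
Variables (R : realType) (m n : nat).
Local Notation mat := 'M[R[i]]_m.+1.
Variables (Om : set 'rV[R]_n) (F N : 'rV[R]_n -> mat).
Hypothesis nc : normal_chart Om F N.
Let CPF := nc_CP nc.
Let TN := nc_tangent nc.
Let N1 := nc_unit nc.
Let oOm := nc_open nc.

Let dF u : Om u -> mdiff F u. Proof. exact: (msmooth_mdiff (nc_smooth nc)). Qed.
Let dN u : Om u -> mdiff N u. Proof. exact: (msmooth_mdiff (nc_nsmooth nc)). Qed.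

Lemma holo_coord u X : Om u -> holo (F u) (N u) X -> exists v, X = mderive F u v.
Proof. by move=> Ou [TX XN _]; exact: (normal_span nc Ou TX XN). Qed.

(** The infinitesimal form of being ruled, [g(AX, Y) = 0] on D at one point. Both directions of the
    theorem pass through it. *)
Definition form0_at u := forall v w, holo (F u) (N u) (mderive F u v) ->
  holo (F u) (N u) (mderive F u w) -> form_coord F N v w u = 0.

Lemma form0_normal_line u v : Om u -> form0_at u ->
  holo (F u) (N u) (mderive F u v) -> mderive (normal_line F N) u v = 0.
Proof.
move=> Ou f0 Dv; apply: (normal_line_derive0 nc Ou Dv) => Y DY.
have [w wE] := holo_coord Ou DY; subst Y.
exact (etrans (esym (form_coordE F N v w u)) (f0 v w Dv DY)).
Qed.

Lemma normal_line_form0 u : Om u -> (forall v, holo (F u) (N u) (mderive F u v) ->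
  mderive (normal_line F N) u v = 0) -> form0_at u.
Proof.
move=> Ou H v w Dv Dw; apply: (etrans (form_coordE F N v w u)).
exact: (shape_of_normal_line nc Ou Dv (H v Dv) Dw).
Qed.

Section Patch.
Variables (k : nat) (W : set 'rV[R]_k) (E : 'rV[R]_k -> 'rV[R]_n) (w : 'cV[R[i]]_m.+1).
Hypotheses (oW : open W) (dE : forall t, W t -> differentiable E t)
  (EOm : forall t, W t -> Om (E t))
  (EH : forall t, W t -> forall X, holo (F (E t)) (N (E t)) X ->
     exists a, X = mderive (F \o E) t a)
  (w0 : w != 0) (Ew : forall t, W t -> F (E t) *m w = 0).

(** Differentiating [F w = 0] along the patch shows that every [X] in D kills [w]; [holo_kernel]
    then identifies the line of the normal with that of [w]. *)
Lemma patch_normal_line t : W t -> normal_line F N (E t) *m w = w.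
Proof.
move=> Wt; have Ot := EOm Wt; apply: (holo_kernel (CPF Ot) (TN Ot) (N1 Ot) (Ew Wt)) => X DX.
have [a ->] := EH Wt DX.
have [dFE _] := mdiff_comp (dE Wt) (dF Ot).
(* [mderive] applies to square matrices: [w] is completed into [w w^H], and a nonzero entry of [w]
   removes the extra factor at the end. *)
have [dw Dw] := mdiff_cst (w *m w^t*) t.
have [d D] := mdiffM dFE dw.
have Z : mderive (fun y => (F \o E) y *m (w *m w^t*)) t a = 0.
  have [d0 D0] := mdiff_cst (0 : mat) t.
  rewrite -(D0 a); apply: (near_mdiff _ d).2.
  apply: filterS (open_nbhs_nbhs (conj oW Wt)) => s Ws.
  by rewrite mulmxA /= (Ew Ws) mul0mx.
move: Z; rewrite D Dw mulmx0 addr0 mulmxA; set c := _ *m w => cw.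
have [j wj] : exists j, w j 0 != 0.
  apply: contrapT => H; move/eqP: w0; apply; apply/colP => j; rewrite mxE.
  by apply/eqP/negPn/negP => wj; apply: H; exists j.
apply/colP => i; have := congr1 (fun M : mat => M i j) cw; rewrite !mxE big_ord1 !mxE => /eqP.
by rewrite mulf_eq0 conjC_eq0 (negbTE wj) orbF => /eqP.
Qed.

(** At all points of the patch the projection onto the line of the normal fixes the same [w], so it
    is constant there; and every direction of D is a direction of the patch. *)
Lemma patch_form0 t : W t -> form0_at (E t).
Proof.
move=> Wt; have Ot := EOm Wt; apply: (normal_line_form0 Ot) => v Dv.
have [a aE] := EH Wt Dv.
have [_ DFE] := mdiff_comp (dE Wt) (dF Ot).
have va : v = 'D_a E t.
  apply/eqP; rewrite -subr_eq0; apply/eqP; apply: (nc_imm nc Ot).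
  rewrite -scaleN1r addrC (mderive_lin (dF Ot)) aE DFE.
  by rewrite [(-1)%:C]rmorphN scaleN1r addNr.
have dG : mdiff (normal_line F N) (E t) := msmooth_mdiff (normal_line_smooth nc) Ot.
have [dGE DGE] := mdiff_comp (dE Wt) dG.
rewrite va -DGE.
have [d0 D0] := mdiff_cst (normal_line F N (E t)) t.
rewrite -(D0 a); apply: (near_mdiff _ dGE).2.
apply: filterS (open_nbhs_nbhs (conj oW Wt)) => s Ws /=.
have Os := EOm Ws.
exact: (rank1_fixed (nproj_CP (CPF Os) (TN Os) (N1 Os)) (nproj_CP (CPF Ot) (TN Ot) (N1 Ot)) w0
  (patch_normal_line Ws) (patch_normal_line Wt)).
Qed.

End Patch.

(** For [X] in D, [A X] is a multiple of xi, which phi kills. Hence [F_X = 0] and both sides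
    vanish. *)
Lemma form0_pure u (A : mat -> mat) : Om u ->
  (forall v, A (mderive F u v) = chart_shape F N u v) -> form0_at u ->
  forall X Y, holo (F u) (N u) X -> holo (F u) (N u) Y ->
  cho_shape_at (F u) (N u) A (phi_at (F u) (N u) X) Y =
  cho_shape_at (F u) (N u) A X (phi_at (F u) (N u) Y).
Proof.
move=> Ou AE f0.
have A0 : A 0 = 0 by have := AE 0; rewrite mderive0 chart_shape0.
have phi0 X : holo (F u) (N u) X -> phi_at (F u) (N u) (A X) = 0.
  move=> DX; have [v vE] := holo_coord Ou DX; subst X.
  have [TA AN] := chart_shape_tang nc v Ou; rewrite -AE in TA AN.
  have HV Y : holo (F u) (N u) Y -> CP_metric (A (mderive F u v)) Y = 0.
    move=> DY; have [w wE] := holo_coord Ou DY; subst Y; rewrite AE.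
    by rewrite (chart_shape_form nc v w Ou) (f0 v w DX DY) oppr0.
  rewrite (orth_holo (CPF Ou) (TN Ou) (N1 Ou) TA AN HV).
  move: (CP_metric _ (CP_J (F u) (N u))) => c.
  rewrite /phi_at /eta_at /xi_at JZ (JJ (CPF Ou) (TN Ou)) metricZl metricNr.
  rewrite (metricJNN (CPF Ou) (TN Ou) (N1 Ou)) mulrN1 rmorphN scaleNr opprK.
  by rewrite scalerN addNr.
have ch X Y : holo (F u) (N u) X -> cho_shape_at (F u) (N u) A X Y = 0.
  move=> DX; rewrite /cho_shape_at /cho_at (phi0 X DX) !metric0l !scaler0 !scale0r subr0 A0.
  by rewrite subr0.
move=> X Y DX DY; rewrite (ch X) //; apply: ch.
have [TX XN XJ] := DX; rewrite /phi_at /eta_at /xi_at metricNr XJ oppr0 scale0r subr0.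
exact: (holoJ (CPF Ou) (TN Ou) DX).
Qed.


Section LevelPatch.
Hypothesis f0 : forall u, Om u -> form0_at u.
Variable (u0 : 'rV[R]_n).
Hypothesis O0 : Om u0.

Let level u : R := CP_metric (normal_line F N u) (xi_at (F u0) (N u0)).

Let dG u : Om u -> mdiff (normal_line F N) u.
Proof. exact: (msmooth_mdiff (normal_line_smooth nc)). Qed.

Let level_smooth : smooth_on Om level.
Proof. exact: (smooth_metric oOm (normal_line_smooth nc) (msmooth_cst _ _)). Qed.

Let levelD u v : Om u -> 'D_v level u =
  CP_metric (mderive (normal_line F N) u v) (xi_at (F u0) (N u0)).
Proof.
move=> Ou; have [dc Dc] := mdiff_cst (xi_at (F u0) (N u0)) u.
apply: (etrans ((metric_diff (dG Ou) dc).2 v)).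
by rewrite Dc metric0r addr0.
Qed.

Let level_diff u : Om u -> differentiable level u.
Proof. exact: smooth_diff. Qed.

Let level_holo u v : Om u -> holo (F u) (N u) (mderive F u v) -> 'D_v level u = 0.
Proof.
move=> Ou Dv; apply: (etrans (levelD v Ou)).
by rewrite (form0_normal_line Ou (f0 Ou) Dv) metric0l.
Qed.

Let level_xi e : mderive F u0 e = xi_field F N u0 -> 'D_e level u0 = -1.
Proof.
move=> eE; apply: (etrans (levelD e O0)).
rewrite (normal_line_derive nc e O0) eE xi_fieldE.
have := dnormal_eq nc e O0; rewrite eE xi_fieldE => H.
exact: (dnproj_xi (CPF O0) (TN O0) (N1 O0) (dnormal_adj nc e O0) H).
Qed.

(** The differential of [level] vanishes on D, so it is a multiple of eta; where it is nonzero the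
    two kernels agree. *)
Let level_kernel u e x : Om u -> 'D_e level u != 0 -> 'D_x level u = 0 ->
  holo (F u) (N u) (mderive F u x).
Proof.
move=> Ou e0 x0; apply: (proj2 (holo_etaP nc _ Ou)).
have [b bE] := xi_coord nc Ou.
have eta1 := eta_coord_xi nc Ou bE.
have key y : 'D_y level u = eta_coord F N y u * 'D_b level u.
  have H := eta_coord_lin nc 1 (- eta_coord F N y u) y b Ou.
  rewrite mul1r eta1 mulr1 addrN scale1r in H.
  have Dy := level_holo Ou (proj2 (holo_etaP nc _ Ou) H).
  rewrite addrC (derive_linear _ _ _ (level_diff Ou)) mulNr addrC in Dy.
  by apply/eqP; rewrite -subr_eq0; apply/eqP.
exact: (kernel_arith (key x) (key e) x0 e0).
Qed.

Lemma level_patch k : n = k.+1 -> exists2 r : R, 0 < r & exists E : 'rV[R]_k -> 'rV[R]_n,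
  [/\ smooth_on (ball 0 r) E, E 0 = u0, forall t, ball 0 r t -> Om (E t) &
   forall t, ball 0 r t -> (forall v, mderive (F \o E) t v = 0 -> v = 0) /\
     forall X, (exists v, X = mderive (F \o E) t v) <-> holo (F (E t)) (N (E t)) X].
Proof.
move=> nk; have [e eE] := xi_coord nc O0.
have e1 := level_xi eE.
(* The gradient of [level] at [u0]. The rows of [L] span its kernel, and [e], the coordinates of xi,
   is transverse to it; the patch is a graph over the kernel in the direction [e]. *)
pose d : 'cV[R]_n := \col_i 'D_(delta_mx 0 i) level u0.
have dE x : (x *m d) 0 0 = 'D_x level u0.
  rewrite (derivative_rV_sum _ (level_diff O0)) mxE; apply: eq_bigr => i _.
  by rewrite mxE.
have d0 : d != 0.
  apply/eqP => d0; have := dE e; rewrite d0 mulmx0 mxE e1 => /eqP.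
  by rewrite eq_sym oppr_eq0 oner_eq0.
have [L [fL Ld sL]] := hyperplane_basis nk d0.
have e0 : 'D_e level u0 != 0 by rewrite e1 oppr_eq0 oner_eq0.
have [r r0 [sg [sg0 ssg sE H]]] := implicit_function L oOm level_smooth O0 e0.
pose E t := u0 + t *m L + sg t *: e.
have ob : open (ball (0 : 'rV[R]_k) r) by exact: ball_open.
have dEt t : ball 0 r t -> differentiable E t by exact: smooth_diff.
have DE t v : ball 0 r t -> 'D_v E t = v *m L + 'D_v sg t *: e.
  by move=> bt; apply: derivative_affine_scale; exact: (smooth_diff ssg bt).
have levelE t v : ball 0 r t -> 'D_('D_v E t) level (E t) = 0.
  move=> bt; have [Ot _ _] := H t bt.
  rewrite -(derivative_comp v (dEt t bt) (level_diff Ot)).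
  rewrite (@near_eq_derive _ _ _ _ (cst (level u0))) ?derive_cst//.
  apply: filterS (open_nbhs_nbhs (conj ob bt)) => s bs.
  by have [_ + _] := H s bs.
exists r => //; exists E; split=> //.
- by rewrite /E mul0mx sg0 scale0r !addr0.
- by move=> t bt; have [] := H t bt.
move=> t bt; have [Ot _ et] := H t bt.
have [_ DFE] := mdiff_comp (dEt t bt) (dF Ot).
split=> [v|X].
  rewrite DFE => /(nc_imm nc Ot); rewrite DE// => vE.
  have := congr1 (fun M : 'rV[R]_n => (M *m d) 0 0) vE.
  rewrite mulmxDl -mulmxA Ld mulmx0 add0r -scalemxAl mul0mx mxE dE e1 mxE.
  rewrite mulrN1 => /eqP; rewrite oppr_eq0 => /eqP s0.
  move: vE; rewrite s0 scale0r addr0 => /eqP.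
  by rewrite mul_mx_rowfree_eq0// => /eqP.
split=> [[v ->]|DX].
  rewrite DFE; exact: (level_kernel Ot et (levelE t v bt)).
have [x xE] := holo_coord Ot DX.
(* The parameter direction [v] is found at [u0], by removing from [x] its component along [e]. Then
   [x] and ['D_v E t] differ by a multiple of [e]; it is zero because the differential of [level] at
   [E t] kills both, but not [e]. *)
pose c := 'D_x level u0 / 'D_e level u0.
have [v vE] : exists v, - c *: e + x = v *m L.
  apply: sL; apply/matrixP => i j; rewrite !ord1 dE [RHS]mxE.
  exact (etrans (derive_linear _ _ _ (level_diff O0)) (quotient_arith _ e0)).
exists v; rewrite DFE xE; congr (mderive F _ _); rewrite DE//.
pose q := 'D_v sg t.
have xvE : x = v *m L + c *: e by rewrite -vE addrAC scaleNr addNr add0r.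
have Dx : 'D_x level (E t) = 0 by apply: (level_holo Ot); rewrite -xE.
have xD : x = (c - q) *: e + 'D_v E t.
  rewrite DE// xvE -/q; move: (v *m L) => y.
  by apply/rowP => i; rewrite !mxE; ring.
have cq : c = q.
  have E1 := derive_linear (c - q) e ('D_v E t) (level_diff Ot).
  rewrite -xD Dx (levelE t v bt) in E1.
  exact: (coef_arith (esym E1) et).
by rewrite xvE cq.
Qed.

End LevelPatch.
End RuledChart.

(** * From charts to manifolds *)

Lemma within_open_preimage (S T : topologicalType) (A : set S) (h : S -> T) (O : set T) :
  open A -> {within A, continuous h} -> open O -> open (A `&` h @^-1` O).
Proof.
move=> oA; rewrite continuous_open_subspace// => ch oO.
rewrite openE => x [Ax Ox]; apply: filterI; first exact: open_nbhs_nbhs.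
by apply: (ch x (mem_set Ax)); exact: open_nbhs_nbhs.
Qed.

Lemma open_within_continuous (S T : topologicalType) (A : set S) (h : S -> T) :
  open A -> (forall x, A x -> {for x, continuous h}) -> {within A, continuous h}.
Proof.
by move=> oA ch; rewrite continuous_open_subspace// => x /set_mem; exact: ch.
Qed.

Section Manifold.
Variables (R : realType) (n : nat) (M : smooth_manifold R n).

Lemma atlas_chart (c : chart R n M) : atlas c -> is_chart c.
Proof. by case: M c => T At H1 H2 H3 H4 H5 c; exact: H3. Qed.

Lemma atlas_cover (q : M) : exists (c : chart R n M), atlas c /\ (c @` dom c) q.
Proof. by case: M q => T At H1 H2 H3 H4 H5 q; exact: H4. Qed.

Lemma atlas_transition (c c' : chart R n M) : atlas c -> atlas c' ->
  forall W, open W -> W `<=` dom c `&` c @^-1` (c' @` dom c') -> smooth_in_chart W c c'.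
Proof. by case: M c c' => T At H1 H2 H3 H4 H5 c c'; exact: H5. Qed.

Section Chart.
Variable c : chart R n M.
Hypothesis ac : atlas c.

Lemma chart_open : open (dom c). Proof. by case: (atlas_chart ac). Qed.

Lemma chart_inj u v : dom c u -> dom c v -> c u = c v -> u = v.
Proof.
case: (atlas_chart ac) => _ _ inj _ du dv; apply: inj; exact: mem_set.
Qed.

Lemma chart_image W : open W -> W `<=` dom c -> open (c @` W).
Proof. by case: (atlas_chart ac) => _ _ _; exact. Qed.

Lemma chart_preimage (O : set M) : open O -> open (dom c `&` c @^-1` O).
Proof.
by case: (atlas_chart ac) => oc cc _ _; exact: within_open_preimage.
Qed.

Lemma chart_continuous u : dom c u -> {for u, continuous c}.
Proof.
case: (atlas_chart ac) => oc cc _ _ du.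
by move: cc; rewrite continuous_open_subspace// => /(_ u (mem_set du)).
Qed.

End Chart.

Lemma chart_at (q : M) : exists (c : chart R n M) u, [/\ atlas c, dom c u & c u = q].
Proof. by have [c [ac [u du cu]]] := atlas_cover q; exists c, u. Qed.

Lemma transition (c c' : chart R n M) u : atlas c -> atlas c' -> dom c u ->
  (c' @` dom c') (c u) -> exists (W : set 'rV[R]_n) (e : 'rV[R]_n -> 'rV[R]_n),
  [/\ open W, W u, W `<=` dom c, smooth_on W e &
      forall v, W v -> dom c' (e v) /\ c' (e v) = c v].
Proof.
move=> ac ac' du c'u.
have oc' : open (c' @` dom c') by apply: (chart_image ac') => //; exact: chart_open.
have oW := chart_preimage ac oc'.
have [e [se H]] := atlas_transition ac ac' oW (@subset_refl _ _).
by exists (dom c `&` c @^-1` (c' @` dom c')), e; split=> // v [].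
Qed.

Lemma open_near_eq (V : normedModType R) (W : set V) (T : Type) (f g : V -> T) x :
  open W -> W x -> (forall y, W y -> f y = g y) -> \near x, f x = g x.
Proof. by move=> oW Wx H; exact: filterS H (open_nbhs_nbhs (conj oW Wx)). Qed.

Lemma mderive_transition p (h : M -> 'M[R[i]]_p) (c c' : chart R n M) u u' :
  atlas c -> atlas c' -> dom c u -> dom c' u' -> c u = c' u' -> mdiff (h \o c') u' ->
  exists e : 'rV[R]_n -> 'rV[R]_n, mdiff (h \o c) u /\
    forall v, mderive (h \o c) u v = mderive (h \o c') u' ('D_v e u).
Proof.
move=> ac ac' du du' cu dh.
have c'u : (c' @` dom c') (c u) by exists u'.
have [W [e [oW Wu _ se H]]] := transition ac ac' du c'u.
have eu : e u = u'.
  by have [d1 E1] := H _ Wu; apply: (chart_inj ac' d1 du'); rewrite E1.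
have de := smooth_diff se Wu.
rewrite -eu in dh.
have [d D] := mdiff_comp de dh.
have E : \near u, ((h \o c') \o e) u = (h \o c) u.
  by apply: (open_near_eq oW Wu) => y /H[_ E] /=; rewrite E.
have [d' D'] := near_mdiff E d.
by exists e; split=> // v; rewrite -D' D eu.
Qed.

End Manifold.

(** * Normals and the holomorphic distribution on the manifold *)

Section Hypersurface.
Variables (R : realType) (m : nat).
Local Notation mat := 'M[R[i]]_m.+1.
Local Notation hmanifold := (smooth_manifold R m.*2.-1).
Hypothesis m0 : (0 < m)%N.

Lemma hdim : (m.*2.-1).+1 = (m + m)%N.
Proof. by rewrite prednK ?double_gt0// addnn. Qed.

Section Fixed.
Variables (M : hmanifold) (f : M -> mat).
Hypothesis hf : real_hypersurface f.

Let fCP q : CP (f q). Proof. by case: hf. Qed.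

Lemma hs_smooth (c : chart R _ M) : atlas c -> msmooth_on (dom c) (f \o c).
Proof. by case: hf => _ _ H _; exact: H. Qed.

Lemma hs_mdiff (c : chart R _ M) u : atlas c -> dom c u -> mdiff (f \o c) u.
Proof. by move=> ac; exact: msmooth_mdiff (hs_smooth ac). Qed.

Lemma hs_imm (c : chart R _ M) u v : atlas c -> dom c u -> mderive (f \o c) u v = 0 -> v = 0.
Proof. by case: hf => _ _ _ H ac du; exact: H. Qed.

Lemma tangent_chart (c : chart R _ M) u X : atlas c -> dom c u ->
  tangent f (c u) X <-> exists v, X = mderive (f \o c) u v.
Proof.
move=> ac du; split=> [[c' [u' [v' [ac' du' cu' ->]]]]|[v ->]]; last by exists c, u, v.
have [e [_ E]] := mderive_transition ac' ac du' du cu' (hs_mdiff ac du).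
by exists ('D_v' e u'); rewrite E.
Qed.

(** [deriv_along] picks a value produced by some chart. Passing to the chart [c] changes the
    coordinates of the direction, and the immersion property forces the new ones to be [v], so all
    charts agree. *)
Lemma deriv_along_chart (h : M -> mat) (c : chart R _ M) u v : atlas c -> dom c u ->
  mdiff (h \o c) u -> deriv_along f h (c u) (mderive (f \o c) u v) = mderive (h \o c) u v.
Proof.
move=> ac du dh; rewrite /deriv_along; set S := [set Z | _].
have S0 : S (mderive (h \o c) u v) by exists c, u, v.
case: xgetP => [Z ZE SZ|H]; last by case: (H _ S0).
have [c' [u' [v' [ac' du' cu' fE hE]]]] := SZ.
rewrite -{}hE.
have [W [e [oW Wu _ se H]]] := transition ac' ac du' (ex_intro2 _ _ u du (esym cu')).
have eu : e u' = u.
  by have [d1 E1] := H _ Wu; apply: (chart_inj ac d1 du); rewrite E1.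
have de := smooth_diff se Wu.
have ch (g : M -> mat) : mdiff (g \o c) u -> mderive (g \o c') u' v' = mderive (g \o c) u ('D_v' e u').
  rewrite -eu => dg; have [d D] := mdiff_comp de dg.
  rewrite -D; apply: esym; apply: (near_mdiff _ d).2.
  by apply: (open_near_eq oW Wu) => y /H[_ E] /=; rewrite E.
rewrite (ch h dh); congr (mderive _ _ _).
rewrite (ch f (hs_mdiff ac du)) in fE.
apply/eqP; rewrite -subr_eq0; apply/eqP; apply: (hs_imm ac du).
rewrite -scaleN1r addrC (mderive_lin (hs_mdiff ac du)) fE.
by rewrite [(-1)%:C]rmorphN scaleN1r addNr.
Qed.

Lemma unit_normal_chart (c : chart R _ M) u N : atlas c -> dom c u ->
  unit_normal_at f (c u) N <-> [/\ CP_tangent (f (c u)) N, CP_metric N N = 1 &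
    forall v, CP_metric (mderive (f \o c) u v) N = 0].
Proof.
move=> ac du; split=> [[TN N1 H]|[TN N1 H]]; split=> //.
  by move=> v; apply: H; apply/(tangent_chart _ ac du); exists v.
by move=> X /(tangent_chart _ ac du)[v ->].
Qed.

Lemma field_chart (U : set M) N (c : chart R _ M) : open U -> unit_normal_field f U N ->
  atlas c -> normal_chart (dom c `&` c @^-1` U) (f \o c) (N \o c).
Proof.
move=> oU [sN HN] ac.
have un u : (dom c `&` c @^-1` U) u -> unit_normal_at f (c u) (N (c u)).
  by move=> [_ Uu]; exact: HN.
split.
- exact: chart_preimage.
- by apply: msmooth_sub (hs_smooth ac) => u [].
- by move=> u _; exact: fCP.
- by move=> u [du _] v; exact: hs_imm.
- exact: hdim.
- exact: sN.
- by move=> u /un[].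
- by move=> u /un[].
- by move=> u v Ou; have [du _] := Ou; have /(unit_normal_chart _ ac du)[_ _ H] := un u Ou.
Qed.

(** What remains of [N'] after removing its component along [N] is tangent to M by [normal_span],
    hence orthogonal to both normals, hence zero. *)
Lemma unit_normal_line q N N' : unit_normal_at f q N -> unit_normal_at f q N' ->
  (exists (U : set M) Nf, [/\ open U, U q, unit_normal_field f U Nf & Nf q = N]) ->
  exists2 a : R, N' = a%:C *: N & a * a = 1.
Proof.
move=> [TN N1 HN] [TN' N1' HN'] [U [Nf [oU Uq fN NE]]].
have [c [u [ac du cu]]] := chart_at q.
have nc := field_chart oU fN ac.
have Ou : (dom c `&` c @^-1` U) u by split=> //=; rewrite cu.
pose a := CP_metric N' N.
have TX : CP_tangent (f q) (N' - a%:C *: N) by apply: tangentB => //; exact: tangentZ.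
have XN : CP_metric (N' - a%:C *: N) N = 0 by rewrite metricBl metricZl N1 mulr1 subrr.
have tX : tangent f q (N' - a%:C *: N).
  rewrite -cu; apply/(tangent_chart _ ac du); apply: (normal_span nc Ou).
    by rewrite /= cu.
  by rewrite /= cu NE.
have NE' : N' = a%:C *: N.
  apply/eqP; rewrite -subr_eq0; apply/eqP; apply: (metric_eq0 (tangent_adj TX)).
  have H := HN' _ tX.
  have := metricBr (N' - a%:C *: N) N' (a%:C *: N).
  by rewrite H metricZr XN mulr0 subr0.
exists a => //; move: N1'; rewrite NE' metricZl metricZr N1 mulr1.
by [].
Qed.

Lemma local_normal_field q : exists (U : set M) N,
  [/\ open U, U q & unit_normal_field f U N].
Proof.
have [c [u0 [ac du0 cu0]]] := chart_at q.
have imm u : dom c u -> forall v, mderive (f \o c) u v = 0 -> v = 0.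
  by move=> du v; exact: hs_imm.
have [Om [N0 [oO OD Ou0 sN HN]]] := local_normal (chart_open ac) (hs_smooth ac)
  (fun u _ => fCP (c u)) imm hdim du0.
(* Inverse of the chart on [Om]; the default [u0] is only taken outside its image, where the field
   is not considered. *)
pose inv (p : M) := xget u0 [set u | Om u /\ c u = p].
have invc u : Om u -> inv (c u) = u.
  move=> Ou; rewrite /inv; case: xgetP => [v _ [Ov cv]|/(_ u)]; last by case.
  exact: (chart_inj ac (OD _ Ov) (OD _ Ou) cv).
pose U := c @` Om; pose N (p : M) := N0 (inv p).
have oU : open U by exact: chart_image.
exists U, N; split=> //; first by exists u0.
split=> [c' ac'|p [u Ou <-]].
  have oW := chart_preimage ac' oU.
  have WD : dom c' `&` c' @^-1` U `<=` dom c' `&` c' @^-1` (c @` dom c).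
    by move=> v [dv [u Ou uv]]; split=> //; exists u => //; exact: OD.
  have [e [se H]] := atlas_transition ac' ac oW WD.
  have eO v : (dom c' `&` c' @^-1` U) v -> Om (e v) /\ c (e v) = c' v.
    move=> Wv; have [de E] := H v Wv; split=> //; have [_ [u Ou uv]] := Wv.
    by rewrite (chart_inj ac de (OD _ Ou) (etrans E (esym uv))).
  apply: (msmooth_eq oW) (msmooth_comp oW oO (fun v Wv => (eO v Wv).1) se sN) => v Wv.
  by have [Oe E] := eO v Wv; rewrite /= /N -E invc.
apply/(unit_normal_chart _ ac (OD _ Ou)); rewrite /N invc//.
exact: HN.
Qed.

Lemma holo_distP (U : set M) N q X : open U -> U q -> unit_normal_field f U N ->
  holo_dist f q X <-> holo (f q) (N q) X.
Proof.
move=> oU Uq fN; have [c [u [ac du cu]]] := chart_at q.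
have nc := field_chart oU fN ac.
have Ou : (dom c `&` c @^-1` U) u by split=> //=; rewrite cu.
have un : unit_normal_at f q (N q) by case: fN => _; exact.
split=> [[tX H]|[TX XN XJ]].
  have [v XE] : exists v, X = mderive (f \o c) u v.
    by apply/(tangent_chart _ ac du); rewrite cu.
  split; [|by case: un => _ _; exact|].
    by rewrite XE -cu; exact: (chart_tangent nc v Ou).
  by apply/eqP; rewrite -oppr_eq0 -metricNr; apply/eqP; exact: H.
split.
  rewrite -cu; apply/(tangent_chart _ ac du); apply: (normal_span nc Ou).
    by rewrite /= cu.
  by rewrite /= cu.
move=> N' un'.
have [|a -> _] := unit_normal_line un un'; first by exists U, N.
by rewrite JZ metricNr metricZr XJ mulr0 oppr0.
Qed.

End Fixed.
End Hypersurface.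

Lemma double_pred2 m : (0 < m)%N -> m.*2.-1 = (m.*2 - 2).+1.
Proof. by case: m => // m _; rewrite doubleS /= subSS subn1. Qed.

(** * From the pointwise condition to ruled hypersurfaces *)

Section EtaPureRuled.
Variables (R : realType) (m : nat).
Local Notation mat := 'M[R[i]]_m.+1.
Local Notation hmanifold := (smooth_manifold R m.*2.-1).
Hypothesis m0 : (0 < m)%N.
Variables (M : hmanifold) (f : M -> mat).
Hypothesis hf : real_hypersurface f.

Lemma shape_chart (U : set M) N (c : chart R _ M) u v : open U -> unit_normal_field f U N ->
  atlas c -> (dom c `&` c @^-1` U) u ->
  shape f N (c u) (mderive (f \o c) u v) = chart_shape (f \o c) (N \o c) u v.
Proof.
move=> oU fN ac Ou; have [du _] := Ou; have [sN _] := fN.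
have oO := chart_preimage ac oU.
rewrite /shape /CP_nabla (deriv_along_chart hf _ ac du); last exact: (msmooth_mdiff (sN c ac) Ou).
exact (etrans (congr1 (fun X => - X) (chart_shapeE (f \o c) (N \o c) u v)) (opprK _)).
Qed.

Definition form0_everywhere := forall (U : set M) N (c : chart R _ M) u, open U ->
  unit_normal_field f U N -> atlas c -> (dom c `&` c @^-1` U) u ->
  form0_at (f \o c) (N \o c) u.

Lemma eta_pureP : eta_pure f <-> form0_everywhere.
Proof.
split=> [pure U N c u oU fN ac Ou v w Dv Dw|form U N oU fN q Uq X Y DX DY].
  have nc := field_chart m0 hf oU fN ac.
  pose A u := shape f N (c u).
  apply: (@eta_pure_form0 R m _ _ _ _ nc A _ _ u v w Ou Dv Dw).
    by move=> u' v' Ou'; exact: shape_chart oU fN ac Ou'.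
  move=> u' Ou' X Y DX DY; have [_ Uu'] := Ou'.
  apply: (pure U N oU fN (c u') Uu' X Y).
    exact: (proj2 (holo_distP m0 hf X oU Uu' fN) DX).
  exact: (proj2 (holo_distP m0 hf Y oU Uu' fN) DY).
have [c [u [ac du cu]]] := chart_at q.
have Ou : (dom c `&` c @^-1` U) u by split=> //=; rewrite cu.
have nc := field_chart m0 hf oU fN ac.
have {}DX := proj1 (holo_distP m0 hf X oU Uq fN) DX.
have {}DY := proj1 (holo_distP m0 hf Y oU Uq fN) DY.
subst q.
exact: (form0_pure nc Ou (fun v => shape_chart v oU fN ac Ou) (form U N c u oU fN ac Ou) DX DY).
Qed.

Hypothesis form : form0_everywhere.

Lemma integral_patch_exists q : exists W y, integral_patch f W y /\ (y @` W) q.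
Proof.
have [U [N [oU Uq fN]]] := local_normal_field m0 hf q.
have [c [u [ac du cu]]] := chart_at q.
have Ou : (dom c `&` c @^-1` U) u by split=> //=; rewrite cu.
have nc := field_chart m0 hf oU fN ac.
have f0 v : (dom c `&` c @^-1` U) v -> form0_at (f \o c) (N \o c) v.
  by move=> Ov; exact: form oU fN ac Ov.
have [r r0 [E [sE E0 EO HE]]] := level_patch nc f0 Ou (double_pred2 m0).
have ob : open (ball (0 : 'rV[R]_(m.*2 - 2)) r) by exact: ball_open.
have cy t : ball 0 r t -> {for t, continuous (c \o E)}.
  move=> bt; have [dE _] := EO t bt; apply: continuous_comp.
    by apply: differentiable_continuous; exact: (smooth_diff sE bt).
  exact: chart_continuous.
exists (ball 0 r), (c \o E); split; last first.
  by exists 0; [exact: ballxx|rewrite /= E0].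
split=> //.
- exact: connected_ball.
- split; first exact: open_within_continuous.
  move=> c' ac' W oW sW.
  have oV : open (dom c `&` c @^-1` (c' @` dom c')).
    by apply: chart_preimage => //; apply: (chart_image ac') => //; exact: chart_open.
  have [e [se He]] := atlas_transition ac ac' oV (@subset_refl _ _).
  have EV t : W t -> (dom c `&` c @^-1` (c' @` dom c')) (E t).
    by move=> /sW[bt Et]; split=> //; have [] := EO t bt.
  have sEW : smooth_on W E by apply: smooth_sub sE => t /sW[].
  exists (e \o E); split; first exact: (smooth_comp_rV oW oV EV sEW se).
  by move=> t /EV /He.
- move=> t bt; have [inj rng] := HE t bt; split; first exact: inj.
  have Ot := EO t bt; have [_ UE] := Ot.
  apply/seteqP; split=> [X [v _ <-]|X DX].
    apply: (proj2 (holo_distP m0 hf _ oU UE fN)).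
    by apply: (proj1 (rng _)); exists v.
  have [v ->] := proj2 (rng X) (proj1 (holo_distP m0 hf X oU UE fN) DX).
  by exists v.
Qed.

Lemma integral_patch_hyperplane W y : integral_patch f W y ->
  exists w, w != 0 /\ (f \o y) @` W `<=` CP_hyperplane w.
Proof.
move=> [oW cW sy Hy].
(* On an empty patch any nonzero vector will do. *)
have [[t0 Wt0]|W0] := pselect (exists t, W t); last first.
  exists (const_mx 1); split.
    apply/eqP => /matrixP/(_ 0 0); rewrite !mxE => /eqP.
    by rewrite oner_eq0.
  by move=> P [t Wt _]; case: W0; exists t.
(* As [N P N] is unchanged under [N |-> - N], an arbitrary choice of unit normals gives a global map
   that agrees with the one of any local smooth field. *)
pose G q := nproj (f q) (xget 0 [set N | unit_normal_at f q N]).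
have GE (U : set M) N q : open U -> unit_normal_field f U N -> U q -> G q = nproj (f q) (N q).
  move=> oU fN Uq; have un : unit_normal_at f q (N q) by case: fN => _; exact.
  rewrite /G; case: xgetP => [N' _ un'|/(_ (N q))]; last by case.
  have [|a -> a1] := unit_normal_line m0 hf un un'; first by exists U, N.
  rewrite /nproj -!scalemxAl -scalemxAr scalerA.
  by rewrite -rmorphM a1 scale1r.
have dG t : W t -> mdiff (G \o y) t /\ forall v, mderive (G \o y) t v = 0.
  move=> Wt; have [U [N [oU Uq fN]]] := local_normal_field m0 hf (y t).
  have [c [u [ac du cu]]] := chart_at (y t).
  have nc := field_chart m0 hf oU fN ac.
  have [cy sy'] := sy.
  pose O := c @` (dom c `&` c @^-1` U).
  have oD := chart_preimage ac oU.
  have oO : open O by apply: (chart_image ac) => // v [].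
  have oW1 : open (W `&` y @^-1` O) by exact: within_open_preimage.
  have W1t : (W `&` y @^-1` O) t by split=> //; exists u => //; split=> //=; rewrite cu.
  have W1D : W `&` y @^-1` O `<=` W `&` y @^-1` (c @` dom c).
    by move=> s [Ws [v [dv _] vE]]; split=> //; exists v.
  have [e [se He]] := sy' c ac _ oW1 W1D.
  have eO s : (W `&` y @^-1` O) s -> (dom c `&` c @^-1` U) (e s).
    move=> W1s; have [de E] := He s W1s; have [_ [v [dv Uv] vE]] := W1s.
    by split=> //=; rewrite E -vE.
  have de := smooth_diff se W1t.
  have Oe := eO t W1t.
  have dn := msmooth_mdiff (normal_line_smooth nc) Oe.
  have [d D] := mdiff_comp de dn.
  have E1 : \near t, (normal_line (f \o c) (N \o c) \o e) t = (G \o y) t.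
    apply: (open_near_eq oW1 W1t) => s W1s /=.
    have [des E] := He s W1s; have [_ Us] := eO s W1s.
    by rewrite (GE U N (y s) oU fN) -E.
  have [d' D'] := near_mdiff E1 d.
  split=> // v; rewrite -D' D; apply: (form0_normal_line nc Oe (form oU fN ac Oe)).
  have [_ DF] := mdiff_comp de (hs_mdiff hf ac Oe.1).
  have E2 : mderive (f \o c) (e t) ('D_v e t) = mderive (f \o y) t v.
    rewrite -DF; apply: (near_mdiff _ (mdiff_comp de (hs_mdiff hf ac Oe.1)).1).2.
    by apply: (open_near_eq oW1 W1t) => s /He[_ E] /=; rewrite E.
  rewrite E2; have [_ Et] := He t W1t.
  have : holo_dist f (y t) (mderive (f \o y) t v) by rewrite -(Hy t Wt).2; exists v.
  by move=> /(holo_distP m0 hf _ oU Uq fN); rewrite /= Et.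
have Gc t : W t -> G (y t) = G (y t0).
  move=> Wt; apply/matrixP => i j; apply: complex_eq.
    apply: (derivative0_connected oW cW _ _ Wt Wt0 (f := fun t => complex.Re (G (y t) i j) : R)).
      by move=> s Ws; have [] := (dG s Ws).1 i j.
    move=> s Ws v; have := congr1 (fun M : mat => complex.Re (M i j)) ((dG s Ws).2 v).
    by rewrite mderiveE mxE.
  apply: (derivative0_connected oW cW _ _ Wt Wt0 (f := fun t => complex.Im (G (y t) i j) : R)).
    by move=> s Ws; have [] := (dG s Ws).1 i j.
  move=> s Ws v; have := congr1 (fun M : mat => complex.Im (M i j)) ((dG s Ws).2 v).
  by rewrite mderiveE mxE.
have GP t : W t -> CP (G (y t)) /\ f (y t) *m G (y t) = 0.
  move=> Wt; have [U [N [oU Uq fN]]] := local_normal_field m0 hf (y t).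
  have [TN N1 _] : unit_normal_at f (y t) (N (y t)) by case: fN => _; exact.
  have CPf : CP (f (y t)) by case: hf.
  rewrite (GE U N _ oU fN Uq); split; first exact: nproj_CP.
  exact: P_nproj.
(* The hyperplane is the one orthogonal to the common line of the projections [G], since [f G = 0]
   along the patch. *)
have [z [z0 Gz]] := CP_neq0 (GP t0 Wt0).1.
exists z; split=> // P [t Wt <-]; split; first by case: hf => _ H _ _; exact: H.
by rewrite /= -Gz -(Gc t Wt) mulmxA (GP t Wt).2 mul0mx.
Qed.

Lemma form0_ruled : ruled f.
Proof. by split; [exact: integral_patch_exists|exact: integral_patch_hyperplane]. Qed.

Lemma ruled_congruent_self : ruled f -> locally_congruent_to_ruled f.
Proof.
move=> rf q; exists M, f; split=> //.
have sid : smooth_map_on setT (id : M -> M).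
  split; first by apply: open_within_continuous; [exact: openT|move=> x _; exact: cvg_id].
  move=> c c' ac ac' W oW sW; apply: (atlas_transition ac ac' oW).
  by move=> u /sW[du [_ c'u]].
exists id, setT, setT, id; split=> //.
- exists 1%:M; split.
    by apply/unitarymxP; rewrite adj1 mulmx1.
  by left => P; rewrite adj1 mulmx1 mul1mx.
- by split=> //; exact: openT.
- exact: openT.
- by exists id; split.
Qed.

End EtaPureRuled.

(** * Transport of integral patches along a congruence *)

Section CongruentRuled.
Variables (R : realType) (m : nat).
Local Notation mat := 'M[R[i]]_m.+1.
Local Notation hmanifold := (smooth_manifold R m.*2.-1).
Hypothesis m0 : (0 < m)%N.
Variables (M M' : hmanifold) (f : M -> mat) (f' : M' -> mat).
Hypotheses (hf : real_hypersurface f) (hf' : real_hypersurface f').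
Variables (Psi : mat -> mat) (U1 : set M) (U' : set M') (h : M -> M').
Hypotheses (iso : CP_isometry Psi) (oU1 : open U1) (oU' : open U')
  (hfh : forall p, U1 p -> f' (h p) = Psi (f p)).

Lemma smooth_map_chart (n n' : nat) (X : smooth_manifold R n) (X' : smooth_manifold R n')
    (O : set X) (g : X -> X') (c : chart R n X) (c' : chart R n' X') u :
  open O -> smooth_map_on O g -> atlas c -> atlas c' -> dom c u -> O (c u) ->
  (c' @` dom c') (g (c u)) -> exists (W : set 'rV[R]_n) (e : 'rV[R]_n -> 'rV[R]_n'),
  [/\ open W, W u, W `<=` dom c `&` c @^-1` O, smooth_on W e &
      forall v, W v -> dom c' (e v) /\ c' (e v) = g (c v)].
Proof.
move=> oO [cg sg] ac ac' du Ou gu.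
have oc' : open (c' @` dom c') by apply: (chart_image ac') => //; exact: chart_open.
have oV := within_open_preimage oO cg oc'.
have oW := chart_preimage ac oV.
have [e [se He]] := sg c c' ac ac' _ oW (@subset_refl _ _).
by exists (dom c `&` c @^-1` (O `&` g @^-1` (c' @` dom c'))), e; split=> // v [dv []].
Qed.

Lemma congruent_tangent p X : smooth_map_on U1 h -> U1 p ->
  tangent f p X -> tangent f' (h p) (Psi X).
Proof.
move=> sh Up; have [c [u [ac du cu]]] := chart_at p; rewrite -cu in Up *.
move=> /(tangent_chart hf _ ac du)[v ->].
have [c' [u' [ac' du' cu']]] := chart_at (h (c u)).
have hu : (c' @` dom c') (h (c u)) by exists u'.
have [W [e [oW Wu WU se He]]] := smooth_map_chart oU1 sh ac ac' du Up hu.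
have [deu ceu] := He u Wu.
have eu : e u = u' by apply: (chart_inj ac' deu du'); rewrite ceu cu'.
have de := smooth_diff se Wu.
have df' := hs_mdiff hf' ac' deu.
have [d D] := mdiff_comp de df'.
have [dP DP] := isometry_mderive iso (hs_mdiff hf ac du).
rewrite -cu' -eu; apply/(tangent_chart hf' _ ac' deu); exists ('D_v e u).
rewrite -D -DP; apply: esym; apply: (near_mdiff _ d).2.
apply: (open_near_eq oW Wu) => y Wy /=; have [_ ->] := He y Wy.
by apply: hfh; have [] := WU y Wy.
Qed.

(** The inverse isometry turns a unit normal of the image into one of M, against which [X] can be
    tested. The possible sign of J does not affect the vanishing of the product. *)
Lemma congruent_holo_dist p X : smooth_map_on U1 h -> U1 p ->
  holo_dist f p X -> holo_dist f' (h p) (Psi X).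
Proof.
move=> sh Up [tX HX]; split; first exact: congruent_tangent.
have [Phi [isoP K1 K2]] := isometry_inv iso.
move=> n' [Tn' n1' Hn'].
have fE : f p = Phi (f' (h p)) by rewrite hfh// K1.
have un : unit_normal_at f p (Phi n').
  split.
  - by rewrite fE; exact: isometry_tangent.
  - by rewrite (isometry_metric isoP).
  - move=> Y tY; rewrite -(isometry_metric iso) K2.
    exact: (Hn' _ (congruent_tangent sh Up tY)).
have := HX _ un; rewrite !metricNr => /eqP; rewrite oppr_eq0 => /eqP H.
apply/eqP; rewrite oppr_eq0; apply/eqP.
rewrite -(isometry_metric isoP) K1.
case: (isometry_J isoP) => HJ; move: H; rewrite fE HJ//.
by rewrite metricNr => /eqP; rewrite oppr_eq0 => /eqP.
Qed.

(** An integral patch of the ruled hypersurface through [h q] is carried into the chart [c] by [h'],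
    its hyperplane by the inverse isometry, and [patch_form0] applies to the result. *)
Lemma congruent_ruled_form0 q (U : set M) N (c : chart R _ M) u :
  diffeo_on U1 U' h -> ruled f' -> U1 q -> c u = q -> open U ->
  unit_normal_field f U N -> atlas c -> (dom c `&` c @^-1` U) u ->
  form0_at (f \o c) (N \o c) u.
Proof.
move=> [h' [sh sh' K1 K2]] [patches planes] U1q cu oU fN ac Ou.
have nc := field_chart m0 hf oU fN ac.
have [du Uu] := Ou.
have [U'hq h'hq] := K1 q U1q.
have [W0 [y [Wy [t0 W0t yt0]]]] := patches (h q).
have [w' [w'0 Hw']] := planes W0 y Wy.
have [oW0 _ sy Hy] := Wy.
have [c' [u' [ac' du' cu']]] := chart_at (h q).
have cu'U : U' (c' u') by rewrite cu'.
have [cy sy'] := sy.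
(* c o ep = h' o c' near u' *)
have h'u : (c @` dom c) (h' (c' u')) by exists u => //; rewrite cu' h'hq.
have [V [ep [oV Vu' VU sep Hep]]] := smooth_map_chart oU' sh' ac' ac du' cu'U h'u.
have oD := chart_preimage ac oU.
have epu : ep u' = u.
  have [d1 E1] := Hep u' Vu'; apply: (chart_inj ac d1 du).
  by rewrite E1 cu' h'hq cu.
pose V1 := V `&` ep @^-1` (dom c `&` c @^-1` U).
have oV1 : open V1.
  apply: within_open_preimage => //; apply: open_within_continuous => // v Vv.
  by apply: differentiable_continuous; exact: (smooth_diff sep Vv).
have V1u : V1 u' by split=> //; rewrite /= epu.
have V1d : V1 `<=` dom c' by move=> v [/VU[]].
pose O := c' @` V1.
have oO : open O by exact: chart_image.
(* The patch is cut down to the domain of the charts; its hyperplane has been found beforehand, for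
   the whole connected patch. *)
pose W := W0 `&` y @^-1` O.
have oW : open W by exact: within_open_preimage.
have Wt0 : W t0 by split=> //; rewrite /= yt0; exists u'.
have WD : W `<=` W0 `&` y @^-1` (c' @` dom c').
  by move=> s [Ws [v Vv vE]]; split=> //; exists v => //; exact: V1d.
have [e' [se' He']] := sy' c' ac' W oW WD.
have e'V s : W s -> V1 (e' s).
  move=> Ws; have [de E] := He' s Ws; have [_ [v Vv vE]] := Ws.
  by rewrite (chart_inj ac' de (V1d _ Vv) (etrans E (esym vE))).
pose E := ep \o e'.
have sE : smooth_on W E.
  by apply: (smooth_comp_rV oW oV1 e'V se'); apply: smooth_sub sep => v [].
have EO s : W s -> (dom c `&` c @^-1` U) (E s) by move=> /e'V[].
have cE s : W s -> c (E s) = h' (y s).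
  move=> Ws; have [Vs _] := e'V s Ws; have [_ ->] := Hep _ Vs.
  by have [_ ->] := He' s Ws.
have U'y s : W s -> U' (y s).
  move=> Ws; have [Vs _] := e'V s Ws; have [_ Ue] := VU _ Vs.
  by move: Ue => /=; have [_ ->] := He' s Ws.
have [Phi [isoP P1 P2]] := isometry_inv iso.
have fE s : W s -> f (c (E s)) = Phi (f' (y s)).
  move=> Ws; have [U1h hh'] := K2 _ (U'y s Ws).
  by rewrite (cE s Ws) -{2}hh' hfh// P1.
have [w w0 Hw] := isometry_hyperplane isoP w'0.
have Et0 : E t0 = u.
  have [d1 _] := EO t0 Wt0; apply: (chart_inj ac d1 du).
  by rewrite (cE _ Wt0) yt0 h'hq cu.
rewrite -Et0.
apply: (@patch_form0 R m _ _ _ _ nc _ W E w oW) => //.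
- by move=> s Ws; exact: (smooth_diff sE Ws).
(* [Psi X] lies in the distribution of the ruled hypersurface, hence is a derivative of [y], and the
   inverse isometry brings it back to a derivative of [E] in the chart. *)
- move=> s Ws X DX; have [_ Us] := EO s Ws.
  have [U1h hh'] := K2 _ (U'y s Ws); have [W0s _] := Ws.
  have HX : holo_dist f (c (E s)) X := proj2 (holo_distP m0 hf X oU Us fN) DX.
  have U1c : U1 (c (E s)) by rewrite (cE s Ws).
  have := congruent_holo_dist sh U1c HX.
  rewrite (cE s Ws) hh' -(Hy s W0s).2 => -[a _ aE].
  exists a; rewrite -(P1 X) -aE.
  have de' := smooth_diff se' Ws.
  have [des Es] := He' s Ws.
  have [d1 D1] := mdiff_comp de' (hs_mdiff hf' ac' des).
  have E1 : \near s, ((f' \o c') \o e') s = (f' \o y) s.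
    by apply: (open_near_eq oW Ws) => z Wz /=; have [_ ->] := He' z Wz.
  have [d2 D2] := near_mdiff E1 d1.
  have [d3 D3] := isometry_mderive isoP d2.
  rewrite -D3; apply: (near_mdiff _ d3).2.
  by apply: (open_near_eq oW Ws) => z Wz /=; rewrite fE.
- move=> s Ws; rewrite /= (fE s Ws); apply: Hw.
  have [W0s _] := Ws; have : ((f' \o y) @` W0) (f' (y s)) by exists s.
  by move=> /Hw'[].
Qed.

End CongruentRuled.

Theorem theorem1 (R : realType) (m : nat) (hm : (3 <= m)%N)
    (M : smooth_manifold R m.*2.-1) (f : M -> 'M[R[i]]_m.+1)
    (hM : real_hypersurface f) :
  eta_pure f <-> locally_congruent_to_ruled f.
Proof.
have m0 : (0 < m)%N by exact: leq_trans hm.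
split=> [/(eta_pureP m0 hM) form|congr].
  exact/ruled_congruent_self/(form0_ruled m0 hM form).
apply/(eta_pureP m0 hM) => U N c u oU fN ac Ou.
have [M' [f' [hf' rf' [Psi [U1 [U' [h [iso [oU1 U1q] oU' dh hfh]]]]]]]] := congr (c u).
exact: (congruent_ruled_form0 m0 hM hf' iso oU1 oU' hfh dh rf' U1q (erefl _) oU fN ac Ou).
Qed.
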